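(* Let $X$ be a separable infinite-dimensional Banach space such that $SP_w(X)$ is countable and such that $SP_w(Y^* )$ is countable for every infinite-dimensional closed subspace $Y$ of $X$. Then every spreading model $(\tilde e_i)$ of $X$ generated by a normalized weakly null sequence is equivalent to the unit vector basis of $c_0$ or of $\ell_p$ for some $1\le p<\infty$.
   Context: A normalized basic sequence $(x_i)$ in a Banach space $X$ generates a spreading model $(\tilde x_i)$ if there exist $\varepsilon_n\downarrow 0$ such that for all $n$, all $(a_i)_{i=1}^n\subseteq[-1,1]$ and all $n\le k_1<\cdots<k_n$, $(1+\varepsilon_n)^{-1}\|\sum_{i=1}^n a_i\tilde x_i\|\le\|\sum_{i=1}^n a_ix_{k_i}\|\le(1+\varepsilon_n)\|\sum_{i=1}^n a_i\tilde x_i\|$. Two sequences $(u_i),(v_i)$ are equivalent if there is $C<\infty$ with $C^{-1}\|\sum a_iv_i\|\le\|\sum a_iu_i\|\le C\|\sum a_iv_i\|$ for all finitely supported scalars $(a_i)$. $SP_w(Z)$ denotes the set of equivalence classes of spreading models generated by normalized weakly null sequences in the Banach space $Z$. *)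

(* Defs.v *)
From HB Require Import structures.
From mathcomp Require Import all_boot all_order all_algebra.
From mathcomp Require Import all_classical all_reals all_analysis.
Set Implicit Arguments. Unset Strict Implicit. Unset Printing Implicit Defensive.
Import Order.TTheory GRing.Theory Num.Theory.
Import numFieldNormedType.Exports.
Local Open Scope classical_set_scope.
Local Open Scope ring_scope.

(* Generic notions for a normed space presented as a linear subspace S of an *)
(* lmodType V together with a norm nv.  This lets us treat X itself          *)
(* (V := X, S := setT, nv := normr) and the dual Y^* of a subspace Y of X    *)
(* (V := X -> R, S := bounded linear functionals on Y, nv := dual norm)      *)
(* uniformly.                                                                *)
Section Generic.
Variables (R : realType) (V : lmodType R) (S : set V) (nv : V -> R).

Definition bounded_functional (Phi : V -> R) : Prop :=
  (forall (c : R) (u v : V), S u -> S v -> Phi (c *: u + v) = c * Phi u + Phi v) /\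
  exists C : R, forall u, S u -> `|Phi u| <= C * nv u.

Definition weakly_null (x : nat -> V) : Prop :=
  forall Phi : V -> R, bounded_functional Phi ->
    (fun n => Phi (x n)) @ \oo --> (0 : R).

Definition normalized (x : nat -> V) : Prop :=
  forall n, S (x n) /\ nv (x n) = 1.

Definition in_closed_span (x : nat -> V) (z : V) : Prop :=
  forall e : R, 0 < e -> exists (n : nat) (a : 'I_n -> R),
    nv (z - \sum_(i < n) a i *: x i) < e.

Definition series_to (x : nat -> V) (a : nat -> R) (z : V) : Prop :=
  (fun N => nv (z - \sum_(i < N) a i *: x i)) @ \oo --> (0 : R).

Definition basic (x : nat -> V) : Prop :=
  (forall n, S (x n)) /\
  forall z, S z -> in_closed_span x z -> exists! a : nat -> R, series_to x a z.

Definition generates_spreading_model (x : nat -> V)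
    (E : normedModType R) (xt : nat -> E) : Prop :=
  normalized x /\ basic x /\
  exists eps : nat -> R,
    {homo eps : m n / (m <= n)%N >-> n <= m} /\ eps @ \oo --> (0 : R) /\
    forall (n : nat) (a : 'I_n -> R) (k : 'I_n -> nat),
      (forall i, -1 <= a i <= 1) ->
      (forall i, (n <= k i)%N) ->
      (forall i j : 'I_n, (i < j)%N -> (k i < k j)%N) ->
      (1 + eps n)^-1 * `|\sum_(i < n) a i *: xt i|
        <= nv (\sum_(i < n) a i *: x (k i))
        <= (1 + eps n) * `|\sum_(i < n) a i *: xt i|.

Definition is_SPw (E : normedModType R) (xt : nat -> E) : Prop :=
  exists x : nat -> V, weakly_null x /\ generates_spreading_model x xt.

End Generic.

Definition seq_equiv (R : realType) (E F : normedModType R)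
    (u : nat -> E) (v : nat -> F) : Prop :=
  exists C : R, 0 < C /\ forall (n : nat) (a : 'I_n -> R),
    C^-1 * `|\sum_(i < n) a i *: v i| <= `|\sum_(i < n) a i *: u i|
      <= C * `|\sum_(i < n) a i *: v i|.

(* SP_w is countable: countably many (Banach-space) sequences represent all
   equivalence classes of spreading models generated by normalized weakly
   null sequences. *)
Definition SPw_countable (R : realType) (V : lmodType R) (S : set V)
    (nv : V -> R) : Prop :=
  exists (E : nat -> completeNormedModType R) (u : forall k, nat -> E k),
    forall (F : completeNormedModType R) (xt : nat -> F),
      is_SPw S nv xt -> exists k, seq_equiv xt (u k).

(* equivalence to a sequence whose finite linear combinations have the given
   norm N n a = || sum_{i<n} a_i e_i || *)
Definition equiv_to_coeff_norm (R : realType) (E : normedModType R)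
    (u : nat -> E) (N : forall n : nat, ('I_n -> R) -> R) : Prop :=
  exists C : R, 0 < C /\ forall (n : nat) (a : 'I_n -> R),
    C^-1 * N n a <= `|\sum_(i < n) a i *: u i| <= C * N n a.

Definition c0_norm (R : realType) (n : nat) (a : 'I_n -> R) : R :=
  \big[Num.max/0]_(i < n) `|a i|.

Definition lp_norm (R : realType) (p : R) (n : nat) (a : 'I_n -> R) : R :=
  (\sum_(i < n) `|a i| `^ p) `^ p^-1.

Definition infinite_dimensional (R : realType) (X : lmodType R) (Y : set X) : Prop :=
  forall n : nat, exists v : 'I_n -> X, (forall i, Y (v i)) /\
    forall a : 'I_n -> R, \sum_(i < n) a i *: v i = 0 -> forall i, a i = 0.

Definition separable (R : realType) (X : normedModType R) : Prop :=
  exists d : nat -> X, closure (range d) = setT.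

Definition closed_subspace (R : realType) (X : normedModType R) (Y : set X) : Prop :=
  closed Y /\ Y 0 /\ forall (c : R) (u v : X), Y u -> Y v -> Y (c *: u + v).

(* Y^*: bounded linear functionals on Y, represented as functions X -> R
   vanishing outside Y *)
Definition dual_space (R : realType) (X : normedModType R) (Y : set X) : set (X -> R) :=
  fun f => (forall y, ~ Y y -> f y = 0) /\
    (forall (c : R) (u v : X), Y u -> Y v -> f (c *: u + v) = c * f u + f v) /\
    exists C : R, forall y, Y y -> `|f y| <= C * `|y|.

Definition dual_norm (R : realType) (X : normedModType R) (Y : set X) (f : X -> R) : R :=
  sup [set `|f y| | y in [set y | Y y /\ `|y| <= 1]].

(* Main.v *)
Require Import Defs.
From HB Require Import structures.
From mathcomp Require Import all_boot all_order all_algebra.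
From mathcomp Require Import all_classical all_reals all_analysis.
From mathcomp Require Import ring lra zify.
Import Order.TTheory GRing.Theory Num.Theory.
Import numFieldNormedType.Exports.
Local Open Scope classical_set_scope.
Local Open Scope ring_scope.

(** Vectors of finite support are coded as polynomials.  Let [p] be the norm of a
spreading model [e] generated by a normalized weakly null sequence [x], and write
[b (x) a] for the sum of successive copies of [a] with coefficients [b].  For every
[a] in the closed span of [e] the successive copies of [a] form again a spreading
model of the space.  If there are only countably many classes, a gliding hump
argument yields one such [a0] dominating all of them:
[p (b (x) a) <= C p(a) p(b (x) a0)]; cutting off the tail of [a0] gives
[p (b (x) a) <= C p(a) p(b)].

A subsequence of [x] is Schreier unconditional, so that the coefficient functionals
on its closed span [Y] have a spreading model equivalent to the dual norm of [p];
they are weakly null in [Y^*] unless [p] is bounded on sums of basis vectors, in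
which case [e] is equivalent to the basis of [c_0].  The same argument in [Y^*]
then gives [p(a) p(b) <= C p (b (x) a)] by duality.

Finally, a multiplicative spreading norm is an [l_r] norm: [p] of a sum of [n]
basis vectors behaves like a power of [n], and a vector with dyadic coefficients is
compared with the [l_r] norm through its tensor powers, whose number of level sets
grows only linearly with the exponent. *)

Set Implicit Arguments.
Unset Strict Implicit.
Unset Printing Implicit Defensive.

(** * Hahn-Banach theorem *)

(** A weakly null sequence may fail to have an unconditional subsequence. A spreading model,
    however, only sees vectors with few coordinates placed far out, so Schreier unconditionality is
    already enough to make [p] unconditional and to bound the dual norm from above far out.
    Ramsey-type selections are replaced by a free ultrafilter: limits are iterated along it, and the
    next index of a subsequence only has to meet finitely many conditions fixed by its predecessors,
    each holding on a set of the ultrafilter. The vector [a0] is never formed. It is a series of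
    blocks, known through the limits [Q b] of the norms of its truncations, and its copies in the
    space are truncated later and later. Countability can be applied to [Q] only after [Q] has been
    realized as the norm of a genuine spreading model in a Banach space. Duality works because the
    pairing is multiplicative on products: norming functionals of [a] and [b] can be multiplied, and
    submultiplicativity of the dual model bounds the norm of their product. The numerical constants
    come from crossing between the space and its model by factors 2; none is meant to be sharp. *)

Section HahnBanach.
Variables (R : realType) (V : lmodType R).

Definition sublinear (q : V -> R) : Prop :=
  (forall x y, q (x + y) <= q x + q y) /\
  (forall (c : R) x, 0 <= c -> q (c *: x) = c * q x).

Definition linear_functional (f : V -> R) : Prop :=
  forall (c : R) x y, f (c *: x + y) = c * f x + f y.

Lemma sublinear0 q : sublinear q -> q 0 = 0.
Proof. by move=> [_ /(_ 0 0 (lexx _))]; rewrite scaler0 mul0r. Qed.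

Lemma sublinear_geN q x : sublinear q -> - q (- x) <= q x.
Proof.
move=> qs; have := qs.1 x (- x); rewrite subrr (sublinear0 qs); lra.
Qed.

Lemma inf_lbP (A : set R) (b : R) : A !=set0 -> (forall a, A a -> b <= a) ->
  b <= inf A /\ (forall a, A a -> inf A <= a) /\
  (forall e : R, inf A < e -> exists2 a, A a & a < e).
Proof.
move=> A0 Ab; have hA : has_inf A by split=> //; exists b.
split; first by apply: lb_le_inf.
split; first by move=> a Aa; exact: (ge_inf hA.2).
by move=> e; apply: (inf_lt A0).
Qed.

Let step (q : V -> R) (v x : V) : set R := [set q (x + t *: v) - t * q v | t in [set t | 0 <= t]].

Lemma step_sublinear q v : sublinear q ->
  sublinear (fun x => inf (step q v x)) /\
  (forall x (t : R), 0 <= t -> inf (step q v x) <= q (x + t *: v) - t * q v).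
Proof.
move=> qs.
have H x : - q (- x) <= inf (step q v x) /\
    (forall a, step q v x a -> inf (step q v x) <= a) /\
  (forall e, inf (step q v x) < e -> exists2 a, step q v x a & a < e).
  apply: inf_lbP; first by exists (q (x + 0 *: v) - 0 * q v), 0 => //=.
  move=> _ [t /= t0 <-]; have := qs.1 (x + t *: v) (- x).
  rewrite addrC addrA addNr add0r qs.2 //; lra.
have Hle x (t : R) : 0 <= t -> inf (step q v x) <= q (x + t *: v) - t * q v.
  by move=> t0; apply: (H x).2.1; exists t.
have Hs (c : R) x : 0 < c -> inf (step q v (c *: x)) <= c * inf (step q v x).
  move=> c0; rewrite leNgt; apply/negP => h.
  have h' : inf (step q v x) < c^-1 * inf (step q v (c *: x)).
    by rewrite ltr_pdivlMl.
  have [_ [t /= t0 <-] ht] := (H x).2.2 _ h'.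
  have := Hle (c *: x) (c * t) (mulr_ge0 (ltW c0) t0).
  rewrite -scalerA -scalerDr (qs.2 _ _ (ltW c0)).
  move: ht; rewrite ltr_pdivlMl // => ht hh; lra.
split=> //; split.
  move=> x y; rewrite leNgt; apply/negP => h.
  set I := inf (step q v (x + y)) in h.
  set J := inf (step q v x) in h; set K := inf (step q v y) in h.
  have h1 : J < J + (I - J - K) / 2 by lra.
  have h2 : K < K + (I - J - K) / 2 by lra.
  have [_ [s /= s0 <-] hs] := (H x).2.2 _ h1.
  have [_ [t /= t0 <-] ht] := (H y).2.2 _ h2.
  have := Hle (x + y) (s + t) (addr_ge0 s0 t0).
  have := qs.1 (x + s *: v) (y + t *: v).
  rewrite scalerDl addrACA -/I; lra.
move=> c x; rewrite le_eqVlt => /orP[/eqP <-|c0].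
  rewrite scale0r mul0r; apply/eqP; rewrite eq_le; apply/andP; split.
    have := Hle 0 0 (lexx _); rewrite scale0r addr0 mul0r sublinear0 //; lra.
  by have := (H 0).1; rewrite oppr0 sublinear0 // oppr0.
apply/eqP; rewrite eq_le Hs //=.
have ci : 0 < c^-1 by rewrite invr_gt0.
have := Hs c^-1 (c *: x) ci; rewrite scalerA mulVf ?gt_eqF // scale1r => h.
have := ler_wpM2l (ltW c0) h; rewrite mulrA divff ?gt_eqF // mul1r.
by [].
Qed.

Record below (p : V -> R) := Below {
  bfct : V -> R; bsub : sublinear bfct; ble : forall x, bfct x <= p x }.

(* A minimal sublinear minorant is additive, because translating its argument
   along [v] and taking the infimum gives a smaller sublinear functional. *)
Lemma exists_linear_below (p : V -> R) : sublinear p ->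
  exists f : V -> R, linear_functional f /\ forall x, f x <= p x.
Proof.
move=> ps.
pose T := below p.
pose Rl (s t : T) := `[< forall x, bfct t x <= bfct s x >].
have t0 : T by exact: (@Below p p ps (fun x => lexx _)).
have [||A Atot|q qmax] := @ZL_preorder T t0 Rl.
- by move=> t; apply/asboolP => x.
- by move=> r s t /asboolP rs /asboolP st; apply/asboolP => x; apply: le_trans (rs x).
- have [[a0 Aa0]|A0] := pselect (exists a, A a); last first.
    by exists t0 => s As; exfalso; apply: A0; exists s.
  pose I x := [set bfct a x | a in A].
  have H x : - p (- x) <= inf (I x) /\ (forall a, I x a -> inf (I x) <= a) /\
      (forall e, inf (I x) < e -> exists2 a, I x a & a < e).
    apply: inf_lbP; first by exists (bfct a0 x), a0.
    move=> _ [a Aa <-]; have := sublinear_geN x (bsub a); have := ble a (- x); lra.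
  have Is : sublinear (fun x => inf (I x)).
    split.
      move=> x y; rewrite leNgt; apply/negP => h.
      have h1 : inf (I x) < inf (I x) + (inf (I (x+y)) - inf (I x) - inf (I y)) / 2 by lra.
      have h2 : inf (I y) < inf (I y) + (inf (I (x+y)) - inf (I x) - inf (I y)) / 2 by lra.
      have [_ [a Aa <-] ha] := (H x).2.2 _ h1.
      have [_ [b Ab <-] hb] := (H y).2.2 _ h2.
      have [c [Ac cx cy]] : exists c, [/\ A c, bfct c x <= bfct a x & bfct c y <= bfct b y].
        have [/asboolP ab|/asboolP ba] := Atot a b Aa Ab.
          by exists b; split.
        by exists a; split.
      have := (bsub c).1 x y.
      have : inf (I (x + y)) <= bfct c (x + y) by apply: (H _).2.1; exists c.
      lra.
    have Hs (c : R) x : 0 < c -> inf (I (c *: x)) <= c * inf (I x).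
      move=> c0; rewrite leNgt; apply/negP => h.
      have h' : inf (I x) < c^-1 * inf (I (c *: x)).
        by rewrite ltr_pdivlMl.
      have [_ [a Aa <-] ha] := (H x).2.2 _ h'.
      have : inf (I (c *: x)) <= bfct a (c *: x) by apply: (H _).2.1; exists a.
      rewrite ((bsub a).2 _ _ (ltW c0)).
      move: ha; rewrite ltr_pdivlMl // => ha hh; lra.
    move=> c x; rewrite le_eqVlt => /orP[/eqP <-|c0].
      rewrite scale0r mul0r; apply/eqP; rewrite eq_le; apply/andP; split.
        have : inf (I 0) <= bfct a0 0 by apply: (H _).2.1; exists a0.
        by rewrite (sublinear0 (bsub a0)).
      by have := (H 0).1; rewrite oppr0 sublinear0 // oppr0.
    apply/eqP; rewrite eq_le Hs //=.
    have ci : 0 < c^-1 by rewrite invr_gt0.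
    have := Hs c^-1 (c *: x) ci; rewrite scalerA mulVf ?gt_eqF // scale1r => h.
    by have := ler_wpM2l (ltW c0) h; rewrite mulrA divff ?gt_eqF // mul1r.
  have Ip x : inf (I x) <= p x.
    by apply: (le_trans _ (ble a0 x)); apply: (H _).2.1; exists a0.
  exists (@Below p _ Is Ip) => s As; apply/asboolP => x /=.
  by apply: (H _).2.1; exists s.
have qs := bsub q.
have qadd x v : bfct q (x + v) = bfct q x + bfct q v.
  apply/eqP; rewrite eq_le qs.1 /=.
  have [ss sle] := step_sublinear v qs.
  have sp y : inf (step (bfct q) v y) <= p y.
    apply: (le_trans _ (ble q y)).
    by have := sle y 0 (lexx _); rewrite scale0r addr0 mul0r subr0.
  have /qmax/asboolP/(_ x)/= : Rl q (@Below p _ ss sp).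
    apply/asboolP => y /=.
    by have := sle y 0 (lexx _); rewrite scale0r addr0 mul0r subr0.
  by have := sle x 1 ler01; rewrite scale1r mul1r; lra.
have qN x : bfct q (- x) = - bfct q x.
  by have := qadd x (- x); rewrite subrr (sublinear0 qs); lra.
exists (bfct q); split; last exact: ble.
move=> c x y; rewrite qadd; congr (_ + _).
have [c0|c0] := leP 0 c; first by rewrite qs.2.
have := qs.2 (- c) x; rewrite scaleNr qN => h.
by apply: oppr_inj; rewrite h ?mulNr //; lra.
Qed.

(** The existence result is applied to the infimum along [v] rather than to [p]: at [- v], with
    [t = 1], this infimum is at most [- p v], so [f v] cannot be smaller than [p v]. *)
Theorem Hahn_Banach_supporting (p : V -> R) (v : V) : sublinear p ->
  exists f : V -> R, [/\ linear_functional f, forall x, f x <= p x & f v = p v].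
Proof.
move=> ps; have [ss sle] := step_sublinear v ps.
have [f [fl fle]] := exists_linear_below ss.
have sp y : inf (step p v y) <= p y.
  by have := sle y 0 (lexx _); rewrite scale0r addr0 mul0r subr0.
exists f; split=> // [x|]; first exact: le_trans (fle x) (sp x).
have f0 : f 0 = 0 by have := fl 1 0 0; rewrite scale1r addr0 mul1r; lra.
have fN : f (- v) = - f v.
  by have := fl (-1) v 0; rewrite scaleN1r addr0 f0 addr0 mulN1r.
have h1 := le_trans (fle v) (sp v).
have := sle (- v) 1 ler01; rewrite scale1r addNr (sublinear0 ps).
have := fle (- v); rewrite fN; lra.
Qed.

End HahnBanach.

Section LinearFunctional.
Variables (R : realType) (V : lmodType R) (f : V -> R).
Hypothesis fl : linear_functional f.

Lemma linear_functional0 : f 0 = 0.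
Proof. by have := fl 1 0 0; rewrite scale1r addr0 mul1r; lra. Qed.

Lemma linear_functionalD x y : f (x + y) = f x + f y.
Proof. by rewrite -{1}(scale1r x) fl mul1r. Qed.

Lemma linear_functionalZ c x : f (c *: x) = c * f x.
Proof. by rewrite -(addr0 (c *: x)) fl linear_functional0 addr0. Qed.

Lemma linear_functionalN x : f (- x) = - f x.
Proof. by rewrite -scaleN1r linear_functionalZ mulN1r. Qed.

Lemma linear_functional_sum (I : Type) (r : seq I) (P : pred I) (F : I -> V) :
  f (\sum_(i <- r | P i) F i) = \sum_(i <- r | P i) f (F i).
Proof.
by apply: (big_morph f); [exact: linear_functionalD | exact: linear_functional0].
Qed.

End LinearFunctional.

Section NormingFunctional.
Variables (R : realType) (X : normedModType R).

Lemma norming_functional_ex (v : X) : exists f : X -> R,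
  [/\ linear_functional f, forall x, `|f x| <= `|x| & f v = `|v|].
Proof.
have ns : sublinear (fun x : X => `|x|).
  by split=> [x y|c x c0]; [exact: ler_normD | rewrite normrZ ger0_norm].
have [f [fl fle fv]] := Hahn_Banach_supporting v ns.
exists f; split=> // x; rewrite ler_norml fle andbT.
by have := fle (- x); rewrite linear_functionalN // normrN; lra.
Qed.

Definition norming (v : X) : X -> R := sval (cid (norming_functional_ex v)).

Lemma norming_linear v : linear_functional (norming v).
Proof. by rewrite /norming; case: cid => f []. Qed.

Lemma norming_le v x : `|norming v x| <= `|x|.
Proof. by rewrite /norming; case: cid => f []. Qed.

Lemma norming_eq v : norming v v = `|v|.
Proof. by rewrite /norming; case: cid => f []. Qed.

End NormingFunctional.

(** * Banach space of bounded functions *)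

Section BoundedFunctions.
Variables (R : realType) (T : Type).

Definition bounded_fct : pred (T -> R) :=
  fun f => `[< exists M, forall t, `|f t| <= M >].

Lemma bounded_fct_submod : submod_closed bounded_fct.
Proof.
split; first by apply/asboolP; exists 0 => t; rewrite normr0.
move=> c f g /asboolP[M fM] /asboolP[M' gM']; apply/asboolP.
exists (`|c| * M + M') => t; apply: le_trans (ler_normD _ _) _.
by apply: lerD => //; rewrite normrM ler_wpM2l.
Qed.

HB.instance Definition _ := GRing.isSubmodClosed.Build R (T -> R) bounded_fct
  bounded_fct_submod.

Record bfun := BFun { bfun_val :> T -> R; _ : bfun_val \in bounded_fct }.

HB.instance Definition _ := [isSub for bfun_val].
HB.instance Definition _ := [Choice of bfun by <:].
HB.instance Definition _ := [SubChoice_isSubLmodule of bfun by <:].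

End BoundedFunctions.

Section BoundedFunctionsNorm.
Variables (R : realType) (T : pointedType).
Local Notation bfun := (bfun R T).

Definition sup_norm (f : bfun) : R := sup (range (fun t => `|f t|)).

Let sup_normP (f : bfun) : has_sup (range (fun t => `|f t|)).
Proof.
split; first by exists `|f point|, point.
case: f => f /= /asboolP[M fM]; exists M => _ [t _ <-]; exact: fM.
Qed.

Lemma ler_sup_norm (f : bfun) t : `|f t| <= sup_norm f.
Proof. by apply: ub_le_sup; [exact: (sup_normP f).2 | exists t]. Qed.

Lemma sup_norm_le (f : bfun) M : (forall t, `|f t| <= M) -> sup_norm f <= M.
Proof.
move=> fM; apply: ge_sup; first exact: (sup_normP f).1.
by move=> _ [t _ <-].
Qed.

Let sup_normD f g : sup_norm (f + g) <= sup_norm f + sup_norm g.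
Proof.
apply: sup_norm_le => t; apply: le_trans (ler_normD _ _) _.
by apply: lerD; exact: ler_sup_norm.
Qed.

Let sup_normZ c f : sup_norm (c *: f) = `|c| * sup_norm f.
Proof.
apply/eqP; rewrite eq_le; apply/andP; split.
  by apply: sup_norm_le => t; rewrite normrM ler_wpM2l // ler_sup_norm.
have [->|c0] := eqVneq c 0.
  rewrite normr0 mul0r; apply: le_trans (ler_sup_norm _ point).
  exact: normr_ge0.
rewrite mulrC -ler_pdivlMr ?normr_gt0 //; apply: sup_norm_le => t.
rewrite ler_pdivlMr ?normr_gt0 // mulrC -normrM.
exact: (ler_sup_norm (c *: f) t).
Qed.

Let sup_norm0 f : sup_norm f = 0 -> f = 0.
Proof.
move=> f0; apply: val_inj; apply/funext => t /=.
by apply/eqP; rewrite -normr_le0 -f0 ler_sup_norm.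
Qed.

HB.instance Definition _ := @Lmodule_isNormed.Build R bfun sup_norm
  sup_normD sup_normZ sup_norm0.


Lemma bfun_complete (F : set_system bfun) : ProperFilter F -> cauchy F -> cvg F.
Proof.
move=> FF /cauchyP FC.
have bE (f : bfun) e (g : bfun) t : ball f e g -> `|f t - g t| < e.
  rewrite -ball_normE /= => h; apply: le_lt_trans h.
  exact: (ler_sup_norm (f - g) t).
pose ev t : bfun -> R := fun f => f t.
have FxC t : cvg (ev t @ F).
  apply/cauchy_cvgP; apply/cauchyP => e e0.
  have [g Fg] := FC e e0; exists (g t).
  apply: (@filterS _ F _ (ball g e) [set f | ball (g t) e (ev t f)] _ Fg).
  by move=> f /= gf; rewrite -ball_normE /=; exact: bE gf.
pose h t : R := lim (ev t @ F).
have hB e (g : bfun) t : F (ball g e) -> `|h t - g t| <= e.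
  move=> Fg.
  have cl : (fun f => `|ev t f - g t|) @ F --> `|h t - g t|.
    apply: cvg_norm; apply: cvgB; first exact: FxC.
    exact: cvg_cst.
  have -> : `|h t - g t| = lim ((fun f => `|ev t f - g t|) @ F) by apply/esym/cvg_lim.
  apply: limr_le; first by apply: cvgP cl.
  apply: (@filterS _ F _ (ball g e) _ _ Fg) => f gf.
  by have := bE _ _ _ t gf; rewrite distrC => /ltW.
have hb : h \in @bounded_fct R T.
  have [g Fg] := FC 1 ltr01.
  apply/asboolP; exists (1 + sup_norm g) => t.
  have -> : h t = (h t - g t) + g t by rewrite subrK.
  apply: le_trans (ler_normD _ _) _; apply: lerD; first exact: hB.
  exact: ler_sup_norm.
apply/cvg_ex; exists (BFun hb); apply/cvgrPdist_le => e e0.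
have e20 : 0 < e / 2 by lra.
have [g Fg] := FC _ e20.
apply: filterS (Fg) => f gf.
apply: sup_norm_le => t /=.
rewrite -[X in `|X|]/(h t - f t).
have -> : h t - f t = (h t - g t) + (g t - f t) by ring.
apply: le_trans (ler_normD _ _) _.
have := hB _ _ t Fg; have := bE _ _ _ t gf; lra.
Qed.

HB.instance Definition _ := Uniform_isComplete.Build bfun bfun_complete.

End BoundedFunctionsNorm.

(** * Realization of seminorms in Banach spaces *)

Section SeminormRepresentation.
Variables (R : realType) (V : lmodType R) (p : V -> R).
Hypothesis pD : forall x y, p (x + y) <= p x + p y.
Hypothesis pZ : forall c x, p (c *: x) = `|c| * p x.

Lemma seminorm_ge0 x : 0 <= p x.
Proof.
have := pD x (- x); rewrite subrr -scaleN1r pZ normrN1 mul1r.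
by have := pZ 0 0; rewrite scale0r normr0 mul0r => ->; lra.
Qed.

Lemma seminorm_sublinear : sublinear p.
Proof. by split=> // c x c0; rewrite pZ ger0_norm. Qed.

(** [SPw_countable] speaks of sequences in complete spaces, while the constructions below produce a
    seminorm on coefficient sequences. A vector is sent to the evaluation at it, a bounded function
    on the set of linear functionals below [p]; Hahn-Banach gives the right norm, and vectors of
    seminorm zero go to zero without a quotient. *)
Lemma seminorm_realization : exists (F : completeNormedModType R) (u : V -> F),
  (forall c x y, u (c *: x + y) = c *: u x + u y) /\ (forall x, `|u x| = p x).
Proof.
pose T := {f : V -> R | linear_functional f /\ forall x, f x <= p x}.
have [f0 [f0l f0p]] := exists_linear_below seminorm_sublinear.
have t0 : T by exists f0.
have fp (f : T) x : `|sval f x| <= p x.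
  case: f => f [fl fle] /=; rewrite ler_norml fle andbT.
  have := fle (- x); rewrite linear_functionalN // -scaleN1r pZ normrN1 mul1r; lra.
pose C : choiceType := {classic T}.
pose mx := isPointed.Build C t0.
pose P : pointedType := HB.pack_for pointedType C mx.
have ub x : (fun f : P => sval (f : T) x) \in @bounded_fct R P.
  by apply/asboolP; exists (p x) => f; exact: fp.
exists (bfun R P), (fun x => BFun (ub x)); split.
  move=> c x y; apply: val_inj; apply/funext => -[f [fl fle]] /=.
  exact: fl.
move=> x; apply/eqP; rewrite eq_le; apply/andP; split.
  by apply: sup_norm_le => f /=; exact: fp.
have [f [fl fle fx]] := Hahn_Banach_supporting x seminorm_sublinear.
have := @ler_sup_norm R P (BFun (ub x)) (exist _ f (conj fl fle) : T).
by rewrite /= fx; apply: le_trans; exact: ler_norm.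
Qed.

End SeminormRepresentation.

(** * Limits along a free ultrafilter on the integers *)

Lemma free_ultrafilter_ex : exists U : set_system nat,
  UltraFilter U /\ (forall A : set nat, (\forall n \near \oo, A n) -> U A).
Proof. exact: (@ultraFilterLemma nat (\oo : set_system nat)). Qed.

Definition Uf : set_system nat := sval (cid free_ultrafilter_ex).

#[global] Instance Uf_ultra : UltraFilter Uf.
Proof. by rewrite /Uf; case: cid => U []. Qed.

#[global] Instance Uf_filter : ProperFilter Uf.
Proof. exact: ultra_proper. Qed.

Lemma Uf_near (A : set nat) : (\forall n \near \oo, A n) -> Uf A.
Proof. by rewrite /Uf; case: cid => U [UU h] /=; exact: h. Qed.

Lemma Uf_ge n : Uf [set m | (n <= m)%N].
Proof. by apply: Uf_near; exists n. Qed.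

Lemma Uf_seq (I : eqType) (l : seq I) (A : I -> set nat) :
  (forall i, i \in l -> Uf (A i)) -> Uf [set n | forall i, i \in l -> A i n].
Proof.
elim: l => [|i l ih] H; first by apply: filterS filterT.
have h1 : Uf (A i) by apply: H; rewrite inE eqxx.
have h2 := ih (fun j jl => H j (@mem_behead _ (i :: l) _ jl)).
apply: filterS (filterI h1 h2) => n [a b] j; rewrite inE => /orP[/eqP->//|].
exact: b.
Qed.

Section Ultralimit.
Variable R : realType.

Definition Ulim (g : nat -> R) : R := lim (g @ Uf).

Lemma Ulim_cvg (g : nat -> R) (M : R) : (forall n, `|g n| <= M) -> g @ Uf --> Ulim g.
Proof.
move=> gM.
have Fs : (g @ Uf) [set` `[- M, M]].
  apply: (@filterS _ Uf _ setT) => [n _ /=|]; last exact: filterT.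
  by rewrite in_itv /= -ler_norml.
have [l [_ gl]] := @segment_compact R (- M) M (g @ Uf) _ Fs.
(* A cluster point of an ultrafilter is its limit: otherwise the complement of some neighbourhood
   would belong to the ultrafilter. *)
have {}gl : g @ Uf --> l.
  apply/cvgrPdist_lt => e e0.
  have [//|nU] := in_ultra_setVsetC [set n | `|l - g n| < e] Uf_ultra.
  exfalso; have [||y [/= hy ly]] := gl [set y | ~ `|l - y| < e] [set y | `|l - y| < e].
  - by apply: filterS nU.
  - by apply/nbhs_ballP; exists e => //= y; rewrite -ball_normE.
  exact: hy.
by rewrite /Ulim (cvg_lim _ gl).
Qed.

Lemma Ulim_near (g : nat -> R) (M e : R) : (forall n, `|g n| <= M) -> 0 < e ->
  Uf [set n | `|g n - Ulim g| < e].
Proof.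
move=> gM e0; have /cvgrPdist_lt/(_ e e0) := Ulim_cvg gM.
by apply: filterS => n; rewrite distrC.
Qed.

Lemma Ulim_norm_le (g : nat -> R) (M : R) : (forall n, `|g n| <= M) -> `|Ulim g| <= M.
Proof.
move=> gM; rewrite leNgt; apply/negP => h.
have e0 : 0 < `|Ulim g| - M by lra.
have [n /= hn] := filter_ex (Ulim_near gM e0).
have := gM n; have := ler_normD (Ulim g - g n) (g n); rewrite subrK distrC; lra.
Qed.

Lemma Ulim_linear c (g h : nat -> R) (M M' : R) : (forall n, `|g n| <= M) ->
  (forall n, `|h n| <= M') -> Ulim (fun n => c * g n + h n) = c * Ulim g + Ulim h.
Proof.
move=> gM hM; apply: cvg_lim => //; apply: cvgD; last exact: Ulim_cvg hM.
by apply: cvgMr; exact: Ulim_cvg gM.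
Qed.

End Ultralimit.

(** * Finitely supported coefficient sequences as polynomials *)

Section Combination.
Variables (R : realType) (V : lmodType R).
Implicit Types (x : nat -> V) (q r : {poly R}).

Definition comb x q : V := \sum_(i < size q) q`_i *: x i.

Lemma comb_widen x q n : (size q <= n)%N -> comb x q = \sum_(i < n) q`_i *: x i.
Proof.
move=> h; rewrite /comb (big_ord_widen n (fun i => q`_i *: x i) h) big_mkcond /=.
apply: eq_bigr => i _; case: ltnP => // hi.
by rewrite nth_default ?scale0r.
Qed.

Lemma comb_linear x (c : R) q r : comb x (c *: q + r) = c *: comb x q + comb x r.
Proof.
pose n := maxn (size q) (size r).
rewrite !(@comb_widen x _ n) ?leq_maxl ?leq_maxr //; last first.
  apply: leq_trans (size_polyD _ _) _; rewrite geq_max leq_maxr andbT.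
  by apply: leq_trans (size_scale_leq _ _) _; rewrite leq_maxl.
rewrite scaler_sumr -big_split /=; apply: eq_bigr => i _.
by rewrite coefD coefZ scalerDl scalerA.
Qed.

Lemma comb0 x : comb x 0 = 0.
Proof. by rewrite /comb size_poly0 big_ord0. Qed.

Lemma combD x q r : comb x (q + r) = comb x q + comb x r.
Proof. by rewrite -[q in LHS]scale1r comb_linear scale1r. Qed.

Lemma combZ x (c : R) q : comb x (c *: q) = c *: comb x q.
Proof. by rewrite -[c *: q]addr0 comb_linear comb0 addr0. Qed.

Lemma combN x q : comb x (- q) = - comb x q.
Proof. by rewrite -[- q]scaleN1r combZ scaleN1r. Qed.

Lemma combB x q r : comb x (q - r) = comb x q - comb x r.
Proof. by rewrite combD combN. Qed.

Lemma comb_sum x (I : Type) (s : seq I) (P : pred I) (F : I -> {poly R}) :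
  comb x (\sum_(i <- s | P i) F i) = \sum_(i <- s | P i) comb x (F i).
Proof. by apply: (big_morph (comb x)); [exact: combD | exact: comb0]. Qed.

Lemma combXn x n : comb x 'X^n = x n.
Proof.
rewrite /comb size_polyXn big_ord_recr /= coefXn eqxx scale1r big1 ?add0r // => i _.
by rewrite coefXn ltn_eqF // scale0r.
Qed.

Lemma comb_eq x y q : (forall i, (i < size q)%N -> x i = y i) -> comb x q = comb y q.
Proof. by move=> h; apply: eq_bigr => i _; rewrite h. Qed.

Lemma comb_poly x n (E : nat -> R) :
  comb x (\poly_(i < n) E i) = \sum_(i < n) E i *: x i.
Proof.
rewrite (comb_widen _ (size_poly n E)); apply: eq_bigr => i _.
by rewrite coef_poly ltn_ord.
Qed.

End Combination.

Section CombinationMorphism.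
Variables (R : realType) (V W : lmodType R).

Lemma comb_morph (f : V -> W) (x : nat -> V) (q : {poly R}) :
  (forall (c : R) u v, f (c *: u + v) = c *: f u + f v) ->
  f (comb x q) = comb (f \o x) q.
Proof.
move=> fl.
have f0 : f 0 = 0.
  by have := fl (-1) 0 0; rewrite scaler0 addr0 scaleN1r addNr.
have fD u v : f (u + v) = f u + f v by have := fl 1 u v; rewrite !scale1r.
rewrite /comb (big_morph f fD f0); apply: eq_bigr => i _.
by have := fl q`_i (x i) 0; rewrite f0 !addr0.
Qed.

End CombinationMorphism.

Section Polynomials.
Variable R : realType.
Implicit Types (q r a b A B : {poly R}).

Lemma comb_comb (V : lmodType R) (x : nat -> V) (z : nat -> {poly R}) q :
  comb x (comb z q) = comb (fun i => comb x (z i)) q.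
Proof. by rewrite (comb_morph z q (comb_linear x)). Qed.

Lemma comb_id q : comb (fun i => 'X^i) q = q.
Proof. by rewrite -[q in RHS]coefK poly_def. Qed.

Lemma combMl (P : {poly R}) z q : comb (fun i => P * z i) q = P * comb z q.
Proof.
rewrite /comb big_distrr /=; apply: eq_bigr => i _; by rewrite -scalerAr.
Qed.

(** Two vectors with the same nonzero entries in the same order differ only in how their support is
    spread out. Depending on [nzs] alone is therefore how the spreading property of a norm is
    encoded. *)
Definition nzs q : seq R := [seq c <- (q : seq R) | c != 0].

Lemma nzs_mkseq q n : (size q <= n)%N ->
  nzs q = [seq c <- mkseq (fun i => q`_i) n | c != 0].
Proof.
move=> h; rewrite -(subnKC h) /mkseq iotaD map_cat filter_cat /nzs.
rewrite -[LHS]cats0; congr (_ ++ _); first by rewrite -[in LHS](mkseq_nth 0 q).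
apply/esym/eqP; rewrite -[_ == _]negbK -has_filter; apply/hasPn => c /mapP[i].
by rewrite mem_iota => /andP[hi _] ->; rewrite nth_default ?eqxx.
Qed.

Lemma nzs_cat A B k : (size A <= k)%N -> nzs (A + 'X^k * B) = nzs A ++ nzs B.
Proof.
move=> h; have hs : (size (A + 'X^k * B)%R <= k + size B)%N.
  apply: leq_trans (size_polyD _ _) _; rewrite geq_max (leq_trans h) ?leq_addr //.
  by apply: leq_trans (size_polyMleq _ _) _; rewrite size_polyXn addSn.
rewrite (nzs_mkseq hs) /mkseq iotaD map_cat filter_cat; congr (_ ++ _).
  rewrite (nzs_mkseq h) /mkseq; apply: (congr1 (fun s => [seq c <- s | c != 0])); apply/eq_in_map => i.
  by rewrite mem_iota add0n => /andP[_ hi]; rewrite coefD coefXnM hi addr0.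
rewrite (nzs_mkseq (leqnn (size B))) /mkseq add0n -[X in iota X _]addn0 iotaDl -map_comp.
apply: (congr1 (fun s => [seq c <- s | c != 0])); apply/eq_in_map => i _ /=.
rewrite coefD coefXnM ltnNge leq_addr /= addKn [A`__]nth_default ?add0r //.
exact: leq_trans h (leq_addr _ _).
Qed.

Lemma nzs0 : nzs 0 = [::].
Proof. by rewrite /nzs polyseq0. Qed.

Lemma nzsZ (c : R) q : c != 0 -> nzs (c *: q) = [seq c * d | d <- nzs q].
Proof.
move=> c0; rewrite (nzs_mkseq (size_scale_leq c q)) (nzs_mkseq (leqnn (size q))).
rewrite /mkseq !filter_map -!map_comp.
have -> : [seq i <- iota 0 (size q) | preim (fun i => (c *: q)`_i) (fun d => d != 0) i]
  = [seq i <- iota 0 (size q) | preim (fun i => q`_i) (fun d => d != 0) i].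
  by apply: eq_filter => i /=; rewrite coefZ mulf_eq0 negb_or c0.
by apply: eq_map => i /=; rewrite coefZ.
Qed.

Lemma nzsZ_eq (c : R) q r : nzs q = nzs r -> nzs (c *: q) = nzs (c *: r).
Proof.
have [->|c0] := eqVneq c 0; first by rewrite !scale0r.
by move=> h; rewrite !nzsZ // h.
Qed.

Lemma nzs_blocks (k : nat -> nat) (A : nat -> {poly R}) b :
  (forall i, (i < size b)%N -> (k i + size (A i) <= k i.+1)%N) ->
  nzs (comb (fun i => 'X^(k i) * A i) b) =
  flatten [seq nzs (b`_i *: A i) | i <- iota 0 (size b)].
Proof.
move=> hk; rewrite /comb; suff H n : (n <= size b)%N ->
    (size (\sum_(i < n) b`_i *: ('X^(k i) * A i))%R <= k n)%N /\
    nzs (\sum_(i < n) b`_i *: ('X^(k i) * A i)) =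
    flatten [seq nzs (b`_i *: A i) | i <- iota 0 n] by exact: (H _ (leqnn _)).2.
elim: n => [|n ih] hn; first by rewrite big_ord0 size_poly0 nzs0.
have [h1 h2] := ih (ltnW hn).
rewrite big_ord_recr scalerAr; split; last first.
  by rewrite -[n.+1 in RHS]addn1 iotaD map_cat flatten_cat /= cats0 nzs_cat // h2.
apply: leq_trans (size_polyD _ _) _; rewrite geq_max; apply/andP; split.
  by apply: leq_trans h1 _; apply: leq_trans (hk _ hn); exact: leq_addr.
apply: leq_trans (hk _ hn); apply: leq_trans (size_polyMleq _ _) _.
rewrite size_polyXn addSn /= leq_add2l; exact: size_scale_leq.
Qed.

Lemma nzs_blocks_eq (k k' : nat -> nat) (A A' : nat -> {poly R}) b :
  (forall i, (i < size b)%N -> (k i + size (A i) <= k i.+1)%N) ->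
  (forall i, (i < size b)%N -> (k' i + size (A' i) <= k' i.+1)%N) ->
  (forall i, (i < size b)%N -> nzs (A i) = nzs (A' i)) ->
  nzs (comb (fun i => 'X^(k i) * A i) b) = nzs (comb (fun i => 'X^(k' i) * A' i) b).
Proof.
move=> h h' hA; rewrite !nzs_blocks //; congr flatten; apply/eq_in_map => i.
by rewrite mem_iota => /andP[_ hi]; apply/nzsZ_eq/hA.
Qed.

Definition spread (m : nat -> nat) q : {poly R} := comb (fun i => 'X^(m i)) q.

Lemma comb_spread (V : lmodType R) (x : nat -> V) m q :
  comb x (spread m q) = comb (x \o m) q.
Proof. by rewrite comb_comb; apply: comb_eq => i _; rewrite combXn. Qed.

Lemma nzs_spread m q : (forall i, (m i < m i.+1)%N) -> nzs (spread m q) = nzs q.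
Proof.
move=> hm; rewrite -[in RHS](comb_id q).
have -> : spread m q = comb (fun i => 'X^(m i) * 1) q.
  by apply: comb_eq => i _; rewrite mulr1.
have -> : comb (fun i => 'X^i) q = comb (fun i => 'X^i * 1) q.
  by apply: comb_eq => i _; rewrite mulr1.
by apply: nzs_blocks_eq => // i _; rewrite size_poly1 addn1.
Qed.

(** This is [b (x) a] of the overview. The copies of [a] start at the multiples of [D] and are
    disjoint as soon as [size a <= D]; in that range a spreading norm does not depend on [D]. *)
Definition tens (D : nat) b a : {poly R} := comb (fun i => 'X^(D * i) * a) b.

Lemma tens_linearr D b (c : R) a a' :
  tens D b (c *: a + a') = c *: tens D b a + tens D b a'.
Proof.
rewrite /tens /comb scaler_sumr -big_split /=; apply: eq_bigr => i _.
by rewrite mulrDr scalerDr -scalerAr !scalerA mulrC.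
Qed.

Lemma nzs_tens D D' b a a' : (size a <= D)%N -> (size a' <= D')%N ->
  nzs a = nzs a' -> nzs (tens D b a) = nzs (tens D' b a').
Proof. by move=> h h' e; apply: nzs_blocks_eq => // i _; rewrite mulnS addnC leq_add2r. Qed.

Lemma coef_tens D b a i j : (size a <= D)%N -> (j < D)%N ->
  (tens D b a)`_(D * i + j) = b`_i * a`_j.
Proof.
move=> h hj; rewrite /tens (@comb_widen _ _ _ _ (maxn (size b) i.+1)) ?leq_maxl //.
have hi : (i < maxn (size b) i.+1)%N by rewrite leq_max leqnn orbT.
rewrite coef_sum (bigD1 (Ordinal hi)) //= coefZ coefXnM ltnNge leq_addr /= addKn.
rewrite big1 ?addr0 // => -[l hl] /= nl.
rewrite coefZ coefXnM; case: ltnP => [|hle]; first by rewrite mulr0.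
have {nl}: l != i by apply: contraNneq nl => e; apply/eqP/val_inj.
rewrite neq_ltn => /orP[li|il].
  rewrite [a`__]nth_default ?mulr0 //; apply: leq_trans h _.
  have : (D * l.+1 <= D * i)%N by rewrite leq_mul2l li orbT.
  by rewrite mulnS; lia.
have : (D * i.+1 <= D * l)%N by rewrite leq_mul2l il orbT.
by rewrite mulnS; lia.
Qed.

Definition cmul (c : nat -> R) q : {poly R} := \poly_(i < size q) (c i * q`_i).

Lemma coef_cmul c q i : (cmul c q)`_i = c i * q`_i.
Proof. by rewrite coef_poly; case: ltnP => // h; rewrite [q`_i]nth_default ?mulr0. Qed.

Lemma size_cmul c q : (size (cmul c q) <= size q)%N.
Proof. exact: size_poly. Qed.

Lemma comb_cmul (V : lmodType R) (x : nat -> V) c q :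
  comb x (cmul c q) = \sum_(i < size q) (c i * q`_i) *: x i.
Proof. exact: comb_poly. Qed.

Definition restr (P : pred nat) q : {poly R} := cmul (fun i => (P i)%:R) q.

Lemma coef_restr P q i : (restr P q)`_i = if P i then q`_i else 0.
Proof. by rewrite coef_cmul; case: (P i); rewrite ?mul1r ?mul0r. Qed.

End Polynomials.

(** * Spreading norms on coefficient sequences *)

Section SpreadingNorm.
Variable R : realType.
Implicit Types (q r a b A B : {poly R}).

(** Unconditional spreading norms: [sn_inv] is invariance under spreading, [sn_restr] is suppression
    unconditionality with constant [K]. Definiteness follows from these, see [sn_coef]. *)
Record spreading_norm (K : R) (p : {poly R} -> R) : Prop := SpreadingNorm {
  snD : forall q r, p (q + r) <= p q + p r;
  snZ : forall (c : R) q, p (c *: q) = `|c| * p q;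
  sn1 : p 1 = 1;
  sn_inv : forall q r, nzs q = nzs r -> p q = p r;
  sn_restr : forall P q, p (restr P q) <= K * p q }.

Variables (K : R) (p : {poly R} -> R).
Hypothesis ps : spreading_norm K p.

Lemma sn_ge0 q : 0 <= p q.
Proof. exact: (seminorm_ge0 (snD ps) (snZ ps)). Qed.

Lemma sn0 : p 0 = 0.
Proof. by have := snZ ps 0 0; rewrite scale0r normr0 mul0r. Qed.

Lemma snN q : p (- q) = p q.
Proof. by rewrite -scaleN1r (snZ ps) normrN1 mul1r. Qed.

Lemma snB q r : p (q - r) <= p q + p r.
Proof. by rewrite -(snN r); exact: (snD ps). Qed.

Lemma sn_sum (I : Type) (s : seq I) (P : pred I) (F : I -> {poly R}) :
  p (\sum_(i <- s | P i) F i) <= \sum_(i <- s | P i) p (F i).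
Proof.
elim/big_rec2: _ => [|i y z _ h]; first by rewrite sn0.
by apply: le_trans (snD ps _ _) _; rewrite lerD2l.
Qed.

Lemma snXnM n q : p ('X^n * q) = p q.
Proof.
apply: (sn_inv ps); rewrite -[LHS]/(nzs ('X^n * q)) -[X in nzs X]add0r nzs_cat ?size_poly0 //.
by rewrite nzs0.
Qed.

Lemma snXn n : p 'X^n = 1.
Proof. by rewrite -[X in p X]mulr1 snXnM (sn1 ps). Qed.

Lemma sn_spread m q : (forall i, (m i < m i.+1)%N) -> p (spread m q) = p q.
Proof. by move=> hm; apply: (sn_inv ps); rewrite nzs_spread. Qed.

Lemma sn_tens D D' b a : (size a <= D)%N -> (size a <= D')%N ->
  p (tens D b a) = p (tens D' b a).
Proof. by move=> h h'; apply: (sn_inv ps); exact: nzs_tens. Qed.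

Lemma sn_K_ge1 : 1 <= K.
Proof.
have := sn_restr ps predT 1; have -> : restr predT 1 = 1 :> {poly R}.
  by apply/polyP => i; rewrite coef_restr.
by rewrite (sn1 ps) mulr1.
Qed.

Lemma sn_coef q i : `|q`_i| <= K * p q.
Proof.
have := sn_restr ps (pred1 i) q; have -> : restr (pred1 i) q = q`_i *: 'X^i.
  apply/polyP => j; rewrite coef_restr coefZ coefXn /=.
  by case: eqP => [->|]; rewrite ?mulr1 ?mulr0.
by rewrite (snZ ps) snXn mulr1.
Qed.

Lemma sn_le_sum q n : (size q <= n)%N -> p q <= \sum_(i < n) `|q`_i|.
Proof.
move=> h; rewrite -[X in p X]comb_id (comb_widen _ h); apply: le_trans (sn_sum _ _ _) _.
by apply: ler_sum => i _; rewrite (snZ ps) snXn mulr1.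
Qed.

(** Read column by column, the product is a combination of shifted spread copies of [b], one for
    each coordinate of [a]. *)
Lemma sn_tens_le D b a : (0 < D)%N ->
  p (tens D b a) <= (\sum_(l < size a) `|a`_l|) * p b.
Proof.
move=> D0; have -> : tens D b a = \sum_(l < size a) a`_l *: ('X^l * spread (fun i => D * i)%N b).
  rewrite /tens /spread /comb.
  under [RHS]eq_bigr do rewrite big_distrr scaler_sumr /=.
  rewrite exchange_big /=; apply: eq_bigr => i _.
  rewrite -{1}(comb_id a) /comb big_distrr scaler_sumr /=; apply: eq_bigr => l _.
  by rewrite -!scalerAr !scalerA mulrC ['X^l * _]mulrC.
apply: le_trans (sn_sum _ _ _) _; rewrite mulr_suml; apply: ler_sum => l _.
rewrite (snZ ps) snXnM sn_spread // => i; rewrite mulnS; lia.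
Qed.

(* The norm is convex in each multiplier, so the worst multipliers are 0 or 1. *)
Lemma sn_cmul01 c q : (forall i, 0 <= c i <= 1) -> p (cmul c q) <= K * p q.
Proof.
move=> hc; suff H n (d : nat -> R) : (forall i, 0 <= d i <= 1) ->
    (forall i, (n <= i)%N -> d i = 0 \/ d i = 1) -> p (cmul d q) <= K * p q.
  pose d i := if (i < size q)%N then c i else 0.
  have -> : cmul c q = cmul d q.
    by apply/polyP => i; rewrite !coef_poly /d; case: ltnP.
  apply: (H (size q)) => i; rewrite /d; first by case: ifP => // _; rewrite lexx ler01.
  by move=> h; rewrite ltnNge h /=; left.
elim: n d => [|n ih] d hd hn.
  have -> : cmul d q = restr (fun i => d i == 1) q; last exact: (sn_restr ps).
  apply/polyP => i; rewrite coef_restr coef_cmul.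
  have [->|->] := hn i isT; first by rewrite mul0r eq_sym oner_eq0.
  by rewrite mul1r eqxx.
pose e t i := if i == n then t else d i.
have -> : cmul d q = d n *: cmul (e 1) q + (1 - d n) *: cmul (e 0) q.
  apply/polyP => i; rewrite coefD !coefZ !coef_cmul /e.
  by case: eqP => [->|_]; ring.
have He t : t = 0 \/ t = 1 -> p (cmul (e t) q) <= K * p q.
  move=> ht; apply: ih => i; rewrite /e; case: eqP => [_|] //.
    by case: ht => ->; rewrite lexx ler01.
  by move=> hi hni; apply: hn; lia.
apply: le_trans (snD ps _ _) _; rewrite !(snZ ps).
have /andP[h0 h1] := hd n.
have := He 1 (or_intror erefl); have := He 0 (or_introl erefl).
rewrite !ger0_norm ?subr_ge0 // => k0 k1; nra.
Qed.

(** The positive and negative parts of [c / M] are multipliers with values between 0 and 1; the two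
    of them account for the factor 2. *)
Lemma sn_cmul (M : R) c q : (forall i, `|c i| <= M) -> p (cmul c q) <= 2 * M * K * p q.
Proof.
move=> hc; have M0 : 0 <= M by apply: le_trans (hc 0%N); exact: normr_ge0.
have [M00|M1] := eqVneq M 0.
  have -> : cmul c q = 0.
    apply/polyP => i; rewrite coef_cmul coef0.
    by have := hc i; rewrite M00 normr_le0 => /eqP->; rewrite mul0r.
  by rewrite sn0 M00 mulr0 !mul0r.
have Mp : 0 < M by rewrite lt_neqAle eq_sym M1.
pose d s i := Num.max 0 (s * c i) / M.
have hd s : s = 1 \/ s = -1 -> p (cmul (d s) q) <= K * p q.
  move=> hs; apply: sn_cmul01 => i; rewrite /d divr_ge0 ?le_max ?lexx //=.
  rewrite ler_pdivrMr // mul1r ge_max M0 /=; apply: le_trans (hc i).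
  case: hs => ->; first by rewrite mul1r ler_norm.
  by rewrite mulN1r -normrN ler_norm.
have -> : cmul c q = M *: (cmul (d 1) q - cmul (d (-1)) q).
  apply/polyP => i; rewrite coefZ coefB !coef_cmul /d mul1r mulN1r.
  have [h|h] := leP 0 (c i).
    by rewrite max_l ?oppr_le0 //; field.
  by rewrite max_r ?oppr_ge0 ?(ltW h) //; field.
rewrite (snZ ps) ger0_norm //.
have := hd 1 (or_introl erefl); have := hd (-1) (or_intror erefl).
have := snB (cmul (d 1) q) (cmul (d (-1)) q); nra.
Qed.

End SpreadingNorm.

(** * Extraction of subsequences by iterated ultralimits *)

(** Takes the place of a diagonal argument: the condition on the next index may depend on all
    earlier choices, and belonging to the ultrafilter it can be satisfied. *)
Lemma inductive_choice (Q : seq nat -> set nat) : (forall p, Uf (Q p)) ->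
  exists m : nat -> nat, forall s, Q (mkseq m s) (m s).
Proof.
move=> HQ; pose c p := sval (cid (@filter_ex nat Uf Uf_filter _ (HQ p))).
have cP p : Q p (c p) by rewrite /c; case: cid.
pose pr := fix pr s := if s is s'.+1 then rcons (pr s') (c (pr s')) else [::].
exists (fun s => c (pr s)) => s.
suff -> : mkseq (fun s => c (pr s)) s = pr s by exact: cP.
by elim: s => // s ih; rewrite mkseqS ih.
Qed.

Section IteratedUltralimit.
Variable R : realType.
Implicit Types (g h : seq nat -> R) (k : seq nat) (r : nat).

(** Limit of [g] over the ways to append [r] further indices to [k]; the first appended index is the
    outermost limit. *)
Fixpoint Ul r g k : R :=
  if r is r'.+1 then Ulim (fun t => Ul r' g (rcons k t)) else g k.

Lemma Ul_norm_le r g k (M : R) : (forall k, `|g k| <= M) -> `|Ul r g k| <= M.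
Proof.
by move=> gM; elim: r k => [|r ih] k //=; apply: Ulim_norm_le => t; exact: ih.
Qed.

Lemma Ul_linear r (c : R) g h k (M M' : R) : (forall k, `|g k| <= M) ->
  (forall k, `|h k| <= M') ->
  Ul r (fun k => c * g k + h k) k = c * Ul r g k + Ul r h k.
Proof.
move=> gM hM; elim: r k => [|r ih] k //=.
rewrite -(@Ulim_linear _ c _ _ M M'); last 2 first.
- by move=> t; exact: Ul_norm_le.
- by move=> t; exact: Ul_norm_le.
by congr Ulim; apply/funext => t; exact: ih.
Qed.

Lemma Ul_near r g k (M e : R) : (forall k, `|g k| <= M) -> 0 < e ->
  Uf [set t | `|Ul r g (rcons k t) - Ul r.+1 g k| <= e].
Proof.
move=> gM e0.
have H t : `|Ul r g (rcons k t)| <= M by exact: Ul_norm_le.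
by apply: filterS (Ulim_near H e0) => t /ltW.
Qed.

Definition picks (m : nat -> nat) (F : pred nat) s : seq nat :=
  [seq m i | i <- iota 0 s & F i].

Lemma picksS m F s :
  picks m F s.+1 = if F s then rcons (picks m F s) (m s) else picks m F s.
Proof.
rewrite /picks -addn1 iotaD filter_cat map_cat /= add0n.
by case: (F s); rewrite ?cats1 ?cats0.
Qed.

(** Makes quantification over all sets [F] finite at each stage: the past of length [s] has only
    [2 ^ s] masks. *)
Lemma picks_mask m F s : exists2 b : bitseq, size b = s & picks m F s = mask b (mkseq m s).
Proof.
exists [seq F i | i <- iota 0 s]; first by rewrite size_map size_iota.
by rewrite /picks filter_mask map_mask.
Qed.

(** Each picked index replaces one limit by an actual value, at cost [d s]; indices outside [F]
    change nothing. *)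
Lemma Ul_telescope (m : nat -> nat) (F : pred nat) (d : nat -> R) g n t N : (t <= N)%N ->
  (forall s, (t <= s < N)%N -> F s ->
    `|Ul (n - (size (picks m F s)).+1) g (rcons (picks m F s) (m s)) -
      Ul (n - size (picks m F s)) g (picks m F s)| <= d s) ->
  (forall s, 0 <= d s) ->
  `|Ul (n - size (picks m F N)) g (picks m F N) -
    Ul (n - size (picks m F t)) g (picks m F t)| <= \sum_(t <= s < N) d s.
Proof.
move=> tN H d0; elim: N tN H => [|N ih] tN H.
  by move: tN; rewrite leqn0 => /eqP ->; rewrite subrr normr0 big_geq.
move: tN; rewrite leq_eqVlt => /orP[/eqP ->|tN]; first by rewrite subrr normr0 big_geq.
rewrite ltnS in tN; rewrite big_nat_recr //=.
have {}ih : `|Ul (n - size (picks m F N)) g (picks m F N) -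
    Ul (n - size (picks m F t)) g (picks m F t)| <= \sum_(t <= s < N) d s.
  apply: ih => // s /andP[h1 h2]; apply: H; rewrite h1 /=; exact: ltnW.
rewrite picksS; case FN : (F N); last by apply: le_trans ih _; rewrite lerDl.
have := H N; rewrite tN ltnSn FN => /(_ isT isT) h.
rewrite size_rcons.
apply: le_trans (ler_distD (Ul (n - size (picks m F N)) g (picks m F N)) _ _) _.
by rewrite addrC lerD.
Qed.

End IteratedUltralimit.

(** * Finite nets of coefficient vectors *)

Section Grid.
Variable R : realType.

Lemma grid1 (e : R) : 0 < e ->
  exists l : seq R, forall x, `|x| <= 1 -> exists2 d, d \in l & `|x - d| <= e.
Proof.
move=> e0; pose N := (Num.truncn e^-1).+1.
have hN : e^-1 < N%:R by apply: truncnS_gt.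
have N0 : 0 < N%:R :> R by rewrite ltr0n.
exists [seq j%:R / N%:R - 1 | j <- iota 0 (2 * N).+1] => x; rewrite ler_norml => /andP[x1 x2].
pose y := (x + 1) * N%:R.
have y0 : 0 <= y by apply: mulr_ge0; [lra | exact: ltW].
have /andP[j1 j2] := truncn_itv y0; set j := Num.truncn y in j1 j2.
exists (j%:R / N%:R - 1).
  apply/mapP; exists j => //; rewrite mem_iota /= add0n ltnS -(ler_nat R).
  apply: le_trans j1 _; rewrite natrM /y; apply: ler_wpM2r; [exact: ltW | lra].
have -> : x - (j%:R / N%:R - 1) = (y - j%:R) / N%:R by rewrite /y; field; rewrite gt_eqF.
rewrite normrM normfV (ger0_norm (ltW N0)) ler_pdivrMr //.
apply: (@le_trans _ _ 1); last by rewrite mulrC -ler_pdivrMr // div1r ltW.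
by rewrite ger0_norm ?subr_ge0 // -natr1 in j2 *; lra.
Qed.

Lemma grid (n : nat) (e : R) : 0 < e -> exists l : seq (seq R),
  forall a : seq R, size a = n -> (forall x, x \in a -> `|x| <= 1) ->
  exists2 d, d \in l & size d = n /\ forall i, `|a`_i - d`_i| <= e.
Proof.
move=> e0; have [l1 H1] := grid1 e0; elim: n => [|n [l H]].
  exists [:: [::]] => a /size0nil -> _; exists [::]; rewrite ?inE //; split=> // i.
  by rewrite nth_nil subrr normr0 ltW.
exists [seq x :: s | x <- l1, s <- l] => -[//|x a] [sa] ha.
have [d dl hd] := H1 x (ha x (mem_head _ _)).
have [||s sl [ss hs]] := H a; first by [].
  by move=> y ya; apply: ha; rewrite inE ya orbT.
exists (d :: s); first by apply: allpairs_f.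
by split=> [|[|i]] //=; rewrite ss.
Qed.

End Grid.

(** * Schreier unconditional subsequences *)

Section Schreier.
Variables (R : realType) (X : normedModType R) (x : nat -> X).
Implicit Types (q : {poly R}) (F : pred nat).
Hypothesis x1 : forall n, `|x n| = 1.
Hypothesis xw : weakly_null (@setT X) (fun v : X => `|v|) x.

(** Error allowed at stage [s]; the sum from [t] on is below [2 * dl t]. Rounding [n] entries by
    [mesh n] costs at most [1/32]. Together these give the loss [10/64 = 4/64 + 6/64] in [key]. *)
Let dl (s : nat) : R := 64^-1 * 2^-1 ^+ s.

Let dl_gt0 s : 0 < dl s.
Proof. by rewrite /dl mulr_gt0 ?exprn_gt0 ?invr_gt0 ?ltr0n. Qed.

Let dl_sum t N : (t <= N)%N -> \sum_(t <= s < N) dl s <= 2 * dl t - 2 * dl N.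
Proof.
elim: N => [|N ih] tN.
  by move: tN; rewrite leqn0 => /eqP ->; rewrite big_geq // subrr.
move: tN; rewrite leq_eqVlt => /orP[/eqP ->|tN]; first by rewrite big_geq // subrr.
rewrite big_nat_recr //=; have := ih tN.
rewrite (_ : dl N.+1 = dl N / 2); last by rewrite /dl exprS; field.
by move: (\sum_(t <= s < N) dl s) (dl t) (dl N) => a b c; lra.
Qed.

Let mesh (n : nat) : R := (32 * n.+1%:R)^-1.

Let mesh_gt0 n : 0 < mesh n.
Proof. by rewrite invr_gt0 mulr_gt0 // ltr0n. Qed.

Let gl n := sval (cid (grid n (mesh_gt0 n))).

Let Gd (d : seq R) (k : seq nat) : X -> R :=
  norming (\sum_(i < size d) d`_i *: x (nth 0%N k i)).

(** A norming functional whose last [r] indices are still to be chosen and are meanwhile replaced by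
    limits. It remains linear and of norm at most 1, so weak nullity of [x] applies to it in
    [H_small]. *)
Let H r d k (z : X) : R := Ul r (fun k' => Gd d k' z) k.

Let H_le r d k z : `|H r d k z| <= `|z|.
Proof. by apply: Ul_norm_le => k'; exact: norming_le. Qed.

Let H_linear r d k : linear_functional (H r d k).
Proof.
move=> c u v; rewrite /H -(@Ul_linear _ _ _ _ _ _ `|u| `|v|); last 2 first.
- by move=> k'; exact: norming_le.
- by move=> k'; exact: norming_le.
by congr Ul; apply/funext => k'; exact: norming_linear.
Qed.

Let H_small r d k (e : R) : 0 < e -> Uf [set n | `|H r d k (x n)| <= e].
Proof.
move=> e0; apply: Uf_near.
have bH : bounded_functional setT (fun v : X => `|v|) (H r d k).
  split; first by move=> c u v _ _; exact: H_linear.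
  by exists 1 => u _; rewrite mul1r; exact: H_le.
by have /cvgr0Pnorm_le/(_ e e0) := xw bH.
Qed.

Let bits s : seq bitseq := [seq tval t | t <- enum {: s.-tuple bool}].

Let mem_bits b : b \in bits (size b).
Proof. by apply/mapP; exists (in_tuple b) => //; rewrite mem_enum. Qed.

(** Two demands on the next index [m], for every grid vector [d] and every subset [k] of the past:
    the functional known so far is small at the new vector [x m], and taking [m] into the support
    hardly moves its values at the old vectors. Only lengths [n <= size p] are treated; this keeps
    the demands finite and is why the outcome is Schreier and not full unconditionality. *)
Let Q (p : seq nat) : set nat := [set m | (forall i, i \in p -> (i < m)%N) /\
  forall n, n \in iota 0 (size p).+1 -> forall d, d \in gl n ->
  forall b, b \in bits (size p) -> let k := mask b p in
  `|H (n - size k) d k (x m)| <= dl (size p) /\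
  forall i, i \in p -> (size k < n)%N ->
    `|H (n - (size k).+1) d (rcons k m) (x i) - H (n - size k) d k (x i)| <= dl (size p)].

Let UQ p : Uf (Q p).
Proof.
apply: filterI.
  by apply: Uf_seq => i _; exact: Uf_ge.
apply: Uf_seq => n _; apply: Uf_seq => d _; apply: Uf_seq => b _ /=.
apply: filterI; first exact: H_small.
apply: Uf_seq => i _.
case: (ltnP (size (mask b p)) n) => h; last by apply: filterS filterT.
have e : (n - size (mask b p))%N = (n - (size (mask b p)).+1).+1 by lia.
rewrite e; apply: filterS (Ul_near _ _ (fun k => norming_le _ (x i)) (dl_gt0 (size p))).
by move=> t ht _; exact: ht.
Qed.

Section Fixed.
Variable m : nat -> nat.
Hypothesis mQ : forall s, Q (mkseq m s) (m s).

Let y i := x (m i).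

Let size_picks F s : size (picks m F s) = count F (iota 0 s).
Proof. by rewrite size_map size_filter. Qed.

(** The functional norming the rounded restriction to [F] is nearly zero at every [y t] with
    [t >= n] outside [F], and below [n] the coefficients outside [F] vanish. So it takes almost the
    same value at [comb y q] as at the restriction, which it almost norms. *)
Let key F n q (A : R) : 0 < A -> (forall i, `|q`_i| <= A) ->
  count F (iota 0 (size q)) = n -> (forall t, (t < n)%N -> ~~ F t -> q`_t = 0) ->
  `|comb y (restr F q)| <= `|comb y q| + A * (10 / 64).
Proof.
move=> A0 hA hn hz; set N := size q in hn.
pose I := [seq i <- iota 0 N | F i].
have sI : size I = n by rewrite size_filter.
pose a := [seq q`_i / A | i <- I].
have sa : size a = n by rewrite size_map.
have Hgl := svalP (cid (grid n (mesh_gt0 n))).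
have [|d dl_ [sd hd]] := Hgl a sa.
  move=> _ /mapP[i _ ->]; rewrite normrM normfV (gtr0_norm A0) ler_pdivrMr // mul1r.
  exact: hA.
pose f := Gd d (picks m F N).
have fl : linear_functional f by exact: norming_linear.
have fle z : `|f z| <= `|z| by exact: norming_le.
pose v := \sum_(i < size d) d`_i *: x (nth 0%N (picks m F N) i).
have fv : f v = `|v| by exact: norming_eq.
set w := comb y (restr F q).
have wE : w = \sum_(j < size d) (A * a`_j) *: x (nth 0%N (picks m F N) j).
  rewrite /w comb_cmul -(big_mkord xpredT (fun i => ((F i)%:R * q`_i) *: y i)).
  rewrite /index_iota subn0 -/N.
  transitivity (\sum_(i <- iota 0 N | F i) q`_i *: y i).
    rewrite [RHS]big_mkcond; apply: eq_bigr => i _.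
    by case: (F i); rewrite ?mul1r // mul0r scale0r.
  rewrite -big_filter -/I (big_nth 0%N) sI sd big_mkord; apply: eq_bigr => j _.
  have hj : (j < size I)%N by rewrite sI; exact: ltn_ord.
  rewrite /a /picks -/I !(nth_map 0%N) // /y; congr (_ *: _).
  by field; rewrite gt_eqF.
have wv : `|w - A *: v| <= A / 32.
  rewrite wE /v scaler_sumr -sumrB.
  apply: le_trans (ler_norm_sum _ _ _) _.
  apply: (@le_trans _ _ (\sum_(j < size d) A * mesh n)).
    apply: ler_sum => j _; rewrite scalerA -scalerBl normrZ x1 mulr1 -mulrBr normrM.
    by rewrite (gtr0_norm A0); apply: ler_wpM2l; [exact: ltW | exact: hd].
  rewrite sumr_const card_ord sd -[_ *+ n]mulr_natl mulrCA; apply: ler_wpM2l; first exact: ltW.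
  rewrite /mesh -[n.+1%:R]natr1 ler_pdivrMr; last by rewrite mulr_gt0 // natr1 ltr0n.
  by have : 0 <= n%:R :> R by []; lra.
have fw : `|w| - A / 16 <= f w.
  have h1 := fle (w - A *: v); rewrite linear_functionalD // linear_functionalN // in h1.
  rewrite linear_functionalZ // fv in h1.
  have : `|w| <= A / 32 + A * `|v|.
    have -> : w = (w - A *: v) + A *: v by rewrite subrK.
    apply: le_trans (ler_normD _ _) _; rewrite lerD //.
    by rewrite normrZ (gtr0_norm A0).
  by move: (le_trans h1 wv); rewrite ler_norml => /andP[]; lra.
(* One [dl t] from the functional known at stage [t], and at most [2 * dl t] from the elements of
   [F] picked after [t]. *)
have ft t : (n <= t < N)%N -> ~~ F t -> `|f (y t)| <= 3 * dl t.
  move=> /andP[nt tN] Ft.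
  have hp s : (t <= s)%N -> exists2 b, b \in bits (size (mkseq m s)) &
      picks m F s = mask b (mkseq m s).
    by move=> _; have [b sb ->] := picks_mask m F s; exists b => //; rewrite size_mkseq -sb.
  have hns s : (t <= s)%N -> n \in iota 0 (size (mkseq m s)).+1.
    by move=> ts; rewrite mem_iota size_mkseq /= add0n ltnS (leq_trans nt).
  have T1 : `|H (n - size (picks m F t)) d (picks m F t) (x (m t))| <= dl t.
    have [b bb ->] := hp t (leqnn _).
    by have := ((mQ t).2 n (hns t (leqnn _)) d dl_ b bb).1; rewrite size_mkseq.
  have := @Ul_telescope R m F dl (fun k' => Gd d k' (x (m t))) n t N (ltnW tN) _
     (fun s => ltW (dl_gt0 s)).
  rewrite size_picks hn subnn => T2.
  have {}T2 : `|f (y t) - H (n - size (picks m F t)) d (picks m F t) (x (m t))|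
      <= \sum_(t <= s < N) dl s.
    apply: T2 => s /andP[ts sN] Fs.
    have tls : (t < s)%N.
      by rewrite ltn_neqAle ts andbT; apply: contraTneq Fs => <-.
    have hsz : (size (picks m F s) < n)%N.
      rewrite -hn size_picks -(subnKC sN) iotaD count_cat -[s.+1]addn1 iotaD count_cat /=.
      by rewrite add0n Fs; lia.
    have [b bb e] := hp s ts; rewrite e in hsz *.
    have := ((mQ s).2 n (hns s ts) d dl_ b bb).2 (m t) _ hsz; rewrite size_mkseq.
    by apply; apply: map_f; rewrite mem_iota.
  have := dl_sum (ltnW tN); have := dl_gt0 N.
  move: T1 T2; rewrite !ler_norml => /andP[a1 a2] /andP[b1 b2] c0 c1.
  by apply/andP; split; lra.
have : `|f (comb y (q - restr F q))| <= A * (6 / 64).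
  rewrite (@comb_widen _ _ _ _ N); last first.
    apply: leq_trans (size_polyD _ _) _; rewrite geq_max leqnn /= size_polyN.
    exact: size_cmul.
  rewrite (linear_functional_sum fl); apply: le_trans (ler_norm_sum _ _ _) _.
  apply: (@le_trans _ _ (\sum_(t < N) (3 * A * dl t))).
    apply: ler_sum => t _; rewrite linear_functionalZ // normrM coefB coef_restr.
    have p3 : 0 <= 3 * A * dl t by rewrite !mulr_ge0 // ltW.
    case Ft : (F t); first by rewrite subrr normr0 mul0r.
    rewrite subr0; case: (ltnP t n) => tn; first by rewrite hz ?Ft // normr0 mul0r.
    have := ft t; rewrite tn ltn_ord Ft => /(_ isT isT) h.
    by rewrite -mulrA mulrCA; apply: ler_pM.
  rewrite -mulr_sumr -(big_mkord xpredT dl).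
  have := dl_sum (leq0n N); have := dl_gt0 N.
  have -> : dl 0 = 64^-1 by rewrite /dl expr0 mulr1.
  move=> h1 h2.
  by rewrite [3 * A]mulrC -mulrA; apply: ler_wpM2l; [exact: ltW | lra].
rewrite combB linear_functionalD // linear_functionalN // ler_norml => /andP[h1 h2].
have := le_trans (ler_norm _) (fle (comb y q)); rewrite -/w in h1 h2 *.
lra.
Qed.

Let S q n := `|comb y (restr (fun i => i < n)%N q)|.

Let S_full q n : (size q <= n)%N -> S q n = `|comb y q|.
Proof.
move=> h; rewrite /S; congr (`|comb y _|); apply/polyP => i; rewrite coef_restr.
by case: ltnP => // hi; rewrite nth_default // (leq_trans h).
Qed.

Let coef_S q i : `|q`_i| <= S q i.+1 + S q i.
Proof.
have -> : `|q`_i| = `|comb y (restr (fun j => j < i.+1)%N q - restr (fun j => j < i)%N q)|.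
  have -> : restr (fun j => j < i.+1)%N q - restr (fun j => j < i)%N q = q`_i *: 'X^i.
    apply/polyP => j; rewrite coefB !coef_restr coefZ coefXn ltnS leq_eqVlt.
    case: eqP => [->|_] /=; first by rewrite ltnn subr0 mulr1.
    by rewrite subrr mulr0.
  by rewrite combZ combXn normrZ /y x1 mulr1.
by rewrite combB; exact: ler_normB.
Qed.

(** [key] is used for the initial segments, with [n] the length of the segment. If [B] is the
    largest partial sum, coefficients are at most [2 * B], and the loss [2 * B * (10/64)] is
    absorbed since [20/64 < 1/2]. *)
Let grunblum q n : S q n <= 2 * `|comb y q|.
Proof.
pose B := \big[Num.max/0]_(i < (size q).+1) S q i.
have B0 : 0 <= B by exact: bigmax_ge_id.
have SB i : S q i <= B.
  case: (leqP (size q) i) => h.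
    rewrite S_full // -(S_full (leqnn (size q))).
    exact: (@le_bigmax _ _ _ _ (fun i : 'I_(size q).+1 => S q i) ord_max).
  exact: (@le_bigmax _ _ _ _ (fun i : 'I_(size q).+1 => S q i) (Ordinal (ltnW h : i < (size q).+1)%N)).
have [B00|Bn] := eqVneq B 0.
  by apply: le_trans (SB n) _; rewrite B00 mulr_ge0.
have Bp : 0 < B by rewrite lt_neqAle eq_sym Bn.
have : B <= `|comb y q| + (2 * B) * (10 / 64).
  apply: bigmax_le; first by rewrite addr_ge0 // !mulr_ge0.
  move=> [i hi] _ /=; apply: (@key _ i) => //; first by rewrite mulr_gt0.
  - by move=> j; apply: le_trans (coef_S q j) _; have := SB j; have := SB j.+1; lra.
  - rewrite -(subnKC (hi : i <= size q)%N) iotaD count_cat add0n.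
    have /all_filterP/(congr1 size) : all (fun j => j < i)%N (iota 0 i).
      by apply/allP => j; rewrite mem_iota.
    rewrite size_filter size_iota => ->.
    rewrite (_ : count _ _ = 0%N) ?addn0 //; apply/eqP; rewrite -leqn0 leqNgt -has_count.
    by apply/hasPn => j; rewrite mem_iota -leqNgt => /andP[].
  - by move=> t ->.
have := SB n; lra.
Qed.

(** The bound on partial sums makes every coefficient at most 4 times the norm, and
    [4 * (10/64) < 1] is the extra loss in [key]. *)
Let schreier q n F : (forall i, (i < n)%N -> q`_i = 0) ->
  count F (iota 0 (size q)) = n -> `|comb y (restr F q)| <= 2 * `|comb y q|.
Proof.
move=> hz hn.
have hA i : `|q`_i| <= 4 * `|comb y q|.
  by apply: le_trans (coef_S q i) _; have := grunblum q i; have := grunblum q i.+1; lra.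
have [z|nz] := eqVneq `|comb y q| 0.
  have -> : restr F q = 0.
    apply/polyP => i; rewrite coef_restr coef0; case: ifP => // _.
    by apply/eqP; rewrite -normr_le0; apply: le_trans (hA i) _; rewrite z mulr0.
  by rewrite comb0 normr0 mulr_ge0.
have cp : 0 < `|comb y q| by rewrite lt_neqAle eq_sym nz normr_ge0.
have h4 : 0 < 4 * `|comb y q| by rewrite mulr_gt0.
have := key h4 hA hn (fun t ht _ => hz t ht); lra.
Qed.

Let increasing i : (m i < m i.+1)%N.
Proof. by apply: (mQ i.+1).1; apply/mapP; exists i => //; rewrite mem_iota add0n leqnn. Qed.

Lemma staged_choice_schreier : [/\ forall i, (m i < m i.+1)%N,
  forall q n, `|comb y (restr (fun i => i < n)%N q)| <= 2 * `|comb y q| &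
  forall q n F, (forall i, (i < n)%N -> q`_i = 0) ->
    count F (iota 0 (size q)) = n -> `|comb y (restr F q)| <= 2 * `|comb y q| ].
Proof. by split. Qed.

End Fixed.

Theorem schreier_unconditional_subsequence : exists m : nat -> nat,
  [/\ forall i, (m i < m i.+1)%N,
  forall q n, `|comb (x \o m) (restr (fun i => i < n)%N q)| <= 2 * `|comb (x \o m) q| &
  forall q n F, (forall i, (i < n)%N -> q`_i = 0) ->
    count F (iota 0 (size q)) = n ->
    `|comb (x \o m) (restr F q)| <= 2 * `|comb (x \o m) q| ].
Proof. by have [m mQ] := inductive_choice UQ; exists m; exact: staged_choice_schreier. Qed.

End Schreier.

(** * Basic sequences and spreading models through coefficient norms *)

Section MorePolynomials.
Variable R : realType.
Implicit Types (q r : {poly R}).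

Lemma comb_XnM (V : lmodType R) (x : nat -> V) n q :
  comb x ('X^n * q) = comb (fun i => x (n + i)%N) q.
Proof.
have -> : 'X^n * q = comb (fun i => 'X^(n + i)) q.
  rewrite -[q in LHS]comb_id -combMl; apply: comb_eq => i _; by rewrite exprD.
by rewrite comb_comb; apply: comb_eq => i _; rewrite combXn.
Qed.

Lemma comb_cons (V : lmodType R) (x : nat -> V) (c : R) q :
  comb x (q * 'X + c%:P) = c *: x 0%N + comb (fun i => x i.+1) q.
Proof.
rewrite combD addrC mulrC -['X]expr1 comb_XnM; congr (_ + _).
by rewrite -[c%:P]mulr1 mul_polyC combZ -(expr0 'X) combXn.
Qed.

Lemma nzs_cons (c : R) q :
  nzs (q * 'X + c%:P) = if c == 0 then nzs q else c :: nzs q.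
Proof.
rewrite addrC mulrC -['X]expr1 nzs_cat ?size_polyC ?leq_b1 //.
by rewrite /nzs polyseqC; case: eqP => //= /eqP ->.
Qed.

Lemma nzs_compress q : exists k : nat -> nat,
  (forall i, (k i < k i.+1)%N) /\ q = spread k (Poly (nzs q)).
Proof.
elim/poly_ind: q => [|q c [k [kI qE]]].
  by exists id; split=> //; rewrite nzs0 /= /spread comb0.
rewrite nzs_cons; case: (eqVneq c 0) => [->|c0].
  exists (fun i => (k i).+1); split=> //; rewrite addr0 {1}qE mulrC /spread -combMl.
  by apply: comb_eq => i _; rewrite exprS.
exists (fun i => if i is j.+1 then (k j).+1 else 0%N); split; first by case.
rewrite /= cons_poly_def /spread comb_cons addrC expr0 alg_polyC; congr (_ + _).
by rewrite {1}qE mulrC /spread -combMl; apply: comb_eq => i _; rewrite exprS.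
Qed.

Lemma size_Poly_nzs q : (size (Poly (nzs q)) <= size (nzs q))%N.
Proof. exact: size_Poly. Qed.

Lemma factor_Xn q L : (forall i, (i < L)%N -> q`_i = 0) -> exists r, q = 'X^L * r.
Proof.
move=> h; exists (drop_poly L q); rewrite mulrC -[LHS](poly_take_drop L) addrC.
by rewrite (_ : take_poly L q = 0) ?addr0 //; apply/polyP => i;
  rewrite coef_take_poly coef0; case: ifP => // /h.
Qed.

Lemma nzs_XnM n q : nzs ('X^n * q) = nzs q.
Proof. by rewrite -[X in nzs X]add0r nzs_cat ?size_poly0 // nzs0. Qed.

Lemma nzs_compress_above q L : (forall i, (i < L)%N -> q`_i = 0) ->
  exists k : nat -> nat, [/\ forall i, (k i < k i.+1)%N, (L <= k 0)%N &
    q = spread k (Poly (nzs q))].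
Proof.
move=> /factor_Xn[r ->]; have [k [kI rE]] := nzs_compress r.
exists (fun i => L + k i)%N; split=> [i||]; rewrite ?leq_addr ?ltn_add2l //.
rewrite nzs_XnM {1}rE /spread -combMl; apply: comb_eq => i _; by rewrite exprD.
Qed.

Lemma coef_spread_lt k q L i : (forall i, (k i < k i.+1)%N) -> (L <= k 0)%N ->
  (i < L)%N -> (spread k q)`_i = 0.
Proof.
move=> kI Lk iL; rewrite /spread /comb coef_sum big1 // => j _; rewrite coefZ coefXn.
have : (k 0 <= k j)%N by elim: (j : nat) => // l ih; apply: leq_trans ih (ltnW _).
by move=> h; rewrite ltn_eqF ?mulr0 //; lia.
Qed.

Lemma size_nzs_le q : (size (nzs q) <= size q)%N.
Proof. by rewrite size_filter count_size. Qed.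

Lemma comb_restr (V : lmodType R) (x : nat -> V) P q :
  comb x (restr P q) = comb (fun i => if P i then x i else 0) q.
Proof.
rewrite comb_cmul /comb; apply: eq_bigr => i _.
by case: (P i); rewrite ?mul1r // mul0r scale0r scaler0.
Qed.

Lemma restr_linear P (c : R) q r : restr P (c *: q + r) = c *: restr P q + restr P r.
Proof.
apply/polyP => i; rewrite coefD coefZ !coef_restr coefD coefZ.
by case: (P i); rewrite ?mulr0 ?addr0.
Qed.

Lemma restr_comb P (z : nat -> {poly R}) q :
  restr P (comb z q) = comb (fun i => restr P (z i)) q.
Proof. by rewrite (comb_morph z q (restr_linear P)). Qed.

Lemma restrXn P n : restr P 'X^n = if P n then 'X^n else 0 :> {poly R}.
Proof.
apply/polyP => i; rewrite coef_restr coefXn; case: eqP => [->|ne].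
  by case: (P n); rewrite ?coefXn ?eqxx ?coef0.
by case: (P i); case: (P n); rewrite ?coefXn ?coef0 //; case: eqP.
Qed.

Definition ofun n (a : 'I_n -> R) (i : nat) : R :=
  if insub i is Some j then a j else 0.

Lemma ofunE n (a : 'I_n -> R) (i : 'I_n) : ofun a i = a i.
Proof. by rewrite /ofun valK. Qed.

Definition opoly n (a : 'I_n -> R) : {poly R} := \poly_(i < n) ofun a i.

Lemma comb_opoly (V : lmodType R) (x : nat -> V) n (a : 'I_n -> R) :
  comb x (opoly a) = \sum_(i < n) a i *: x i.
Proof. by rewrite comb_poly; apply: eq_bigr => i _; rewrite ofunE. Qed.

Lemma coef_opoly n (a : 'I_n -> R) (i : 'I_n) : (opoly a)`_i = a i.
Proof. by rewrite coef_poly ltn_ord ofunE. Qed.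

Lemma opoly_coef n q : (size q <= n)%N -> opoly (fun i : 'I_n => q`_i) = q.
Proof.
move=> h; apply/polyP => i; rewrite coef_poly; case: ltnP => hi.
  by rewrite -[i]/(val (Ordinal hi)) ofunE.
by rewrite nth_default // (leq_trans h).
Qed.

Lemma increasing_extension n (k : 'I_n -> nat) :
  (forall i j : 'I_n, (i < j)%N -> (k i < k j)%N) ->
  exists k' : nat -> nat, (forall i, (k' i < k' i.+1)%N) /\ forall i : 'I_n, k' i = k i.
Proof.
(* From [n] on the values start above the sum of all [k j], hence above each of them. *)
move=> kI; pose k' i := if insub i is Some j then k j else (\sum_(j < n) k j + i).+1.
exists k'; split; last by move=> i; rewrite /k' valK.
move=> i; rewrite /k'; case: (ltnP i.+1 n) => h.
  by rewrite (insubT (fun i => i < n)%N (ltnW h)) (insubT (fun i => i < n)%N h); exact: kI.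
rewrite [insub i.+1]insubF ?(leq_gtF h) //; case: (ltnP i n) => h2.
  by rewrite (insubT (fun i => i < n)%N h2) ltnS (bigD1 (Ordinal h2)) //= -addnA leq_addr.
by rewrite insubF ?(leq_gtF h2) // !ltnS addnS.
Qed.

Lemma le_of_eps (eps : nat -> R) (u v : R) n0 : eps @ \oo --> (0 : R) ->
  (forall n, (n0 <= n)%N -> u <= (1 + eps n) * v) -> u <= v.
Proof.
move=> e0 H.
have c : (fun n => (1 + eps n) * v) @ \oo --> (1 + 0) * v.
  by apply: cvgMl; apply: cvgD => //; exact: cvg_cst.
rewrite addr0 mul1r in c; rewrite -(cvg_lim _ c) //.
apply: limr_ge; first by apply: cvgP c.
by exists n0.
Qed.

(** The definition of a spreading model asks for nonincreasing errors; [eta n] is the supremum of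
    the tail of the absolute values. *)
Lemma monotone_majorant (th : nat -> R) : th @ \oo --> (0 : R) ->
  exists eta : nat -> R, [/\ {homo eta : m n / (m <= n)%N >-> n <= m},
    eta @ \oo --> (0 : R) & forall n, `|th n| <= eta n].
Proof.
move=> th0; have bnd : exists M, forall n, `|th n| <= M.
  have /cvg_seq_bounded[M [_ /(_ (M + 1))]] : cvg (th @ \oo) by apply: cvgP th0.
  by rewrite ltrDl ltr01 => /(_ isT) h; exists (M + 1) => n; exact: h.
have [M thM] := bnd.
pose A n := [set `|th l| | l in [set l | (n <= l)%N]].
have hs n : has_sup (A n).
  by split; [exists `|th n|, n => /= | exists M => _ [l _ <-]].
have ub n l : (n <= l)%N -> `|th l| <= sup (A n).
  by move=> nl; apply: ub_le_sup; [exact: (hs n).2 | exists l].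
have lub n B : (forall l, (n <= l)%N -> `|th l| <= B) -> sup (A n) <= B.
  by move=> h; apply: ge_sup; [exact: (hs n).1 | move=> _ [l /= nl <-]; exact: h].
exists (fun n => sup (A n)); split=> [m n mn||n]; last exact: ub.
  by apply: lub => l nl; apply: ub; exact: leq_trans nl.
apply/cvgr0Pnorm_le => e e0.
have /cvgr0Pnorm_le/(_ e e0)[N _ hN] := th0.
exists N => // n /= Nn; rewrite ger0_norm.
  by apply: lub => l nl; apply: hN; rewrite /= (leq_trans Nn).
by apply: le_trans (ub n n (leqnn n)).
Qed.

End MorePolynomials.

Section Increasing.
Variable m : nat -> nat.
Hypothesis mI : forall i, (m i < m i.+1)%N.

Lemma incr_ge i : (i <= m i)%N.
Proof. by elim: i => // i ih; exact: leq_ltn_trans ih (mI i). Qed.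

Lemma incr_lt i j : (i < j)%N -> (m i < m j)%N.
Proof.
elim: j => // j ih; rewrite ltnS leq_eqVlt => /orP[/eqP ->|/ih h]; first exact: mI.
exact: ltn_trans h (mI j).
Qed.

Lemma incr_ltE i j : (m i < m j)%N = (i < j)%N.
Proof.
case: (ltngtP i j) => [/incr_lt ->|/incr_lt h|->] //; last by rewrite ltnn.
by rewrite ltnNge (ltnW h).
Qed.

End Increasing.

(** * Basic sequences through uniformly bounded initial projections *)

Section NormedSubspace.
Variables (R : realType) (V : lmodType R) (S : set V) (nv : V -> R).
Implicit Types (q r : {poly R}) (x : nat -> V).

Record normed_on : Prop := NormedOn {
  no0 : S 0;
  noL : forall (c : R) u v, S u -> S v -> S (c *: u + v);
  noD : forall u v, S u -> S v -> nv (u + v) <= nv u + nv v;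
  noZ : forall (c : R) u, S u -> nv (c *: u) = `|c| * nv u }.

Hypothesis NS : normed_on.

Lemma noSZ (c : R) u : S u -> S (c *: u).
Proof. by move=> h; rewrite -[_ *: _]addr0; apply: (noL NS) => //; exact: (no0 NS). Qed.

Lemma noSD u v : S u -> S v -> S (u + v).
Proof. by move=> h; rewrite -[u]scale1r; exact: (noL NS). Qed.

Lemma noSN u : S u -> S (- u).
Proof. by move=> h; rewrite -scaleN1r; exact: noSZ. Qed.

Lemma noSB u v : S u -> S v -> S (u - v).
Proof. by move=> h h'; apply: noSD => //; exact: noSN. Qed.

Lemma noS_sum (I : Type) (s : seq I) (P : pred I) (F : I -> V) :
  (forall i, S (F i)) -> S (\sum_(i <- s | P i) F i).
Proof.
by move=> h; elim/big_ind: _ => //; [exact: (no0 NS) | move=> u v; exact: noSD].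
Qed.

Lemma noS_comb x q : (forall n, S (x n)) -> S (comb x q).
Proof. by move=> h; apply: noS_sum => i; apply: noSZ. Qed.

Lemma no_nv0 : nv 0 = 0.
Proof. by have := noZ NS 0 (no0 NS); rewrite scale0r normr0 mul0r. Qed.

Lemma no_nvN u : S u -> nv (- u) = nv u.
Proof. by move=> h; rewrite -scaleN1r (noZ NS) // normrN1 mul1r. Qed.

Lemma no_ge0 u : S u -> 0 <= nv u.
Proof.
by move=> h; have := noD NS h (noSN h); rewrite subrr no_nv0 no_nvN //; lra.
Qed.

Lemma no_dist u v w : S u -> S v -> S w -> nv (u - v) <= nv (u - w) + nv (w - v).
Proof.
move=> hu hv hw; have -> : u - v = (u - w) + (w - v) by rewrite addrA subrK.
by apply: (noD NS); exact: noSB.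
Qed.

Lemma no_nvBC u v : S u -> S v -> nv (u - v) = nv (v - u).
Proof. by move=> hu hv; rewrite -no_nvN ?opprB //; exact: noSB. Qed.

Lemma no_rdist u v : S u -> S v -> `|nv u - nv v| <= nv (u - v).
Proof.
move=> hu hv; have := noD NS (noSB hu hv) hv; have := noD NS (noSB hv hu) hu.
rewrite !subrK (no_nvBC hv hu) ler_norml => h1 h2; by apply/andP; split; lra.
Qed.

Lemma no_sum (I : Type) (s : seq I) (P : pred I) (F : I -> V) :
  (forall i, S (F i)) -> nv (\sum_(i <- s | P i) F i) <= \sum_(i <- s | P i) nv (F i).
Proof.
move=> h; suff [] : S (\sum_(i <- s | P i) F i) /\
  nv (\sum_(i <- s | P i) F i) <= \sum_(i <- s | P i) nv (F i) by [].
elim/big_rec2: _ => [|i y z _ [h1 h2]]; first by rewrite no_nv0; split=> //; exact: (no0 NS).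
split; first exact: noSD.
by apply: le_trans (noD NS _ _) _ => //; rewrite lerD2l.
Qed.

(** Grunblum's criterion with basis constant [K]. Unlike [basic], which it implies for normalized
    sequences, it passes at once to subsequences, to the blocks built below and to the coordinate
    functionals. *)
Definition grunblum (K : R) x : Prop := forall q n,
  nv (comb x (restr (fun i => i < n)%N q)) <= K * nv (comb x q).

Section Basic.
Variables (K : R) (x : nat -> V).
Hypotheses (xn : normalized S nv x) (xG : grunblum K x).

Let Sx n : S (x n). Proof. exact: (xn n).1. Qed.

Let Sc q : S (comb x q). Proof. exact: noS_comb. Qed.

Lemma grunblum_ge1 : 1 <= K.
Proof.
have := xG 1 1; have -> : restr (fun i => i < 1)%N 1 = 1 :> {poly R}.
  by rewrite -(expr0 'X) restrXn.
by rewrite -(expr0 'X) combXn (xn 0).2 mulr1.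
Qed.

Lemma grunblum_coef q i : `|q`_i| <= 2 * K * nv (comb x q).
Proof.
have e : restr (fun j => j < i.+1)%N q - restr (fun j => j < i)%N q = q`_i *: 'X^i.
  apply/polyP => j; rewrite coefB !coef_restr coefZ coefXn ltnS leq_eqVlt.
  case: eqP => [->|_] /=; first by rewrite ltnn subr0 mulr1.
  by rewrite subrr mulr0.
have -> : `|q`_i| = nv (comb x (q`_i *: 'X^i)).
  by rewrite combZ combXn (noZ NS) // (xn i).2 mulr1.
rewrite -e combB; apply: le_trans (noD NS _ (noSN _)) _ => //.
by rewrite no_nvN //; have := xG q i; have := xG q i.+1; lra.
Qed.

(** On finite combinations the coordinate is Lipschitz with constant [2 * K]; the supremum of the
    lower cones is the usual Lipschitz extension of it, evaluated at [z]. *)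
Lemma coef_functional z i : S z ->
  exists c : R, forall q, `|c - q`_i| <= 2 * K * nv (z - comb x q).
Proof.
move=> Sz; pose A := [set q`_i - 2 * K * nv (z - comb x q) | q in [set: {poly R}]].
have K1 := grunblum_ge1.
have ub q : ubound A (q`_i + 2 * K * nv (z - comb x q)).
  move=> _ [r _ <-].
  have h1 := grunblum_coef (r - q) i; rewrite coefB combB in h1.
  have h2 := no_dist (Sc r) (Sc q) Sz.
  rewrite (no_nvBC (Sc r) Sz) in h2.
  have h3 : 2 * K * nv (comb x r - comb x q) <=
    2 * K * (nv (z - comb x r) + nv (z - comb x q)) by apply: ler_wpM2l => //; lra.
  have := le_trans (ler_norm _) (le_trans h1 h3); lra.
exists (sup A) => q; rewrite ler_norml; apply/andP; split.
  have : q`_i - 2 * K * nv (z - comb x q) <= sup A.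
    by apply: ub_le_sup; [exists ((0 : {poly R})`_i + 2 * K * nv (z - comb x 0)); exact: ub | exists q].
  lra.
have : sup A <= q`_i + 2 * K * nv (z - comb x q).
  by apply: ge_sup; [exists ((0 : {poly R})`_i - 2 * K * nv (z - comb x 0)), 0 | exact: ub].
lra.
Qed.

Lemma grunblum_basic : basic S nv x.
Proof.
have K1 := grunblum_ge1.
split=> // z Sz zx.
have [a aP] : exists a : nat -> R, forall i q, `|a i - q`_i| <= 2 * K * nv (z - comb x q).
  by exists (fun i => sval (cid (coef_functional i Sz))) => i; case: cid.
have zq e : 0 < e -> exists q, nv (z - comb x q) < e.
  by move=> /zx[n [b h]]; exists (opoly b); rewrite comb_opoly.
exists a; split.
  apply/cvgr0Pnorm_le => e e0.
  pose e1 := e / (2 + 2 * K).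
  have K2 : 0 < 2 + 2 * K by lra.
  have e10 : 0 < e1 by rewrite divr_gt0.
  (* [q] is fixed and serves all [N >= size q], while [r] depends on [N] and is so close to [z] that
     the [N] coordinate errors add up to at most [e1]. The three distances from [z] via [q] and [r']
     to the partial sum total [(2 + 2 * K) * e1]. *)
  have [q hq] := zq _ e10.
  exists (size q) => // N /= hN.
  have d0 : 0 < e1 / (N.+1%:R * (2 * K)).
    by rewrite divr_gt0 // mulr_gt0 ?ltr0n //; lra.
  have [r hr] := zq (Num.min e1 (e1 / (N.+1%:R * (2 * K)))) ltac:(by rewrite lt_min e10).
  move: hr; rewrite lt_min => /andP[hr1 hr2].
  set t := \sum_(i < N) a i *: x i.
  have tE : t = comb x (\poly_(i < N) a i) by rewrite comb_poly.
  have St : S t by rewrite tE.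
  rewrite ger0_norm; last by apply: no_ge0; exact: noSB.
  have qE : restr (fun i => i < N)%N q = q.
    apply/polyP => i; rewrite coef_restr; case: ltnP => // h.
    by rewrite nth_default // (leq_trans hN).
  pose r' := restr (fun i => i < N)%N r.
  have h1 : nv (comb x q - comb x r') <= K * (e1 + e1).
    have -> : comb x q - comb x r' = comb x (restr (fun i => i < N)%N (q - r)).
      rewrite -combB -[q in LHS]qE; congr comb; apply/polyP => i.
      by rewrite coefB !coef_restr coefB; case: ifP; rewrite ?subr0.
    apply: le_trans (xG _ _) _; apply: ler_wpM2l; first lra.
    rewrite combB; apply: le_trans (no_dist (Sc q) (Sc r) Sz) _.
    by rewrite (no_nvBC (Sc q) Sz) lerD // ltW.
  have h2 : nv (comb x r' - t) <= e1.
    rewrite tE -combB (@comb_widen _ _ _ _ N); last first.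
      apply: leq_trans (size_polyD _ _) _; rewrite geq_max size_polyN size_poly andbT.
      apply/leq_sizeP => j hj; rewrite coef_restr ltnNge hj //.
    apply: le_trans (no_sum _ _ _) _; first by move=> i; exact: noSZ.
    apply: (@le_trans _ _ (\sum_(i < N) 2 * K * (e1 / (N.+1%:R * (2 * K))))).
      apply: ler_sum => i _; rewrite (noZ NS) // (xn _).2 mulr1 coefB coef_restr ltn_ord.
      rewrite coef_poly ltn_ord distrC; apply: le_trans (aP i r) _.
      by apply: ler_wpM2l; [lra | exact: ltW].
    rewrite sumr_const card_ord -[_ *+ N]mulr_natl.
    have -> : N%:R * (2 * K * (e1 / (N.+1%:R * (2 * K)))) = e1 * (N%:R / N.+1%:R) :> R.
      have N0 : 0 <= N%:R :> R by [].
      by field; rewrite !gt_eqF //; lra.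
    rewrite -[X in _ <= X]mulr1 ler_wpM2l ?(ltW e10) // ler_pdivrMr ?ltr0n // mul1r.
    by rewrite ler_nat.
  have h3 := no_dist Sz St (Sc q); have h4 := no_dist (Sc q) St (Sc r').
  apply: (@le_trans _ _ (e1 * (2 + 2 * K))); first lra.
  by rewrite /e1 divfK // gt_eqF.
move=> b hb; apply/funext => i; apply/eqP; rewrite -subr_eq0 -normr_le0.
apply/ler_addgt0Pl => e e0; rewrite addr0.
have e1 : 0 < e / (2 * K) by rewrite divr_gt0 //; lra.
have /cvgr0Pnorm_le/(_ _ e1)[N _ hN] := hb.
have := aP i (\poly_(j < maxn N i.+1) b j).
rewrite coef_poly leq_max leqnn orbT comb_poly => h; apply: le_trans h _.
have := hN (maxn N i.+1) (leq_maxl _ _) => h.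
by rewrite mulrC -ler_pdivlMr; [exact: le_trans (ler_norm _) h | lra].
Qed.

Lemma grunblum_sub m : (forall i, (m i < m i.+1)%N) -> grunblum K (x \o m).
Proof.
move=> mI q n; rewrite -!(comb_spread x m).
have -> : spread m (restr (fun i => i < n)%N q) = restr (fun i => i < m n)%N (spread m q).
  rewrite /spread restr_comb comb_restr; apply: comb_eq => i _.
  by rewrite restrXn incr_ltE.
exact: xG.
Qed.

End Basic.

Lemma normalized_sub x m : normalized S nv x -> normalized S nv (x \o m).
Proof. by move=> h n; exact: h. Qed.

Lemma weakly_null_sub x m : (forall i, (m i < m i.+1)%N) ->
  weakly_null S nv x -> weakly_null S nv (x \o m).
Proof.
move=> mI h Phi bP; have /cvgr0Pnorm_le H := h Phi bP.
apply/cvgr0Pnorm_le => e e0; have [N _ hN] := H e e0.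
by exists N => // n /= Nn; apply: hN; exact: leq_trans Nn (incr_ge mI n).
Qed.

(** The spreading model inequality in homogeneous form: vectors supported from [L] on with at most
    [L] nonzero entries of any size. Positions need not be mentioned, because [p], being spreading,
    may be evaluated at [q] itself. *)
Definition models x (p : {poly R} -> R) (eps : nat -> R) : Prop :=
  forall L q, (forall i, (i < L)%N -> q`_i = 0) -> (size (nzs q) <= L)%N ->
  (1 + eps L)^-1 * p q <= nv (comb x q) <= (1 + eps L) * p q.

End NormedSubspace.

(** * Passing between spreading models and norms on coefficient sequences *)

Section GeneratedNorm.
Variables (R : realType) (V : lmodType R) (S : set V) (nv : V -> R).
Hypothesis NS : normed_on S nv.
Implicit Types (q r : {poly R}) (x : nat -> V).

Lemma sumabs_bound q i : `|q`_i| <= 1 + \sum_(j < size q) `|q`_j|.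
Proof.
case: (ltnP i (size q)) => h.
  rewrite (bigD1 (Ordinal h)) //=.
  have : 0 <= \sum_(j < size q | j != Ordinal h) `|q`_j| by apply: sumr_ge0.
  lra.
rewrite nth_default // normr0.
have : 0 <= \sum_(j < size q) `|q`_j| by apply: sumr_ge0.
lra.
Qed.

(** The spreading property is a consequence of the definition: [q] and its compression
    [Poly (nzs q)] are approximated by one and the same far vector, so their norms agree up to the
    square of [1 + eps n] for all large [n]. The bound on coefficients is removed by scaling. *)
Lemma generates_models x (E : normedModType R) (xt : nat -> E) :
  generates_spreading_model S nv x xt ->
  exists eps : nat -> R, [/\ forall n, 0 <= eps n,
    {homo eps : m n / (m <= n)%N >-> n <= m} /\ eps @ \oo --> (0 : R),
    models nv x (fun q => `|comb xt q|) eps, `|comb xt 1| = 1 &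
    forall q r, nzs q = nzs r -> `|comb xt q| = `|comb xt r| ].
Proof.
move=> [xn [_ [eps [emono [e0 H]]]]].
have eps0 n : 0 <= eps n.
  have c : cvg (eps @ \oo) by apply: cvgP e0.
  have := nonincreasing_cvgn_ge emono c n; rewrite (cvg_lim _ e0) //.
pose p q := `|comb xt q|.
have pZ (c : R) q : p (c *: q) = `|c| * p q by rewrite /p combZ normrZ.
have Sx n : S (x n) by exact: (xn n).1.
have I q k n : (forall i, (k i < k i.+1)%N) -> (size q <= n)%N -> (n <= k 0)%N ->
    (1 + eps n)^-1 * p q <= nv (comb x (spread k q)) <= (1 + eps n) * p q.
  move=> kI qn nk.
  have kmono i j : (i < j)%N -> (k i < k j)%N.
    exact: incr_lt.
  have {}H1 r : (size r <= n)%N -> (forall i, `|r`_i| <= 1) ->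
      (1 + eps n)^-1 * p r <= nv (comb x (spread k r)) <= (1 + eps n) * p r.
    move=> rn r1; have := H n (fun i => r`_i) (fun i => k i) _ _ _.
    rewrite comb_spread /p -!comb_opoly.
    have -> : \sum_(i < n) r`_i *: x (k i) = comb (x \o k) r by rewrite (comb_widen _ rn).
    rewrite opoly_coef //; apply.
    - by move=> i; rewrite -ler_norml.
    - move=> i; apply: leq_trans nk _; case: (posnP i) => [->//|i0].
      exact: ltnW (kmono _ _ i0).
    - by move=> i j; exact: kmono.
  pose A := 1 + \sum_(j < size q) `|q`_j|.
  have A0 : 0 < A.
    by have : 0 <= \sum_(j < size q) `|q`_j| by [apply: sumr_ge0]; rewrite /A; lra.
  pose r := A^-1 *: q.
  have qA : q = A *: r by rewrite scalerA divff ?gt_eqF // scale1r.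
  have r1 i : `|r`_i| <= 1.
    rewrite coefZ normrM normfV (gtr0_norm A0) mulrC ler_pdivrMr // mul1r.
    exact: sumabs_bound.
  have /andP[h1 h2] := H1 r (leq_trans (size_scale_leq _ _) qn) r1.
  have -> : p q = A * p r by rewrite qA pZ gtr0_norm.
  have -> : nv (comb x (spread k q)) = A * nv (comb x (spread k r)).
    rewrite [in LHS]qA /spread (combZ _ A r) (combZ x A) (noZ NS) ?gtr0_norm //.
    by apply: (noS_comb NS).
  rewrite [_^-1 * _]mulrCA [(1 + _) * _]mulrCA !ler_pM2l //.
  by rewrite h1.
have sq2 : (fun n => 2 * eps n + eps n * eps n) @ \oo --> (0 : R).
  rewrite [X in _ --> X](_ : 0 = 2 * 0 + 0 * 0); last by rewrite !mulr0 addr0.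
  by apply: cvgD; [apply: cvgMr | apply: cvgM].
have ip n : 0 < 1 + eps n by have := eps0 n; lra.
have inv1 q : p q = p (Poly (nzs q)).
  have [k [kI qE]] := nzs_compress q.
  set r := Poly (nzs q) in qE *.
  have sz : (size r <= size q)%N by exact: leq_trans (size_Poly_nzs q) (size_nzs_le q).
  have two n : (size q <= n)%N -> p q <= (1 + (2 * eps n + eps n * eps n)) * p r /\
      p r <= (1 + (2 * eps n + eps n * eps n)) * p q.
    move=> qn.
    have /andP[a1 a2] : (1 + eps n)^-1 * p q <= nv (comb x ('X^n * q)) <= (1 + eps n) * p q.
      have -> : 'X^n * q = spread (fun i => n + i)%N q.
        rewrite -[q in LHS]comb_id -combMl; apply: comb_eq => i _; by rewrite exprD.
      by apply: I; rewrite ?addn0 // => i; rewrite addnS.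
    have /andP[b1 b2] : (1 + eps n)^-1 * p r <= nv (comb x ('X^n * q)) <= (1 + eps n) * p r.
      have -> : 'X^n * q = spread (fun i => n + k i)%N r.
        rewrite {1}qE /spread -combMl; apply: comb_eq => i _; by rewrite exprD.
      by apply: I; rewrite ?leq_addr ?(leq_trans sz) // => i; rewrite ltn_add2l.
    have e : 1 + (2 * eps n + eps n * eps n) = (1 + eps n) * (1 + eps n) by ring.
    rewrite e; split; rewrite -mulrA -ler_pdivrMl //; first exact: le_trans a1 b2.
    exact: le_trans b1 a2.
  apply/eqP; rewrite eq_le; apply/andP; split;
    apply: (le_of_eps (n0 := size q) sq2) => n /two[].
  - by [].
  - by [].
exists eps; split=> // [L q qz qL||q r qr].
- have [k [kI Lk qE]] := nzs_compress_above qz.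
  have := I _ k L kI (leq_trans (size_Poly_nzs q) qL) Lk.
  by rewrite -qE -inv1.
- have h n : (1 <= n)%N -> p 1 <= (1 + eps n) * 1 /\ 1 <= (1 + eps n) * p 1.
    move=> n1.
    have kI i : (n + i < n + i.+1)%N by rewrite addnS.
    have /andP[a b] : (1 + eps n)^-1 * p 1 <= nv (comb x (spread (fun i => n + i)%N 1)) <=
        (1 + eps n) * p 1 by apply: I; rewrite ?size_poly1 ?addn0.
    move: a b; rewrite /spread -(expr0 'X) combXn combXn (xn _).2 expr0 => a b.
    by rewrite mulr1; move: a; rewrite ler_pdivrMl // mulr1.
  apply/eqP; rewrite eq_le; apply/andP; split;
    by apply: (le_of_eps (n0 := 1%N) e0) => n /h[].
- by rewrite -/(p q) -/(p r) inv1 qr -inv1.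
Qed.

(** Converts additive errors, valid for coefficients at most 1, into the relative errors of a
    spreading model: divide by the largest coefficient, which is at most [P q / c]. The model itself
    comes from [seminorm_realization]. *)
Lemma additive_spreading_model (K : R) x (P : {poly R} -> R) (th : nat -> R) (c : R) :
  normalized S nv x -> weakly_null S nv x -> grunblum nv K x ->
  (forall q r, P (q + r) <= P q + P r) ->
  (forall (d : R) q, P (d *: q) = `|d| * P q) ->
  (forall q r, nzs q = nzs r -> P q = P r) ->
  0 < c -> (forall q i, c * `|q`_i| <= P q) ->
  th @ \oo --> (0 : R) ->
  (forall L q, (forall i, (i < L)%N -> q`_i = 0) -> (size (nzs q) <= L)%N ->
    (forall i, `|q`_i| <= 1) -> `|nv (comb x q) - P q| <= th L) ->
  exists (F : completeNormedModType R) (xt : nat -> F) (y : nat -> V),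
    [/\ weakly_null S nv y, generates_spreading_model S nv y xt, grunblum nv K y &
        forall q, `|comb xt q| = P q].
Proof.
move=> xn xw xG PD PZ Pinv c0 cP th0 H.
have [F [u [ul uP]]] := seminorm_realization PD PZ.
have uE q : `|comb (fun i => u 'X^i) q| = P q.
  by rewrite -(comb_morph (fun i => 'X^i) q ul) comb_id uP.
have [eta [emono e0 the]] := monotone_majorant th0.
(* The first [N0] terms are dropped so that [t = eta / c] is at most [1/2]; then
   [(1 + 2 * t) * (1 - t) >= 1], and [2 * t] can serve as relative error. *)
have [N0 hN0] : exists N0, forall n, (N0 <= n)%N -> eta n <= c / 2.
  have c2 : 0 < c / 2 by lra.
  have /cvgr0Pnorm_le/(_ _ c2)[N _ hN] := e0; exists N => n Nn.
  exact: le_trans (ler_norm _) (hN n Nn).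
pose m i := (N0 + i)%N.
have mI i : (m i < m i.+1)%N by rewrite /m addnS.
exists F, (fun i => u 'X^i), (x \o m).
split=> //; [exact: weakly_null_sub | | exact: grunblum_sub].
split; first exact: normalized_sub.
split; first by apply: (grunblum_basic NS (normalized_sub m xn) (grunblum_sub xG mI)).
pose eps n := 2 / c * eta (m n).
exists eps; split.
  move=> i j ij; apply: ler_wpM2l; first by rewrite divr_ge0 // ltW.
  by apply: emono; rewrite leq_add2l.
split.
  rewrite [X in _ --> X](_ : 0 = 2 / c * 0); last by rewrite mulr0.
  apply: cvgMr; apply/cvgr0Pnorm_le => e ep; have /cvgr0Pnorm_le/(_ _ ep)[N _ hN] := e0.
  by exists N => // n /= Nn; apply: hN; apply: leq_trans Nn _; rewrite leq_addl.
move=> n a k _ nk kI.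
have [k' [k'I k'E]] := increasing_extension kI.
pose q := opoly a.
have -> : \sum_(i < n) a i *: u 'X^i = comb (fun i => u 'X^i) q by rewrite comb_opoly.
rewrite uE.
have -> : \sum_(i < n) a i *: (x \o m) (k i) = comb x (spread (m \o k') q).
  rewrite comb_spread comb_opoly; apply: eq_bigr => i _ /=; by rewrite k'E.
have mk i : ((m \o k') i < (m \o k') i.+1)%N by rewrite /= /m ltn_add2l.
have -> : P q = P (spread (m \o k') q) by apply: Pinv; rewrite nzs_spread.
set Q := spread _ q.
have [n0|n0] := posnP n.
  have q0 : q = 0 by apply/eqP; rewrite -size_poly_leq0 -n0 size_poly.
  have -> : Q = 0 by rewrite /Q q0 /spread comb0.
  by rewrite comb0 (no_nv0 NS) (_ : P 0 = 0) ?mulr0 ?lexx // -(scale0r 0) PZ normr0 mul0r.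
have mn : (m n <= (m \o k') 0)%N.
  by rewrite /= /m leq_add2l -[0%N]/(val (Ordinal n0)) k'E.
have Qz i : (i < m n)%N -> Q`_i = 0 by exact: coef_spread_lt.
have Qs : (size (nzs Q) <= m n)%N.
  rewrite nzs_spread //; apply: leq_trans (size_nzs_le _) _.
  by apply: leq_trans (size_poly _ _) _; rewrite leq_addl.
pose A := \big[Num.max/0]_(i < size Q) `|Q`_i|.
have QA i : `|Q`_i| <= A.
  case: (ltnP i (size Q)) => h; last by rewrite nth_default // normr0 bigmax_ge_id.
  exact: (@le_bigmax _ _ _ _ (fun i : 'I_(size Q) => `|Q`_i|) (Ordinal h)).
have AP : A <= c^-1 * P Q.
  apply: bigmax_le.
    by apply: mulr_ge0; [rewrite invr_ge0 ltW | exact: seminorm_ge0 PD PZ _].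
  by move=> i _; rewrite ler_pdivlMl.
have Pge := seminorm_ge0 PD PZ Q.
have main : `|nv (comb x Q) - P Q| <= eta (m n) * (c^-1 * P Q).
  have et0 : 0 <= eta (m n) by apply: le_trans (the (m n)).
  have [A0|A0] := eqVneq A 0.
    have -> : Q = 0.
      by apply/polyP => i; have := QA i; rewrite A0 normr_le0 coef0 => /eqP.
    rewrite comb0 (no_nv0 NS) (_ : P 0 = 0) ?subrr ?normr0 ?mulr0 //.
    by rewrite -(scale0r 0) PZ normr0 mul0r.
  have Ap : 0 < A by rewrite lt_neqAle eq_sym A0; exact: bigmax_ge_id.
  have Sx i : S (x i) by exact: (xn i).1.
  have := H (m n) (A^-1 *: Q); rewrite combZ (noZ NS) ?PZ; last by apply: (noS_comb NS).
  rewrite normfV (gtr0_norm Ap) -mulrBr normrM normfV (gtr0_norm Ap) => h.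
  have {}h : A^-1 * `|nv (comb x Q) - P Q| <= th (m n).
    apply: h => [i im||i].
    - by rewrite coefZ Qz // mulr0.
    - by rewrite nzsZ ?invr_eq0 // size_map.
    - by rewrite coefZ normrM normfV (gtr0_norm Ap) ler_pdivrMl // mulr1.
  rewrite ler_pdivrMl // in h; apply: le_trans h _.
  apply: le_trans (ler_wpM2l (ltW Ap) (le_trans (ler_norm _) (the (m n)))) _.
  by rewrite mulrC; apply: ler_wpM2l.
have eh := hN0 (m n) (leq_addr _ _).
have et0 : 0 <= eta (m n) by apply: le_trans (the (m n)).
pose t := eta (m n) / c.
have t0 : 0 <= t by rewrite divr_ge0 // ltW.
have t2 : t <= 2^-1 by rewrite /t ler_pdivrMr // mulrC.
have -> : eps n = 2 * t by rewrite /eps /t; ring.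
have {}main : `|nv (comb x Q) - P Q| <= t * P Q by rewrite /t -mulrA.
move: main; rewrite ler_norml => /andP[m1 m2].
apply/andP; split; last by nra.
rewrite ler_pdivrMl; last by lra.
have : (1 - t) * P Q <= nv (comb x Q) by lra.
move=> h; have h1 : (1 + 2 * t) * ((1 - t) * P Q) <= (1 + 2 * t) * nv (comb x Q).
  by apply: ler_wpM2l => //; lra.
apply: le_trans h1; rewrite mulrA -[X in X <= _]mul1r; apply: ler_wpM2r => //.
have -> : (1 + 2 * t) * (1 - t) = 1 + t * (1 - 2 * t) by ring.
by rewrite lerDl mulr_ge0 //; lra.
Qed.

End GeneratedNorm.

(** * Tensor products of coefficient sequences *)

Section RealLemmas.
Variable R : realType.

Lemma between (a b : nat -> R) : (forall m n, a m <= b n) ->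
  exists l, forall n, a n <= l <= b n.
Proof.
move=> h; exists (sup (range a)) => n; apply/andP; split.
  by apply: ub_le_sup; [exists (b 0%N) => _ [m _ <-] | exists n].
by apply: ge_sup; [exists (a 0%N), 0%N | move=> _ [m _ <-]].
Qed.

Lemma inv_le_of (u v : R) : 0 < v -> v^-1 <= u -> u^-1 <= v.
Proof.
move=> v0 h; have i0 : 0 < v^-1 by rewrite invr_gt0.
by rewrite -[v]invrK lef_pV2 ?posrE //; exact: lt_le_trans h.
Qed.

Lemma geo_gt0 n : 0 < 4^-1 ^+ n :> R.
Proof. by rewrite exprn_gt0 // invr_gt0. Qed.

Lemma geo_le m n : (m <= n)%N -> 4^-1 ^+ n <= 4^-1 ^+ m :> R.
Proof. by move=> mn; apply: ler_wiXn2l => //; lra. Qed.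

Lemma geo_limit (u : nat -> R) (C : R) :
  (forall n, `|u n.+1 - u n| <= C * 4^-1 ^+ n) ->
  exists l, forall n, `|u n - l| <= 2 * C * 4^-1 ^+ n.
Proof.
move=> h; pose a n := u n - 2 * C * 4^-1 ^+ n; pose b n := u n + 2 * C * 4^-1 ^+ n.
have C0 : 0 <= C by have := le_trans (normr_ge0 _) (h 0%N); rewrite expr0 mulr1.
have g n := geo_gt0 n.
have a_incr : {homo a : m n / (m <= n)%N >-> m <= n}.
  apply: (@homo_leq _ _ (fun x y => x <= y)) => // [x y z|n]; first exact: le_trans.
  have := h n; rewrite ler_norml => /andP[h1 h2]; rewrite /a exprS.
  have := mulr_ge0 C0 (ltW (g n)); lra.
have b_decr : {homo b : m n / (m <= n)%N >-> n <= m}.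
  apply: (@homo_leq _ _ (fun x y => y <= x)) => // [x y z xy yz|n]; first exact: le_trans yz xy.
  have := h n; rewrite ler_norml => /andP[h1 h2]; rewrite /b exprS.
  have := mulr_ge0 C0 (ltW (g n)); lra.
have ab n : a n <= b n.
  by rewrite /a /b; have := mulr_ge0 C0 (ltW (g n)); lra.
have [|l hl] := @between a b.
  move=> m n; case: (leqP m n) => mn.
    by apply: le_trans (a_incr _ _ mn) (ab n).
  by apply: le_trans (ab m) (b_decr _ _ (ltnW mn)).
exists l => n; have /andP[h1 h2] := hl n; rewrite /a /b in h1 h2.
by rewrite ler_norml; apply/andP; split; lra.
Qed.

Lemma geo_cvg0 : (fun n => 2^-1 ^+ n) @ \oo --> (0 : R).
Proof. by apply: cvg_expr; rewrite ger0_norm; lra. Qed.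

Lemma natS_le_2X n : n.+1%:R <= 2 ^+ n :> R.
Proof.
by rewrite -natrX ler_nat; elim: n => // n ih; rewrite expnS; lia.
Qed.

Lemma geo_half n : n.+1%:R * 4^-1 ^+ n <= 2^-1 ^+ n :> R.
Proof.
have -> : 4^-1 ^+ n = 2^-1 ^+ n * 2^-1 ^+ n :> R.
  by rewrite -exprMn; congr (_ ^+ _); field.
rewrite mulrA ler_piMl ?exprn_ge0 // exprVn ler_pdivrMr ?exprn_gt0 // mul1r.
exact: natS_le_2X.
Qed.

Lemma geo4_half n : 4^-1 ^+ n <= 2^-1 ^+ n :> R.
Proof. by apply: lerXn2r; rewrite ?nnegrE //; lra. Qed.

Lemma geo_small (C e : R) : 0 < e -> exists N, forall n, (N <= n)%N -> C * 4^-1 ^+ n <= e.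
Proof.
move=> e0; have C1 : 0 < `|C| + 1 by have := normr_ge0 C; lra.
have e1 : 0 < e / (`|C| + 1) by rewrite divr_gt0.
have /cvgr0Pnorm_le/(_ _ e1)[N _ hN] := geo_cvg0.
exists N => n Nn; have h := le_trans (ler_norm _) (hN n Nn).
rewrite ler_pdivlMr // in h; have := geo4_half n; have := geo_gt0 n; have := ler_norm C.
move=> h1 h2 h3; apply: le_trans h.
apply: (@le_trans _ _ (`|C| * 4^-1 ^+ n)); first by apply: ler_wpM2r.
by rewrite mulrC; apply: ler_pM => //; lra.
Qed.

Lemma le_of_geo (u v C : R) : (forall n, u <= v + C * 4^-1 ^+ n) -> u <= v.
Proof.
move=> h; apply/ler_addgt0Pl => e e0; have [N hN] := geo_small C e0.
by apply: le_trans (h N) _; rewrite addrC lerD2r; exact: hN.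
Qed.

Lemma le_of_geo_above (u v C : R) N : (forall n, (N <= n)%N -> u <= v + C * 4^-1 ^+ n) -> u <= v.
Proof.
move=> h; apply/ler_addgt0Pl => e e0; have [M hM] := geo_small C e0.
apply: le_trans (h (maxn N M) (leq_maxl _ _)) _; rewrite addrC lerD2r.
by apply: hM; exact: leq_maxr.
Qed.

End RealLemmas.

(** * Norms of products *)

Section Tensor.
Variable R : realType.
Implicit Types (a b q : {poly R}).

Definition l1 b : R := \sum_(i < size b) `|b`_i|.

Lemma l1_ge0 b : 0 <= l1 b.
Proof. exact: sumr_ge0. Qed.

Lemma sum_coef_nzs (f : R -> R) b : f 0 = 0 ->
  \sum_(i < size b) f b`_i = \sum_(c <- nzs b) f c.
Proof.
move=> f0; rewrite /nzs big_filter [RHS]big_mkcond [RHS](big_nth 0) big_mkord.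
by apply: eq_bigr => i _; case: eqP => // ->.
Qed.

Lemma l1_nzs b : (forall i, `|b`_i| <= 1) -> l1 b <= (size (nzs b))%:R.
Proof.
move=> h; rewrite /l1 (sum_coef_nzs _ (normr0 _)).
have H : forall c, c \in nzs b -> `|c| <= 1.
  by move=> c; rewrite mem_filter => /andP[_ /(nthP 0)[i _ <-]].
rewrite big_seq; apply: (@le_trans _ _ (\sum_(c <- nzs b | c \in nzs b) 1)).
  by apply: ler_sum => c; exact: H.
by rewrite -big_seq big_const_seq iter_addr_0 count_predT.
Qed.

Lemma nzs_tensE D b a : (size a <= D)%N ->
  nzs (tens D b a) = [seq c * d | c <- nzs b, d <- nzs a].
Proof.
move=> h; rewrite nzs_blocks => [|i _]; last by rewrite mulnS addnC leq_add2r.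
have -> : [seq nzs (b`_i *: a) | i <- iota 0 (size b)] = [seq nzs (c *: a) | c <- (b : seq R)].
  by rewrite -[X in map _ X = _]/(iota 0 (size b)) -[in RHS](mkseq_nth 0 b) /mkseq -map_comp.
rewrite /nzs; elim: (polyseq b) => //= c s ih.
by case: (eqVneq c 0) => [->|c0] /=; rewrite ih ?scale0r ?polyseq0 // -/(nzs _) nzsZ.
Qed.

Lemma restr_tens D b a P : (size a <= D)%N -> (0 < D)%N ->
  tens D b (restr P a) = restr (fun i => P (i %% D)%N) (tens D b a).
Proof.
move=> h D0; apply/polyP => t; rewrite coef_restr.
have e : t = (D * (t %/ D) + t %% D)%N by rewrite mulnC -divn_eq.
have ht := ltn_pmod t D0.
have h' : (size (restr P a) <= D)%N by apply: leq_trans (size_cmul _ _) h.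
have H q : (size q <= D)%N -> (tens D b q)`_t = b`_(t %/ D) * q`_(t %% D).
  by move=> hq; rewrite {1}e coef_tens.
by rewrite !H // coef_restr; case: (P _); rewrite ?mulr0.
Qed.

Section TensorNorm.
Variables (K : R) (p : {poly R} -> R).
Hypothesis ps : spreading_norm K p.

(** In the notation of the overview, [p (b (x) a)]; the outer coefficients [b] come first. *)
Definition ptens b a : R := p (tens (size a) b a).

Lemma ptensE D b a : (size a <= D)%N -> p (tens D b a) = ptens b a.
Proof. by move=> h; exact: (sn_tens ps b h (leqnn _)). Qed.

Lemma ptens_nzs b b' a a' : nzs b = nzs b' -> nzs a = nzs a' -> ptens b a = ptens b' a'.
Proof. by move=> h h'; apply: (sn_inv ps); rewrite !nzs_tensE // h h'. Qed.

Lemma ptens_ge0 b a : 0 <= ptens b a.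
Proof. exact: sn_ge0 ps _. Qed.

Lemma ptensDr b a a' : ptens b (a + a') <= ptens b a + ptens b a'.
Proof.
pose D := maxn (size a) (size a').
rewrite -(@ptensE D) ?(leq_trans (size_polyD _ _)) // -(@ptensE D b a) ?leq_maxl //.
rewrite -(@ptensE D b a') ?leq_maxr //.
by rewrite -[X in tens D b (X + _)]scale1r tens_linearr scale1r; exact: (snD ps).
Qed.

Lemma ptensZr b (c : R) a : ptens b (c *: a) = `|c| * ptens b a.
Proof.
rewrite -(@ptensE (size a)) ?size_scale_leq //.
rewrite -[c *: a]addr0 tens_linearr -(snZ ps) /ptens.
have -> : tens (size a) b 0 = 0.
  by rewrite /tens /comb big1 // => i _; rewrite mulr0 scaler0.
by rewrite addr0.
Qed.

Lemma ptensDl b b' a : ptens (b + b') a <= ptens b a + ptens b' a.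
Proof. by rewrite /ptens /tens combD; exact: (snD ps). Qed.

Lemma ptensZl b (c : R) a : ptens (c *: b) a = `|c| * ptens b a.
Proof. by rewrite /ptens /tens combZ; exact: (snZ ps). Qed.

Lemma ptens_l1 b a : ptens b a <= l1 b * p a.
Proof.
rewrite /ptens /tens /comb; apply: le_trans (sn_sum ps _ _ _) _.
rewrite /l1 mulr_suml; apply: ler_sum => i _.
by rewrite (snZ ps) (snXnM ps).
Qed.

Lemma ptens_l1r b a : ptens b a <= l1 a * p b.
Proof.
rewrite -(@ptensE (size a).+1) //; exact: (sn_tens_le ps).
Qed.

Lemma ptens_restr b a P : ptens b (restr P a) <= K * ptens b a.
Proof.
rewrite -!(@ptensE (size a).+1) //; last first.
  by apply: leq_trans (size_cmul _ _) _.
by rewrite restr_tens //; exact: (sn_restr ps).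
Qed.

Lemma ptens1r b : ptens b 1 = p b.
Proof.
apply: (sn_inv ps); rewrite nzs_tensE //.
have -> : nzs (1 : {poly R}) = [:: 1] by rewrite /nzs polyseq1 /= oner_eq0.
by elim: (nzs b) => //= c s ->; rewrite mulr1.
Qed.

Lemma ptens1l a : ptens 1 a = p a.
Proof.
apply: (sn_inv ps); rewrite nzs_tensE //.
have -> : nzs (1 : {poly R}) = [:: 1] by rewrite /nzs polyseq1 /= oner_eq0.
by rewrite /= cats0 -[RHS]map_id; apply: eq_map => c; rewrite mul1r.
Qed.

End TensorNorm.

End Tensor.

(** * Infinite coefficient sequences built by successive blocks *)

Section BlockSeries.
Variables (R : realType) (K : R) (p : {poly R} -> R).
Hypothesis ps : spreading_norm K p.
Implicit Types (a b q : {poly R}).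

(** Partial sums of an element of the closed span of the model, written as successive blocks. The
    initial block [1] keeps it away from zero and makes every product norm dominate [p] up to
    [K]. *)
Fixpoint bseries (B : nat -> {poly R}) i : {poly R} :=
  if i is j.+1 then bseries B j + 'X^(size (bseries B j)) * B j else 1.

Variable B : nat -> {poly R}.
Local Notation A := (bseries B).

Lemma size_bseriesS i : size (A i.+1) = (size (A i) + size (B i))%N.
Proof.
rewrite /=; have [->|b0] := eqVneq (B i) 0; first by rewrite mulr0 addr0 size_poly0 addn0.
have e : size ('X^(size (A i)) * B i) = (size (A i) + size (B i))%N.
  by rewrite size_monicM ?monicXn // size_polyXn.
by rewrite addrC size_polyDl e // -[X in (X < _)%N]addn0 ltn_add2l size_poly_gt0.
Qed.

Lemma size_bseries_le i j : (i <= j)%N -> (size (A i) <= size (A j))%N.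
Proof.
elim: j => [|j ih]; first by rewrite leqn0 => /eqP ->.
rewrite leq_eqVlt => /orP[/eqP ->//|/ih h]; apply: leq_trans h _.
by rewrite size_bseriesS leq_addr.
Qed.

Lemma size_bseries_gt0 i : (0 < size (A i))%N.
Proof. by apply: leq_trans (size_bseries_le (leq0n i)); rewrite size_poly1. Qed.

Lemma coef_bseries_low i j t : (i <= j)%N -> (t < size (A i))%N -> (A j)`_t = (A i)`_t.
Proof.
elim: j => [|j ih]; first by rewrite leqn0 => /eqP ->.
rewrite leq_eqVlt => /orP[/eqP ->//|]; rewrite ltnS => ij ti /=.
rewrite coefD coefXnM (leq_trans ti) ?size_bseries_le // addr0; exact: ih.
Qed.

Lemma bseries_coef0 i : (A i)`_0 = 1.
Proof.
rewrite (@coef_bseries_low 0 i) //; last by rewrite size_poly1.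
by rewrite /= coef1.
Qed.

Lemma restr_bseries i j : (j < i)%N ->
  restr (fun t => size (A j) <= t < size (A j.+1))%N (A i) = 'X^(size (A j)) * B j.
Proof.
move=> ji; have e := size_bseriesS j; apply/polyP => t; rewrite coef_restr coefXnM e.
case: (leqP (size (A j)) t) => h1 //=.
case: (ltnP t (size (A j) + size (B j))) => h2.
  rewrite (@coef_bseries_low j.+1 i) ?e //= coefD coefXnM (leq_gtF h1).
  by rewrite [(A j)`_t]nth_default ?add0r.
by rewrite nth_default // -(leq_add2l (size (A j))) subnKC.
Qed.

Hypothesis pB : forall i, p (B i) <= 4^-1 ^+ i.

Lemma bseries_tail i j : (i <= j)%N -> p (A j - A i) <= 2 * 4^-1 ^+ i - 2 * 4^-1 ^+ j.
Proof.
elim: j => [|j ih]; first by rewrite leqn0 => /eqP ->; rewrite subrr (sn0 ps); lra.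
rewrite leq_eqVlt => /orP[/eqP ->|]; first by rewrite subrr (sn0 ps); lra.
rewrite ltnS => ij /=; rewrite addrAC; apply: le_trans (snD ps _ _) _.
rewrite (snXnM ps); have := ih ij; have := pB j; have := geo_gt0 R j; rewrite exprS.
move: (p _) (p _) (4^-1 ^+ j) (4^-1 ^+ i) => u v w z; lra.
Qed.

Lemma bseries_tail_le i j : (i <= j)%N -> p (A j - A i) <= 2 * 4^-1 ^+ i.
Proof. by move=> ij; have := bseries_tail ij; have := geo_gt0 R j; lra. Qed.

Lemma bseries_norm_le i : p (A i) <= 3.
Proof.
have -> : A i = (A i - A 0) + 1 by rewrite subrK.
apply: le_trans (snD ps _ _) _; have := bseries_tail_le (leq0n i).
by rewrite (sn1 ps) expr0; lra.
Qed.

Lemma ptens_bseries_ge b i : p b <= K * ptens p b (A i).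
Proof.
rewrite -(ptens1r ps); have <- : restr (pred1 0%N) (A i) = 1.
  apply/polyP => t; rewrite coef_restr coef1 /=; case: eqP => // ->.
  exact: bseries_coef0.
exact: (ptens_restr ps).
Qed.

(** [Q b] stands for the norm of [b (x) a] with [a] the infinite series; the rate comes from the
    geometric bound on the blocks. *)
Definition series_norm (Q : {poly R} -> R) : Prop :=
  forall b i, `|ptens p b (A i) - Q b| <= 2 * l1 b * 4^-1 ^+ i.

Lemma series_norm_ex : exists Q, series_norm Q.
Proof.
have H b : exists l, forall i, `|ptens p b (A i) - l| <= 2 * l1 b * 4^-1 ^+ i.
  apply: geo_limit => i; apply: (@le_trans _ _ (ptens p b (B i))).
    have e : ptens p b ('X^(size (A i)) * B i) = ptens p b (B i).
      by apply: (ptens_nzs ps) => //; exact: nzs_XnM.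
    rewrite ler_norml; apply/andP; split; last first.
      have := ptensDr ps b (A i) ('X^(size (A i)) * B i); rewrite /= e; lra.
    have := ptensDr ps b (A i.+1) ((-1) *: ('X^(size (A i)) * B i)).
    rewrite (ptensZr ps) normrN1 mul1r e scaleN1r.
    have -> : A i.+1 - 'X^(size (A i)) * B i = A i by rewrite /= addrK.
    lra.
  apply: le_trans (ptens_l1 ps _ _) _; apply: ler_wpM2l; [exact: l1_ge0 | exact: pB].
by exists (fun b => sval (cid (H b))) => b; case: cid.
Qed.

Section SeriesNorm.
Variable Q : {poly R} -> R.
Hypothesis QA : series_norm Q.

Let up b i : ptens p b (A i) <= Q b + 2 * l1 b * 4^-1 ^+ i.
Proof. by have := QA b i; rewrite ler_norml => /andP[_]; lra. Qed.

Let dn b i : Q b <= ptens p b (A i) + 2 * l1 b * 4^-1 ^+ i.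
Proof. by have := QA b i; rewrite ler_norml => /andP[]; lra. Qed.

Lemma series_normD b b' : Q (b + b') <= Q b + Q b'.
Proof.
apply: (@le_of_geo _ _ _ (2 * l1 (b + b') + 2 * l1 b + 2 * l1 b')) => i.
have := dn (b + b') i; have := ptensDl ps b b' (A i); have := up b i; have := up b' i; lra.
Qed.

Lemma series_normZ (c : R) b : Q (c *: b) = `|c| * Q b.
Proof.
apply/eqP; rewrite eq_le; apply/andP; split.
  apply: (@le_of_geo _ _ _ (2 * l1 (c *: b) + `|c| * (2 * l1 b))) => i.
  have := dn (c *: b) i; rewrite (ptensZl ps).
  have := ler_wpM2l (normr_ge0 c) (up b i); lra.
apply: (@le_of_geo _ _ _ (2 * l1 (c *: b) + `|c| * (2 * l1 b))) => i.
have := up (c *: b) i; rewrite (ptensZl ps).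
have := ler_wpM2l (normr_ge0 c) (dn b i); lra.
Qed.

Lemma series_norm_inv b b' : nzs b = nzs b' -> Q b = Q b'.
Proof.
move=> h; have e i : ptens p b (A i) = ptens p b' (A i) by exact: (ptens_nzs ps).
apply/eqP; rewrite eq_le; apply/andP; split;
  apply: (@le_of_geo _ _ _ (2 * l1 b + 2 * l1 b')) => i.
  by have := dn b i; have := up b' i; rewrite e; lra.
by have := up b i; have := dn b' i; rewrite e; lra.
Qed.

Lemma series_norm_ge b : p b <= K * Q b.
Proof.
have K1 := sn_K_ge1 ps.
apply: (@le_of_geo _ _ _ (K * (2 * l1 b))) => i; apply: le_trans (ptens_bseries_ge b i) _.
have := ler_wpM2l (le_trans ler01 K1) (up b i); lra.
Qed.

(** Unconditionality isolates the [j]-th block inside all copies simultaneously. *)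
Lemma series_norm_block b j : ptens p b (B j) <= K * Q b.
Proof.
have K1 := sn_K_ge1 ps.
apply: (@le_of_geo_above _ _ _ (K * (2 * l1 b)) j.+1) => i ji.
have <- : ptens p b ('X^(size (A j)) * B j) = ptens p b (B j).
  by apply: (ptens_nzs ps) => //; exact: nzs_XnM.
rewrite -(restr_bseries ji); apply: le_trans (ptens_restr ps _ _ _) _.
have := ler_wpM2l (le_trans ler01 K1) (up b i); lra.
Qed.

(** Head and tail are treated differently: the product with the fixed head [A i] costs only
    [l1 (A i)], and the tail is small enough for the domination by [Q] to be absorbed once [i] is
    large. *)
Lemma series_norm_split (C : R) b i :
  (forall a, ptens p b a <= C * p a * Q b) -> 0 <= C ->
  Q b <= l1 (A i) * p b + C * (2 * 4^-1 ^+ i) * Q b.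
Proof.
move=> h C0; have K1 := sn_K_ge1 ps.
have Q0 : 0 <= Q b.
  have := series_norm_ge b; have := sn_ge0 ps b => h1 h2.
  have : 0 <= K * Q b by apply: le_trans h1 h2.
  by rewrite pmulr_rge0 //; lra.
apply: (@le_of_geo_above _ _ _ (2 * l1 b) i) => j ij.
have := dn b j; have -> : A j = A i + (A j - A i) by rewrite addrC subrK.
have := ptensDr ps b (A i) (A j - A i); have := ptens_l1r ps b (A i).
have := h (A j - A i).
have : C * p (A j - A i) * Q b <= C * (2 * 4^-1 ^+ i) * Q b.
  by apply: ler_wpM2r => //; apply: ler_wpM2l => //; exact: bseries_tail_le.
lra.
Qed.

End SeriesNorm.

End BlockSeries.

(** * Spreading models of block sequences *)

Section BlockModels.
Variables (R : realType) (V : lmodType R) (S : set V) (nv : V -> R).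
Hypothesis NS : normed_on S nv.
Implicit Types (q a b : {poly R}).
Variables (x : nat -> V) (Kb K : R) (p : {poly R} -> R) (eps : nat -> R).
Hypotheses (xn : normalized S nv x) (xw : weakly_null S nv x).
Hypothesis xG : grunblum nv Kb x.
Hypothesis ps : spreading_norm K p.
Hypothesis eps_ge0 : forall n, 0 <= eps n.
Hypothesis eps_cvg : eps @ \oo --> (0 : R).
Hypothesis xp : models nv x p eps.

Let Sx n : S (x n). Proof. exact: (xn n).1. Qed.
Let Sc q : S (comb x q). Proof. exact: (noS_comb NS). Qed.

Lemma functional_comb Phi (z : nat -> V) q : bounded_functional S nv Phi ->
  (forall n, S (z n)) -> Phi (comb z q) = \sum_(i < size q) q`_i * Phi (z i).
Proof.
move=> [PL _] Sz.
have P0 : Phi 0 = 0.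
  have := PL 1 0 0 (no0 NS) (no0 NS); rewrite scale1r addr0 mul1r; lra.
rewrite /comb; suff [] : S (\sum_(i < size q) q`_i *: z i) /\
  Phi (\sum_(i < size q) q`_i *: z i) = \sum_(i < size q) q`_i * Phi (z i) by [].
elim/big_rec2: _ => [|i u v _ [h1 h2]]; first by split=> //; exact: (no0 NS).
by split; [apply: (noL NS) | rewrite PL // h2].
Qed.

Lemma models_dist L q : (forall i, (i < L)%N -> q`_i = 0) -> (size (nzs q) <= L)%N ->
  `|nv (comb x q) - p q| <= eps L * p q.
Proof.
move=> h1 h2; have /andP[a1 a2] := xp h1 h2; have e0 := eps_ge0 L.
have p0 := sn_ge0 ps q.
rewrite ler_norml; apply/andP; split; last by lra.
rewrite ler_pdivrMl in a1; last by lra.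
have n0 : 0 <= nv (comb x q) by exact: (no_ge0 NS (Sc q)).
nra.
Qed.

Section Series.
Variable B : nat -> {poly R}.
Hypothesis pB : forall i, p (B i) <= 4^-1 ^+ i.
Variable Q : {poly R} -> R.
Hypothesis QA : series_norm p B Q.
Local Notation A := (bseries B).

Let N0 i : exists N, forall n, (N <= n)%N -> i.+1%:R * eps n <= 4^-1 ^+ i.
Proof.
have e0 : 0 < 4^-1 ^+ i / i.+1%:R :> R by rewrite divr_gt0 ?geo_gt0 // ltr0n.
have /cvgr0Pnorm_le/(_ _ e0)[N _ hN] := eps_cvg; exists N => n Nn.
have := le_trans (ler_norm _) (hN n Nn); rewrite ler_pdivlMr ?ltr0n //.
by rewrite mulrC.
Qed.

(** The gaps between the positions [k i] of the copies: late enough for [eps (k i)] to be below the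
    geometric rate, and large enough that copies are disjoint and that [i] copies of [A i] have at
    most [k i] nonzero entries. *)
Let G j := (sval (cid (N0 j)) + j.+2 * size (A j))%N.
Let k i := (\sum_(j < i.+1) G j)%N.

Let kS i : k i.+1 = (k i + G i.+1)%N.
Proof. by rewrite /k big_ord_recr. Qed.

Let Gk i : (G i <= k i)%N.
Proof. by rewrite /k big_ord_recr /= leq_addl. Qed.

Let sG i : (size (A i) <= G i)%N.
Proof. by rewrite /G mulSn; lia. Qed.

Let k_gap i : (k i + size (A i) <= k i.+1)%N.
Proof.
rewrite kS leq_add2l; apply: leq_trans (sG _); exact: size_bseries_le.
Qed.

Let kI i : (k i < k i.+1)%N.
Proof. by apply: leq_trans (k_gap i); have := size_bseries_gt0 B i; lia. Qed.

Let k_gapL L i : (L <= i)%N -> (k i + size (A L) <= k i.+1)%N.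
Proof.
by move=> Li; apply: leq_trans (k_gap i); rewrite leq_add2l; exact: size_bseries_le.
Qed.

Let k_le i j : (i <= j)%N -> (k i <= k j)%N.
Proof.
rewrite leq_eqVlt => /orP[/eqP ->//|h]; exact: ltnW (incr_lt kI h).
Qed.

Let k_size i : (size (A i) <= k i)%N.
Proof. exact: leq_trans (sG i) (Gk i). Qed.

Let k_mul i : (i * size (A i) <= k i)%N.
Proof.
apply: leq_trans (Gk i); rewrite /G; apply: leq_trans (leq_addl _ _).
by rewrite leq_mul2r; apply/orP; right; lia.
Qed.

Let k_eps i : i.+1%:R * eps (k i) <= 4^-1 ^+ i.
Proof.
have h := svalP (cid (N0 i)); apply: h; apply: leq_trans (Gk i).
by rewrite /G leq_addr.
Qed.

Let eps_geo i : eps (k i) <= 4^-1 ^+ i.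
Proof.
apply: le_trans (k_eps i); rewrite -[X in X <= _]mul1r; apply: ler_wpM2r => //.
by rewrite ler1n.
Qed.

Let eps_le1 i : eps (k i) <= 1.
Proof. by apply: le_trans (eps_geo i) _; rewrite -[X in _ <= X](expr0 4^-1) geo_le. Qed.

Let low n q i : (i < n)%N -> ('X^n * q)`_i = 0.
Proof. by move=> h; rewrite coefXnM h. Qed.

Let shift_dist i q : (size q <= k i)%N ->
  `|nv (comb x ('X^(k i) * q)) - p q| <= eps (k i) * p q.
Proof.
move=> h; have := models_dist (L := k i) (fun j => @low (k i) q j) _.
rewrite nzs_XnM (snXnM ps); apply; exact: leq_trans (size_nzs_le _) h.
Qed.

Let shift_le i q : (size q <= k i)%N -> nv (comb x ('X^(k i) * q)) <= 2 * p q.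
Proof.
move=> h; have := shift_dist h; rewrite ler_norml => /andP[_].
have := ler_wpM2r (sn_ge0 ps q) (eps_le1 i); lra.
Qed.

Let r i := nv (comb x ('X^(k i) * A i)).
Let rho := Q 1.

Let l1_1 : l1 (1 : {poly R}) = 1.
Proof. by rewrite /l1 size_poly1 big_ord_recl big_ord0 addr0 coef1 normr1. Qed.

Let pA_rho i : `|p (A i) - rho| <= 2 * 4^-1 ^+ i.
Proof. by have := QA 1 i; rewrite (ptens1l ps) l1_1 mulr1. Qed.

Let K1 : 1 <= K. Proof. exact: (sn_K_ge1 ps). Qed.

Let rho_ge : K^-1 <= rho.
Proof.
have k1 : 1 <= K := K1.
have := series_norm_ge ps QA 1; rewrite (sn1 ps) => h.
by rewrite -[K^-1]mulr1 ler_pdivrMl //; lra.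
Qed.

Let rho_gt0 : 0 < rho.
Proof.
have k1 : 1 <= K := K1.
by apply: lt_le_trans rho_ge; rewrite invr_gt0; lra. Qed.

Let pA_ge i : K^-1 <= p (A i).
Proof.
have k1 : 1 <= K := K1.
have := ptens_bseries_ge ps B 1 i; rewrite (sn1 ps) (ptens1l ps) => h.
by rewrite -[K^-1]mulr1 ler_pdivrMl //; lra.
Qed.

Let r_ge i : (2 * K)^-1 <= r i.
Proof.
have k1 : 1 <= K := K1.
have /andP[h _] : (1 + eps (k i))^-1 * p ('X^(k i) * A i) <= r i <= (1 + eps (k i)) * p ('X^(k i) * A i).
  apply: xp; first exact: low.
  by rewrite nzs_XnM; exact: leq_trans (size_nzs_le _) (k_size i).
apply: le_trans h; rewrite (snXnM ps) invfM; apply: ler_pM => //.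
- by rewrite invr_ge0; lra.
- by rewrite lef_pV2 ?posrE //; have := eps_le1 i; have := eps_ge0 (k i); lra.
Qed.

Let r_gt0 i : 0 < r i.
Proof.
have k1 : 1 <= K := K1.
by apply: lt_le_trans (r_ge i); rewrite invr_gt0; lra. Qed.

Let r_rho i : `|r i - rho| <= 5 * 4^-1 ^+ i.
Proof.
have h1 := shift_dist (k_size i); have h2 := pA_rho i.
have h3 := bseries_norm_le ps pB i; have h4 := eps_geo i.
have h5 : eps (k i) * p (A i) <= 4^-1 ^+ i * 3 by apply: ler_pM => //; exact: (sn_ge0 ps _).
apply: le_trans (ler_distD (p (A i)) _ _) _; rewrite -/(r i) in h1; lra.
Qed.

(** The [i]-th copy carries the truncation [A i], so it is a finite block. The copies are not
    identical, but their differences decay geometrically and disappear in the spreading model. *)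
Let z i := (r i)^-1 *: comb x ('X^(k i) * A i).
Let Z i := (r i)^-1 *: ('X^(k i) * A i).

Let zZ i : z i = comb x (Z i).
Proof. by rewrite /Z combZ. Qed.

Let comb_z b : comb z b = comb x (comb Z b).
Proof. by rewrite comb_comb; apply: comb_eq => i _; exact: zZ. Qed.

Let z_normalized : normalized S nv z.
Proof.
move=> i; split; first by rewrite zZ.
by rewrite /z (noZ NS) // normfV (gtr0_norm (r_gt0 i)) -/(r i) mulVf // gt_eqF.
Qed.

Let z_grunblum : grunblum nv Kb z.
Proof.
move=> q n; rewrite !comb_z.
have -> : comb Z (restr (fun i => i < n)%N q) = restr (fun i => i < k n)%N (comb Z q).
  rewrite restr_comb comb_restr; apply: comb_eq => i _.
  apply/polyP => t; rewrite coef_restr; case: ltnP => ni.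
    case: ltnP => // kt; rewrite /Z coefZ coefXnM.
    have h : (k i + size (A i) <= t)%N.
      by apply: leq_trans kt; apply: leq_trans (k_gap i) (k_le ni).
    rewrite ltnNge (leq_trans (leq_addr _ _) h) /= nth_default ?mulr0 //.
    by rewrite -(leq_add2l (k i)) subnKC // (leq_trans (leq_addr _ _) h).
  rewrite coef0; case: ltnP => // tk; rewrite /Z coefZ low ?mulr0 //.
  exact: leq_trans tk (k_le ni).
exact: xG.
Qed.

(** The tails [A i - A L] are uniformly small, and on the shifted copies of the fixed head [A L] a
    functional is a finite combination of subsequences of its values at [x]. *)
Let z_weakly_null : weakly_null S nv z.
Proof.
have k1 : 1 <= K := K1.
move=> Phi bP; have [PL [C hC]] := bP.
have Cn u : S u -> `|Phi u| <= `|C| * nv u.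
  move=> Su; apply: le_trans (hC u Su) _; apply: ler_wpM2r; last exact: ler_norm.
  exact: (no_ge0 NS Su).
apply/cvgr0Pnorm_le => e e0.
pose M := 2 * K.
have M0 : 0 < M by rewrite /M; lra.
have e1 : 0 < e / (2 * M) by rewrite divr_gt0 //; lra.
have [L hL] := geo_small (`|C| * 4) e1.
have Phi_tail i : (L <= i)%N -> `|Phi (comb x ('X^(k i) * (A i - A L)))| <= e / (2 * M).
  move=> Li; apply: le_trans (Cn _ (Sc _)) _; apply: le_trans (hL L (leqnn L)).
  rewrite -mulrA; apply: ler_wpM2l => //.
  have sz : (size (A i - A L)%R <= k i)%N.
    apply: leq_trans (size_polyD _ _) _; rewrite size_polyN geq_max k_size /=.
    exact: leq_trans (size_bseries_le B Li) (k_size i).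
  apply: le_trans (shift_le sz) _; have := bseries_tail_le ps pB Li; lra.
have c0 : (fun i => Phi (comb x ('X^(k i) * A L))) @ \oo --> (0 : R).
  have -> : (fun i => Phi (comb x ('X^(k i) * A L))) =
      (fun i => \sum_(l < size (A L)) (A L)`_l * Phi (x (k i + l)%N)).
    by apply/funext => i; rewrite comb_XnM (functional_comb _ bP) // => n; exact: Sx.
  elim: (size (A L)) => [|n ih].
    rewrite [X in X @ _](_ : _ = fun=> 0); first exact: cvg_cst.
    by apply/funext => i; rewrite big_ord0.
  rewrite [X in X @ _](_ : _ = fun i => \sum_(l < n) (A L)`_l * Phi (x (k i + l)%N) +
     (A L)`_n * Phi (x (k i + n)%N)); last by apply/funext => i; rewrite big_ord_recr.
  rewrite -[X in _ --> X]addr0; apply: cvgD => //.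
  rewrite -[X in _ --> X](mulr0 (A L)`_n); apply: cvgMr.
  have mI i : (k i + n < k i.+1 + n)%N by rewrite ltn_add2r.
  exact: (weakly_null_sub mI xw).
have /cvgr0Pnorm_le/(_ _ e1)[N1 _ hN1] := c0.
exists (maxn L N1) => // i /=; rewrite geq_max => /andP[Li Ni].
have -> : Phi (z i) = (r i)^-1 * (Phi (comb x ('X^(k i) * A L)) + Phi (comb x ('X^(k i) * (A i - A L)))).
  have Phi0 : Phi 0 = 0 by have := PL 1 0 0 (no0 NS) (no0 NS); rewrite scale1r addr0 mul1r; lra.
  have := PL 1 _ _ (Sc ('X^(k i) * A L)) (Sc ('X^(k i) * (A i - A L))).
  rewrite scale1r mul1r -combD -mulrDr addrC subrK addrC => <-.
  have := PL (r i)^-1 (comb x ('X^(k i) * A i)) 0 (Sc _) (no0 NS).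
  by rewrite !addr0 Phi0 addr0.
rewrite normrM normfV (gtr0_norm (r_gt0 i)) ler_pdivrMl //.
apply: le_trans (ler_normD _ _) _.
have := hN1 i Ni; have := Phi_tail i Li => a1 a2.
have : (2 * K)^-1 * e <= r i * e by apply: ler_wpM2r; [exact: ltW | exact: r_ge].
have -> : (2 * K)^-1 * e = e / (2 * M) + e / (2 * M).
  by rewrite /M; field; rewrite gt_eqF //; lra.
move: a1 a2 => /=; lra.
Qed.

Let P b := rho^-1 * Q b.
Let c1 : R := 3 * (2 * K) * (K * 5) + 2 * (2 * K).

Let inv_dist i : `|(r i)^-1 - rho^-1| <= (2 * K) * (K * 5) * 4^-1 ^+ i.
Proof.
have k1 : 1 <= K := K1.
have r0 := r_gt0 i; have h0 := rho_gt0.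
have -> : (r i)^-1 - rho^-1 = (r i)^-1 * rho^-1 * (rho - r i).
  by field; rewrite !gt_eqF.
rewrite normrM distrC gtr0_norm ?mulr_gt0 ?invr_gt0 //.
have a1 : (r i)^-1 <= 2 * K by apply: inv_le_of; [lra | exact: r_ge].
have a2 : rho^-1 <= K by apply: inv_le_of; [lra | exact: rho_ge].
have -> : 2 * K * (K * 5) * 4^-1 ^+ i = 2 * K * K * (5 * 4^-1 ^+ i) by ring.
apply: ler_pM => //.
  by rewrite mulr_ge0 // invr_ge0 ltW.
by apply: ler_pM => //; rewrite invr_ge0 ltW.
Qed.

Let coef_dist L i : (L <= i)%N ->
  p ((r i)^-1 *: A i - rho^-1 *: A L) <= c1 * 4^-1 ^+ L.
Proof.
have k1 : 1 <= K := K1.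
move=> Li.
have -> : (r i)^-1 *: A i - rho^-1 *: A L =
    ((r i)^-1 - rho^-1) *: A i + rho^-1 *: (A i - A L).
  by rewrite scalerBl scalerBr addrA subrK.
apply: le_trans (snD ps _ _) _; rewrite !(snZ ps).
have h1 : `|(r i)^-1 - rho^-1| * p (A i) <= ((2 * K) * (K * 5) * 4^-1 ^+ L) * 3.
  apply: ler_pM => //; [exact: (sn_ge0 ps _) | | exact: (bseries_norm_le ps pB i)].
  apply: le_trans (inv_dist i) _; apply: ler_wpM2l; last exact: geo_le.
  by rewrite !mulr_ge0 //; lra.
have h2 : `|rho^-1| * p (A i - A L) <= K * (2 * 4^-1 ^+ L).
  apply: ler_pM => //; [exact: (sn_ge0 ps _) | | exact: (bseries_tail_le ps pB Li)].
  by rewrite gtr0_norm ?invr_gt0 //; apply: inv_le_of; [lra | exact: rho_ge].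
rewrite /c1; have := geo_gt0 R L; have := mulr_ge0 (le_trans ler01 K1) (ltW (geo_gt0 R L)).
lra.
Qed.

(** Beyond [L] every normalized copy may be exchanged for [A L] divided by [rho], at a cost of order
    [4^-L] for each of at most [L] terms. What results has the entries of [b (x) A L], to which the
    model given for [x] applies. *)
Let P_approx L b : (forall i, (i < L)%N -> b`_i = 0) -> (size (nzs b) <= L)%N ->
  (forall i, `|b`_i| <= 1) ->
  `|nv (comb z b) - P b| <= (2 * c1 + 5 * K) * (L.+1%:R * 4^-1 ^+ L).
Proof.
have k1 : 1 <= K := K1.
move=> bz bs b1.
have lb : l1 b <= L%:R by apply: le_trans (l1_nzs b1) _; rewrite ler_nat.
pose W := comb (fun i => 'X^(k i) * A L) b.
have gL := geo_gt0 R L.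
have L0 : 0 <= L%:R :> R by [].
have LS : L%:R <= L.+1%:R :> R by rewrite ler_nat.
have c10 : 0 <= c1 by rewrite /c1 addr_ge0 // !mulr_ge0 //; lra.
have ri0 : `|rho^-1| <= K.
  by rewrite gtr0_norm ?invr_gt0 //; apply: inv_le_of; [lra | exact: rho_ge].
have h1 : nv (comb z b - rho^-1 *: comb x W) <= 2 * c1 * (L%:R * 4^-1 ^+ L).
  have -> : comb z b - rho^-1 *: comb x W =
      \sum_(i < size b) b`_i *: comb x ('X^(k i) * ((r i)^-1 *: A i - rho^-1 *: A L)).
    rewrite comb_z -combZ -combB /W /comb scaler_sumr -sumrB -/(comb _ _) comb_sum.
    apply: eq_bigr => i _; rewrite -combZ; congr comb.
    by rewrite /Z mulrBr scalerBr -!scalerAr !scalerA [rho^-1 * _]mulrC.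
  apply: le_trans (no_sum NS _ _ _) _; first by move=> i; exact: (noSZ NS _ (Sc _)).
  apply: (@le_trans _ _ (\sum_(i < size b) `|b`_i| * (2 * (c1 * 4^-1 ^+ L)))).
    apply: ler_sum => i _; rewrite (noZ NS) //.
    case: (ltnP i L) => iL; first by rewrite bz // normr0 !mul0r.
    apply: ler_wpM2l => //; apply: le_trans (shift_le _) _.
      apply: leq_trans (size_polyD _ _) _; rewrite size_polyN geq_max.
      rewrite !(leq_trans (size_scale_leq _ _)) ?k_size //.
      exact: leq_trans (size_bseries_le B iL) (k_size i).
    by apply: ler_wpM2l => //; exact: coef_dist.
  rewrite -mulr_suml -/(l1 b).
  have : l1 b * (2 * (c1 * 4^-1 ^+ L)) <= L%:R * (2 * (c1 * 4^-1 ^+ L)).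
    by apply: ler_wpM2r => //; rewrite !mulr_ge0 // ltW.
  lra.
have nW : nzs W = nzs (tens (size (A L)) b (A L)).
  (* below [L] the blocks may overlap, but there the coefficients vanish *)
  have [b' bE] := factor_Xn bz.
  have -> : W = comb (fun i => 'X^(k (L + i)%N) * A L) b'.
    by rewrite /W bE comb_XnM.
  have -> : nzs (tens (size (A L)) b (A L)) = nzs (tens (size (A L)) b' (A L)).
    by rewrite !nzs_tensE // bE nzs_XnM.
  apply: nzs_blocks_eq => // i _; last by rewrite mulnS addnC.
  by rewrite addnS; apply: k_gapL; exact: leq_addr.
have pW : p W = ptens p b (A L) by apply: (sn_inv ps).
have h2 : `|nv (comb x W) - p W| <= eps (k L) * p W.
  apply: models_dist.
    move=> t tk; have [b' bE] := factor_Xn bz.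
    rewrite /W bE comb_XnM /comb coef_sum big1 // => i _; rewrite coefZ low ?mulr0 //.
    by apply: leq_trans tk _; apply: k_le; exact: leq_addr.
  rewrite nW nzs_tensE // size_allpairs; apply: leq_trans (k_mul L).
  by apply: leq_mul => //; exact: size_nzs_le.
have h3 : eps (k L) * p W <= 3 * (L.+1%:R * 4^-1 ^+ L).
  have : p W <= L%:R * 3.
    rewrite pW; apply: le_trans (ptens_l1 ps _ _) _; apply: ler_pM => //.
    - exact: l1_ge0.
    - exact: (sn_ge0 ps _).
    - exact: (bseries_norm_le ps pB L).
  move=> hW; have := ler_pM (eps_ge0 (k L)) (sn_ge0 ps W) (eps_geo L) hW.
  have : L%:R * 4^-1 ^+ L <= L.+1%:R * 4^-1 ^+ L :> R by rewrite ler_pM2r.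
  lra.
have h4 : `|ptens p b (A L) - Q b| <= 2 * (L.+1%:R * 4^-1 ^+ L).
  apply: le_trans (QA b L) _; rewrite -mulrA; apply: ler_wpM2l => //.
  by apply: ler_wpM2r; [exact: ltW | exact: le_trans lb LS].
have h5 : `|nv (rho^-1 *: comb x W) - P b| <= K * (5 * (L.+1%:R * 4^-1 ^+ L)).
  rewrite (noZ NS) // (gtr0_norm (_ : 0 < rho^-1)) ?invr_gt0 // /P -mulrBr normrM.
  apply: ler_pM => //; apply: le_trans (ler_distD (p W) _ _) _.
  rewrite {2}pW; move: (le_trans h2 h3) h4; lra.
have h6 := no_rdist NS (_ : S (comb z b)) (_ : S (rho^-1 *: comb x W)).
apply: le_trans (ler_distD (nv (rho^-1 *: comb x W)) _ _) _.
have h7 : `|nv (comb z b) - nv (rho^-1 *: comb x W)| <= 2 * c1 * (L%:R * 4^-1 ^+ L).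
  by apply: le_trans h1; apply: h6; [rewrite comb_z | exact: (noSZ NS _ (Sc _))].
have h8 : 2 * c1 * (L%:R * 4^-1 ^+ L) <= 2 * c1 * (L.+1%:R * 4^-1 ^+ L).
  by rewrite ler_wpM2l ?ler_wpM2r // ?mulr_ge0 //; exact: ltW.
lra.
Qed.

Lemma series_SPw : exists (F : completeNormedModType R) (xt : nat -> F) (rho : R),
  [/\ 0 < rho, is_SPw S nv xt & forall b, `|comb xt b| = rho^-1 * Q b].
Proof.
have k1 : 1 <= K := K1.
have th0 : (fun L => (2 * c1 + 5 * K) * 2^-1 ^+ L) @ \oo --> (0 : R).
  rewrite [X in _ --> X](_ : 0 = (2 * c1 + 5 * K) * 0); last by rewrite mulr0.
  by apply: cvgMr; exact: geo_cvg0.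
(* A coefficient of [q] is at most [K * p q], hence at most [K * K * Q q], which is [rho * K * K]
   times [P q]. *)
have c0 : 0 < (rho * K * K)^-1 by rewrite invr_gt0 !mulr_gt0 //; lra.
have [|||||F [xt [y [h1 h2 _ h3]]]] := @additive_spreading_model R V S nv NS Kb z P _ (rho * K * K)^-1
  z_normalized z_weakly_null z_grunblum _ _ _ c0 _ th0.
- move=> q q'; rewrite /P -mulrDr; apply: ler_wpM2l; first by rewrite invr_ge0 ltW.
  exact: (series_normD ps QA _ _).
- by move=> d q; rewrite /P (series_normZ ps QA) mulrCA.
- by move=> q q' h; rewrite /P (series_norm_inv ps QA h).
- have KK : 0 < rho * K * K by rewrite -invr_gt0.
  move=> q i; rewrite /P ler_pdivrMl //.
  have := sn_coef ps q i; have := series_norm_ge ps QA q.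
  have e : rho * K * K * (rho^-1 * Q q) = K * (K * Q q) by field; rewrite gt_eqF.
  rewrite e => a1 a2; apply: le_trans a2 _; apply: ler_wpM2l => //; exact: le_trans ler01 k1.
- move=> L q q1 q2 q3; apply: le_trans (P_approx q1 q2 q3) _; apply: ler_wpM2l.
    have c10 : 0 <= c1 by rewrite /c1 addr_ge0 // !mulr_ge0 //; lra.
    lra.
  exact: geo_half.
by exists F, xt, rho; split=> //; exists y.
Qed.

End Series.

End BlockModels.

(** * Countably many spreading models force submultiplicativity *)

Section Submultiplicative.
Variables (R : realType) (V : lmodType R) (S : set V) (nv : V -> R).
Hypothesis NS : normed_on S nv.
Implicit Types (q a b : {poly R}).
Variables (x : nat -> V) (Kb K : R) (p : {poly R} -> R) (eps : nat -> R).
Hypotheses (xn : normalized S nv x) (xw : weakly_null S nv x).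
Hypothesis xG : grunblum nv Kb x.
Hypothesis ps : spreading_norm K p.
Hypothesis eps_ge0 : forall n, 0 <= eps n.
Hypothesis eps_cvg : eps @ \oo --> (0 : R).
Hypothesis xp : models nv x p eps.

(** The 2-adic valuation enumerates the classes so that each recurs arbitrarily late; the odd
    cofactors [3 ^ n] show it. *)
Lemma logn2_infinitely_often k n : exists2 j, (n <= j)%N & logn 2 j.+1 = k.
Proof.
have pos : (0 < 2 ^ k * 3 ^ n)%N by rewrite muln_gt0 !expn_gt0.
exists (2 ^ k * 3 ^ n).-1; last first.
  rewrite prednK // lognM ?expn_gt0 // pfactorK // lognX.
  by rewrite (_ : logn 2 3 = 0%N) ?muln0 ?addn0.
have h : (n < 3 ^ n)%N by apply: ltn_expl.
have h2 : (3 ^ n <= 2 ^ k * 3 ^ n)%N by rewrite leq_pmull // expn_gt0.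
by rewrite -ltnS prednK //; exact: leq_trans h h2.
Qed.

(* If no class dominated all block models uniformly, blocks violating the
   domination by the [k]-th class could be added up, each [k] being visited
   infinitely often; the sum would belong to no class. *)
Theorem SPw_countable_submultiplicative : SPw_countable S nv ->
  exists2 C : R, 0 <= C & forall a b, ptens p b a <= C * p a * p b.
Proof.
move=> [E [u Hu]].
pose U k b := `|comb (u k) b|.
have U0 k b : 0 <= U k b by exact: normr_ge0.
have K1 := sn_K_ge1 ps.
(* A class is of use only if it lies below the norm of some block series: the domination found for
   it is then passed on to that series, whose tail can be cut. *)
pose good k := exists B Q C, [/\ forall i, p (B i) <= 4^-1 ^+ i, series_norm p B Q,
  0 <= C & forall b, U k b <= C * Q b].
have [k [C0 [[B0 [Q0 [C1 [pB0 QB0 C10 hC1]]]] C00 hC0]]] : exists k (C : R),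
    [/\ good k, 0 <= C & forall a b, p a <= 1 -> ptens p b a <= C * U k b].
  apply: contrapT => nex.
  (* The factor [K * 4 ^+ j] anticipates the scaling of the block by [4^-j] and the constant of
     [series_norm_block]. A violation by [j.+1] survives, which eventually exceeds [C * rho]. For a
     class that is not good the block is [0]. *)
  have sel j : exists a, p a <= 1 /\ (good (logn 2 j.+1) -> exists b,
      K * 4 ^+ j * j.+1%:R * U (logn 2 j.+1) b < ptens p b a).
    apply: contrapT => nj; apply: nex; exists (logn 2 j.+1), (K * 4 ^+ j * j.+1%:R).
    have g : good (logn 2 j.+1).
      apply: contrapT => ng; apply: nj; exists 0; split=> //.
      by rewrite (sn0 ps) ler01.
    split=> //; first by rewrite !mulr_ge0 // ?exprn_ge0 //; lra.
    move=> a b pa; rewrite leNgt; apply/negP => h; apply: nj; exists a; split=> // _.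
    by exists b.
  have [a aP] := choice sel.
  pose B j := 4^-1 ^+ j *: a j.
  have pB i : p (B i) <= 4^-1 ^+ i.
    rewrite /B (snZ ps) ger0_norm ?(ltW (geo_gt0 R i)) // -[X in _ <= X]mulr1.
    by apply: ler_wpM2l; [exact/ltW/geo_gt0 | exact: (aP i).1].
  have [Q QB] := series_norm_ex ps pB.
  have [F [xt [rho [rho0 sp xtQ]]]] := series_SPw NS xn xw xG ps eps_ge0 eps_cvg xp pB QB.
  have [k [C [C0 hC]]] := Hu F xt sp.
  have ck b : C^-1 * U k b <= rho^-1 * Q b <= C * U k b.
    have := hC (size b) (fun i => b`_i); rewrite -xtQ /U.
    by rewrite /comb.
  have gk : good k.
    exists B, Q, (C * rho^-1); split=> //; first by rewrite mulr_ge0 ?invr_ge0 // ltW.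
    by move=> b; have /andP[+ _] := ck b; rewrite ler_pdivrMl // mulrA.
  have [n hn] : exists n : nat, C * rho <= n%:R.
    exists (Num.truncn (C * rho)).+1; exact/ltW/truncnS_gt.
  have [j nj jk] := logn2_infinitely_often k n.
  have := (aP j).2; rewrite jk => /(_ gk)[b hb].
  have h1 := series_norm_block ps QB b j; rewrite /B (ptensZr ps) in h1.
  rewrite ger0_norm ?(ltW (geo_gt0 R j)) // in h1.
  have /andP[_ h2] := ck b; rewrite ler_pdivrMl // in h2.
  have h3 : C * rho <= j.+1%:R by apply: le_trans hn _; rewrite ler_nat; lia.
  have h4 : (C * rho) * U k b <= j.+1%:R * U k b by apply: ler_wpM2r.
  have g0 := geo_gt0 R j.
  have h5 : 4^-1 ^+ j * (K * 4 ^+ j * j.+1%:R * U k b) < 4^-1 ^+ j * ptens p b (a j).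
    by rewrite ltr_pM2l.
  have e4 : 4^-1 ^+ j * (K * 4 ^+ j * j.+1%:R * U k b) = K * (j.+1%:R * U k b).
    have e : 4^-1 ^+ j * 4 ^+ j = 1 :> R by rewrite -exprMn mulVf ?expr1n.
    rewrite -[RHS]mul1r -[X in _ = X * _]e.
    by move: (4^-1 ^+ j) (4 ^+ j) j.+1%:R => c d n'; ring.
  rewrite e4 in h5; have := lt_le_trans h5 h1; rewrite ltr_pM2l; last by lra.
  by move=> h6; move: h2 h4 h6; rewrite mulrA [rho * C]mulrC; lra.
pose C := C0 * C1.
have Cge : 0 <= C by rewrite mulr_ge0.
have Q0ge b : 0 <= Q0 b.
  have := le_trans (sn_ge0 ps b) (series_norm_ge ps QB0 b).
  by rewrite pmulr_rge0 //; lra.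
have hC a b : ptens p b a <= C * p a * Q0 b.
  have [a0|a0] := eqVneq (p a) 0.
    have -> : a = 0.
      apply/polyP => i; apply/eqP; rewrite coef0 -normr_le0.
      by apply: le_trans (sn_coef ps a i) _; rewrite a0 mulr0.
    rewrite -(scale0r (0 : {poly R})) (ptensZr ps) normr0 mul0r.
    by rewrite !mulr_ge0 // (sn_ge0 ps).
  have pa : 0 < p a by rewrite lt_neqAle eq_sym a0 (sn_ge0 ps).
  have e : a = p a *: ((p a)^-1 *: a) by rewrite scalerA divff // scale1r.
  rewrite {1}e (ptensZr ps) gtr0_norm //.
  have h : ptens p b ((p a)^-1 *: a) <= C0 * U k b.
    by apply: hC0; rewrite (snZ ps) normfV gtr0_norm // mulVf.
  have h' : C0 * U k b <= C0 * (C1 * Q0 b) by apply: ler_wpM2l.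
  have := ler_wpM2l (ltW pa) (le_trans h h'); rewrite /C; lra.
(* With this [i] the tail takes at most half of [Q0 b], so [Q0 b] is bounded by
   [2 * l1 (bseries B0 i)] times [p b]. *)
have [i hi] := geo_small (C * 2) (e := 2^-1) ltac:(by rewrite invr_gt0).
have {}hi := hi i (leqnn i).
exists (C * (2 * l1 (bseries B0 i))); first by rewrite !mulr_ge0 // l1_ge0.
move=> a b; apply: le_trans (hC a b) _.
have h := series_norm_split ps pB0 QB0 i (fun a => hC a b) Cge.
have h1 : C * (2 * 4^-1 ^+ i) * Q0 b <= 2^-1 * Q0 b.
  by apply: ler_wpM2r => //; rewrite mulrA.
have h2 : Q0 b <= 2 * l1 (bseries B0 i) * p b by lra.
have := ler_wpM2l (mulr_ge0 Cge (sn_ge0 ps a)) h2; lra.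
Qed.

End Submultiplicative.

(** * Brunel-Sucheston stabilization *)

Section Stabilization.
Variables (R : realType) (V : lmodType R) (S : set V) (nv : V -> R).
Hypothesis NS : normed_on S nv.
Variable x : nat -> V.
Hypothesis xn : normalized S nv x.
Implicit Types (q : {poly R}).

Let Sx n : S (x n). Proof. exact: (xn n).1. Qed.

Let mesh (s : nat) : R := 4^-1 ^+ s / s.+1%:R.

Let mesh_gt0 s : 0 < mesh s.
Proof. by rewrite divr_gt0 ?geo_gt0 ?ltr0n. Qed.

Let gl n s := sval (cid (grid n (mesh_gt0 s))).

Let g (d : seq R) (k : seq nat) : R := nv (\sum_(i < size d) d`_i *: x (nth 0%N k i)).

Let g_le d k : `|g d k| <= \sum_(i < size d) `|d`_i|.
Proof.
rewrite /g ger0_norm; last first.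
  by apply: (no_ge0 NS); apply: (noS_sum NS) => i; exact: (noSZ NS).
apply: le_trans (no_sum NS _ _ _) _; first by move=> i; exact: (noSZ NS).
by apply: ler_sum => i _; rewrite (noZ NS) // (xn _).2 mulr1.
Qed.

Let bits s : seq bitseq := [seq tval t | t <- enum {: s.-tuple bool}].

Let mem_bits b : b \in bits (size b).
Proof. by apply/mapP; exists (in_tuple b) => //; rewrite mem_enum. Qed.

(** The counterpart for norms of the selection behind Schreier unconditionality: fixing one more
    index of a support barely changes the iterated limit of the norm, for all lengths and meshes up
    to the current stage. *)
Let Q (p : seq nat) : set nat := [set m | (forall i, i \in p -> (i < m)%N) /\
  forall n, n \in iota 0 (size p).+1 -> forall s, s \in iota 0 (size p).+1 ->
  forall d, d \in gl n s -> forall b, b \in bits (size p) -> let k := mask b p in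
  (size k < n)%N ->
  `|Ul (n - (size k).+1) (g d) (rcons k m) - Ul (n - size k) (g d) k| <= 4^-1 ^+ size p].

Let UQ p : Uf (Q p).
Proof.
apply: filterI.
  by apply: Uf_seq => i _; exact: Uf_ge.
apply: Uf_seq => n _; apply: Uf_seq => s _; apply: Uf_seq => d _; apply: Uf_seq => b _ /=.
case: (ltnP (size (mask b p)) n) => h; last by apply: filterS filterT.
have e : (n - size (mask b p))%N = (n - (size (mask b p)).+1).+1 by lia.
rewrite e; apply: filterS (Ul_near _ _ (g_le d) (geo_gt0 R (size p))).
by move=> t ht _; exact: ht.
Qed.

Section Fixed.
Variable m : nat -> nat.
Hypothesis mQ : forall s, Q (mkseq m s) (m s).

Let y i := x (m i).
Let Sy i : S (y i). Proof. exact: Sx. Qed.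
Let Sc q : S (comb y q). Proof. exact: (noS_comb NS). Qed.

Let level L q := [/\ forall i, (i < L)%N -> q`_i = 0, (size (nzs q) <= L)%N &
  forall i, `|q`_i| <= 1].

Let geo_sum L N : \sum_(0 <= s < N) (if (L <= s)%N then 4^-1 ^+ s else 0 : R) <=
  if (L <= N)%N then 2 * 4^-1 ^+ L - 2 * 4^-1 ^+ N else 0.
Proof.
elim: N => [|N ih].
  by rewrite big_geq //; case: ifP => //; rewrite leqn0 => /eqP ->; rewrite subrr.
rewrite big_nat_recr //=; move: ih; case: (leqP L N) => h.
  rewrite (leqW h) exprS; have := geo_gt0 R N; move: (4^-1 ^+ L) (4^-1 ^+ N) (\sum_(_ <= _ < _) _).
  by move=> a b c; lra.
case: (leqP L N.+1) => h'; last by rewrite addr0.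
have -> : L = N.+1 by lia.
by rewrite addr0 subrr.
Qed.

(** The common value is the iterated limit of the norm of the rounded vector. Rounding costs [4^-L];
    replacing the limits by the actual indices, all chosen from stage [L] on, costs at most
    [2 * 4^-L]. *)
Let stable_aux L (a : seq R) : exists H : R, forall q, level L q -> nzs q = a ->
  `|nv (comb y q) - H| <= 3 * 4^-1 ^+ L.
Proof.
have [sa|sa] := leqP (size a) L; last first.
  by exists 0 => q [_ h _] e; move: sa; rewrite -e ltnNge h.
have [a1|na] := pselect (forall c, c \in a -> `|c| <= 1); last first.
  exists 0 => q [_ _ h] e; exfalso; apply: na => c; rewrite -e mem_filter => /andP[_ /(nthP 0)[i _ <-]].
  exact: h.
have Hgl := svalP (cid (grid (size a) (mesh_gt0 L))).
have [d dl_ [sd hd]] := Hgl a erefl a1.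
exists (Ul (size a) (g d) [::]) => q [qz qs _] qa.
pose N := size q; pose F i := q`_i != 0.
pose I := [seq i <- iota 0 N | F i].
have aI : a = [seq q`_i | i <- I].
  by rewrite -qa (nzs_mkseq (leqnn N)) /mkseq filter_map.
have sI : size I = size a by rewrite aI size_map.
have aN t : (t < size I)%N -> a`_t = q`_(nth 0%N I t).
  by move=> h; rewrite aI (nth_map 0%N).
have qE : comb y q = \sum_(j < size d) a`_j *: x (nth 0%N (picks m F N) j).
  rewrite /comb -(big_mkord xpredT (fun i => q`_i *: y i)) /index_iota subn0 -/N.
  transitivity (\sum_(i <- iota 0 N | F i) q`_i *: y i).
    rewrite [RHS]big_mkcond; apply: eq_bigr => i _.
    by rewrite /F; case: eqP => //= ->; rewrite scale0r.
  rewrite -big_filter -/I (big_nth 0%N) sI sd big_mkord; apply: eq_bigr => j _.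
  have hj : (j < size I)%N by rewrite sI; exact: ltn_ord.
  by rewrite /picks -/I aN // (nth_map 0%N).
have h1 : `|nv (comb y q) - g d (picks m F N)| <= 4^-1 ^+ L.
  have Sg : S (\sum_(i < size d) d`_i *: x (nth 0%N (picks m F N) i)).
    by apply: (noS_sum NS) => i; exact: (noSZ NS).
  apply: le_trans (no_rdist NS (Sc q) Sg) _.
  rewrite qE -sumrB; apply: le_trans (no_sum NS _ _ _) _.
    by move=> i; apply: (noSB NS); exact: (noSZ NS).
  apply: (@le_trans _ _ (\sum_(i < size d) mesh L)).
    by apply: ler_sum => i _; rewrite -scalerBl (noZ NS) // (xn _).2 mulr1.
  rewrite sumr_const card_ord sd -[_ *+ size a]mulr_natl /mesh mulrCA.
  rewrite -[X in _ <= X]mulr1; apply: ler_wpM2l; first exact: ltW (geo_gt0 R L).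
  by rewrite ler_pdivrMr ?ltr0n // mul1r ler_nat (leq_trans sa).
have size_picks s : size (picks m F s) = count F (iota 0 s) by rewrite size_map size_filter.
have cN : count F (iota 0 N) = size a by rewrite -sI size_filter.
have h2 : `|g d (picks m F N) - Ul (size a) (g d) [::]| <= 2 * 4^-1 ^+ L.
  have dd0 s : 0 <= (if (L <= s)%N then 4^-1 ^+ s else 0 : R).
    by case: ifP => // _; exact: ltW (geo_gt0 R s).
  have := @Ul_telescope R m F _ (g d) (size a) 0 N (leq0n N) _ dd0.
  rewrite size_picks cN subnn /= subn0 => T.
  apply: le_trans (T _) _.
    move=> s sN Fs.
    have Ls : (L <= s)%N by rewrite leqNgt; apply: contra Fs => h; rewrite /F qz // eqxx.
    rewrite Ls.
    have hsz : (size (picks m F s) < size a)%N.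
      rewrite -cN size_picks -(subnKC sN) iotaD count_cat -[s.+1]addn1 iotaD count_cat /=.
      by rewrite add0n Fs; lia.
    have [b sb e] := picks_mask m F s; rewrite e in hsz *.
    have := (mQ s).2 (size a) _ L _ d dl_ b _ hsz; rewrite size_mkseq; apply.
    - by rewrite mem_iota /= add0n ltnS (leq_trans sa).
    - by rewrite mem_iota /= add0n ltnS.
    - by rewrite -sb mem_bits.
  have g1 := geo_gt0 R L; have g2 := geo_gt0 R N.
  by apply: le_trans (geo_sum L N) _; case: ifP => _; lra.
apply: le_trans (ler_distD (g d (picks m F N)) _ _) _; lra.
Qed.

Let stable L q q' : level L q -> level L q' -> nzs q = nzs q' ->
  `|nv (comb y q) - nv (comb y q')| <= 6 * 4^-1 ^+ L.
Proof.
move=> h h' e; have [H hH] := stable_aux L (nzs q').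
apply: le_trans (ler_distD H _ _) _; have := hH q h e; have := hH q' h' erefl.
by rewrite [`|H - _|]distrC; lra.
Qed.

Let u q L := nv (comb y ('X^L * q)).

Let uZ (c : R) q L : u (c *: q) L = `|c| * u q L.
Proof. by rewrite /u -scalerAr combZ (noZ NS). Qed.

Let uD q q' L : u (q + q') L <= u q L + u q' L.
Proof. by rewrite /u mulrDr combD; exact: (noD NS). Qed.

Let shift_level q L L' : (size q <= L)%N -> (L <= L')%N -> (forall i, `|q`_i| <= 1) ->
  level L ('X^L' * q).
Proof.
move=> qL LL q1; split=> [i iL||i].
- by rewrite coefXnM (leq_trans iL).
- by rewrite nzs_XnM (leq_trans (size_nzs_le q)).
- by rewrite coefXnM; case: ifP => // _; rewrite normr0.
Qed.

Let bnd q := 1 + \sum_(j < size q) `|q`_j|.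

Let bnd_gt0 q : 0 < bnd q.
Proof. by have : 0 <= \sum_(j < size q) `|q`_j| by [apply: sumr_ge0]; rewrite /bnd; lra. Qed.

Let u_dist q L L' : (size q <= L)%N -> (L <= L')%N ->
  `|u q L - u q L'| <= 6 * bnd q * 4^-1 ^+ L.
Proof.
move=> qL LL; have b0 := bnd_gt0 q; pose r := (bnd q)^-1 *: q.
have r1 i : `|r`_i| <= 1.
  rewrite coefZ normrM normfV (gtr0_norm b0) mulrC ler_pdivrMr // mul1r.
  exact: sumabs_bound.
have rL : (size r <= L)%N by apply: leq_trans (size_scale_leq _ _) qL.
have qr : q = bnd q *: r by rewrite scalerA divff ?gt_eqF // scale1r.
have := stable (shift_level rL (leqnn L) r1) (shift_level rL LL r1).
rewrite !nzs_XnM => /(_ erefl) h.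
rewrite [X in X <= _](_ : _ = bnd q * `|u r L - u r L'|); last first.
  by rewrite {1 2}qr !uZ (gtr0_norm b0) -mulrBr normrM (gtr0_norm b0).
have := ler_wpM2l (ltW b0) h; rewrite /u; lra.
Qed.

(** Far translates of [q] have almost constant norm, and their limit is the norm in the spreading
    model. *)
Let P_ex q : exists P : R, forall n, `|u q (size q + n) - P| <= 6 * bnd q * 4^-1 ^+ n.
Proof.
have b0 := bnd_gt0 q.
have D n n' : (n <= n')%N -> `|u q (size q + n) - u q (size q + n')| <= 6 * bnd q * 4^-1 ^+ n.
  move=> nn; apply: le_trans (u_dist _ _) _; rewrite ?leq_addr ?leq_add2l //.
  by apply: ler_wpM2l; [rewrite mulr_ge0 // ltW | apply: geo_le; exact: leq_addl].
have g0 n : 0 <= 6 * bnd q * 4^-1 ^+ n by rewrite !mulr_ge0 // ltW // geo_gt0.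
have [|l hl] := @between R (fun n => u q (size q + n) - 6 * bnd q * 4^-1 ^+ n)
   (fun n => u q (size q + n) + 6 * bnd q * 4^-1 ^+ n).
  move=> n n'; have := g0 n; have := g0 n'; case: (leqP n n') => h.
    by have := D _ _ h; rewrite ler_norml => /andP[]; lra.
  by have := D _ _ (ltnW h); rewrite ler_norml => /andP[]; lra.
exists l => n; have /andP[h1 h2] := hl n; rewrite ler_norml.
by apply/andP; split; lra.
Qed.

Let P q := sval (cid (P_ex q)).
Let PP q n : `|u q (size q + n) - P q| <= 6 * bnd q * 4^-1 ^+ n.
Proof. by rewrite /P; case: cid. Qed.

Let PL q N n : (size q + n <= N)%N -> `|u q N - P q| <= 12 * bnd q * 4^-1 ^+ n.
Proof.
move=> h; have h1 := PP q n.
have h2 := u_dist (leq_addr n (size q)) h.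
apply: le_trans (ler_distD (u q (size q + n)) _ _) _; rewrite [X in X + _]distrC.
have : 6 * bnd q * 4^-1 ^+ (size q + n) <= 6 * bnd q * 4^-1 ^+ n.
  by apply: ler_wpM2l; [rewrite mulr_ge0 // ltW | apply: geo_le; exact: leq_addl].
lra.
Qed.

Let up q N n : (size q + n <= N)%N -> u q N <= P q + 12 * bnd q * 4^-1 ^+ n.
Proof. by move=> /PL; rewrite ler_norml => /andP[_]; lra. Qed.

Let dn q N n : (size q + n <= N)%N -> P q <= u q N + 12 * bnd q * 4^-1 ^+ n.
Proof. by move=> /PL; rewrite ler_norml => /andP[]; lra. Qed.

Let PD q q' : P (q + q') <= P q + P q'.
Proof.
apply: (@le_of_geo _ _ _ (12 * bnd (q + q') + 12 * bnd q + 12 * bnd q')) => n.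
pose N := (size (q + q')%R + size q + size q' + n)%N.
have h1 : (size (q + q')%R + n <= N)%N by rewrite /N; lia.
have h2 : (size q + n <= N)%N by rewrite /N; lia.
have h3 : (size q' + n <= N)%N by rewrite /N; lia.
have := dn h1; have := up h2; have := up h3; have := uD q q' N; lra.
Qed.

Let PZ (c : R) q : P (c *: q) = `|c| * P q.
Proof.
have H n : let N := (size (c *: q)%R + size q + n)%N in
  `|P (c *: q) - `|c| * P q| <= (12 * bnd (c *: q) + `|c| * (12 * bnd q)) * 4^-1 ^+ n.
  move=> N; have h1 : (size (c *: q)%R + n <= N)%N by rewrite /N; lia.
  have h2 : (size q + n <= N)%N by rewrite /N; lia.
  have := PL h1; rewrite uZ distrC => a1; have a2 := PL h2.
  apply: le_trans (ler_distD (`|c| * u q N) _ _) _.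
  rewrite -mulrBr normrM normr_id.
  have := ler_wpM2l (normr_ge0 c) a2; lra.
apply/eqP; rewrite -subr_eq0 -normr_le0.
apply: (@le_of_geo _ _ _ (12 * bnd (c *: q) + `|c| * (12 * bnd q))) => n.
by rewrite add0r; exact: H.
Qed.

Let approx L q : level L q -> `|nv (comb y q) - P q| <= 6 * 4^-1 ^+ L.
Proof.
move=> lq; have [q0 qs q1] := lq.
apply: (@le_of_geo _ _ _ (12 * bnd q)) => n.
pose N := (L + (size q + n))%N.
have lN : level L ('X^N * q).
  split=> [i iL||i]; rewrite ?nzs_XnM // coefXnM.
  - by rewrite (leq_trans iL) // leq_addr.
  - by case: ifP => // _; rewrite normr0.
have := stable lq lN; rewrite nzs_XnM => /(_ erefl) h1.
have h2 : `|u q N - P q| <= 12 * bnd q * 4^-1 ^+ n by apply: PL; exact: leq_addl.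
apply: le_trans (ler_distD (u q N) _ _) _; rewrite /u in h2 *; lra.
Qed.

Let Pinv q q' : nzs q = nzs q' -> P q = P q'.
Proof.
wlog : q q' / P q <= P q'.
  by move=> H e; case: (leP (P q) (P q')) => [/H|/ltW/H h]; [apply|apply/esym/h].
move=> le e; apply/eqP; rewrite eq_le le /=.
pose c := bnd q + bnd q'; have c0 : 0 < c by rewrite addr_gt0 // bnd_gt0.
apply: (@le_of_geo_above _ _ _ (c * 12 + 12 * bnd q + 12 * bnd q') (size q + size q')) => n hn.
pose N := (size q + size q' + n)%N.
pose r := c^-1 *: q; pose r' := c^-1 *: q'.
have lr s : (s = q \/ s = q') -> level n ('X^N * (c^-1 *: s)).
  move=> hs; have sz : (size (c^-1 *: s)%R <= n)%N.
    apply: leq_trans (size_scale_leq _ _) _; apply: leq_trans hn.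
    by case: hs => ->; rewrite ?leq_addr ?leq_addl.
  apply: shift_level => //; first exact: leq_addl.
  move=> i; rewrite coefZ normrM normfV (gtr0_norm c0) mulrC ler_pdivrMr // mul1r.
  have := bnd_gt0 q; have := bnd_gt0 q'.
  by case: hs => ->; [have := sumabs_bound q i | have := sumabs_bound q' i];
    rewrite -/(bnd _) /c; lra.
have := stable (lr q (or_introl erefl)) (lr q' (or_intror erefl)).
rewrite !nzs_XnM => /(_ (nzsZ_eq _ e)).
rewrite -!/(u _ N) !uZ normfV (gtr0_norm c0) -mulrBr normrM normfV (gtr0_norm c0).
rewrite ler_pdivrMl // ler_norml => /andP[a1 a2].
have b1 : u q N <= P q + 12 * bnd q * 4^-1 ^+ n by apply: up; rewrite /N; lia.
have b2 : P q' <= u q' N + 12 * bnd q' * 4^-1 ^+ n by apply: dn; rewrite /N; lia.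
have := mulr_gt0 c0 (geo_gt0 R n); lra.
Qed.

Let increasing i : (m i < m i.+1)%N.
Proof. by apply: (mQ i.+1).1; apply/mapP; exists i => //; rewrite mem_iota add0n leqnn. Qed.

Lemma staged_choice_stable : (forall i, (m i < m i.+1)%N) /\ exists P : {poly R} -> R,
  [/\ forall q r, P (q + r) <= P q + P r, forall (c : R) q, P (c *: q) = `|c| * P q,
   forall q r, nzs q = nzs r -> P q = P r &
   forall L q, (forall i, (i < L)%N -> q`_i = 0) -> (size (nzs q) <= L)%N ->
    (forall i, `|q`_i| <= 1) -> `|nv (comb (x \o m) q) - P q| <= 6 * 4^-1 ^+ L].
Proof. by split=> //; exists P; split=> // L q h1 h2 h3; apply: approx. Qed.

End Fixed.

Theorem stable_subsequence : exists m : nat -> nat,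
  (forall i, (m i < m i.+1)%N) /\ exists P : {poly R} -> R,
  [/\ forall q r, P (q + r) <= P q + P r, forall (c : R) q, P (c *: q) = `|c| * P q,
   forall q r, nzs q = nzs r -> P q = P r &
   forall L q, (forall i, (i < L)%N -> q`_i = 0) -> (size (nzs q) <= L)%N ->
    (forall i, `|q`_i| <= 1) -> `|nv (comb (x \o m) q) - P q| <= 6 * 4^-1 ^+ L].
Proof. by have [m mQ] := inductive_choice UQ; exists m; exact: staged_choice_stable. Qed.

End Stabilization.

(** * Coefficient functionals in the dual of a closed span *)

Section Pairing.
Variable R : realType.
Implicit Types (al be q r : {poly R}).

Lemma sum_coef_widen (f : nat -> R) q n : (size q <= n)%N ->
  \sum_(i < size q) q`_i * f i = \sum_(i < n) q`_i * f i.
Proof. exact: (@comb_widen R R^o f q n). Qed.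

Definition pair al q : R := \sum_(i < size al) al`_i * q`_i.

Lemma pair_widen al q n : (size al <= n)%N -> pair al q = \sum_(i < n) al`_i * q`_i.
Proof. exact: sum_coef_widen. Qed.

Lemma pairZr al (c : R) q : pair al (c *: q) = c * pair al q.
Proof. by rewrite /pair mulr_sumr; apply: eq_bigr => i _; rewrite coefZ; ring. Qed.

Lemma pair0r al : pair al 0 = 0.
Proof. by rewrite /pair big1 // => i _; rewrite coef0 mulr0. Qed.

Lemma pair_cmul c al q : pair (cmul c al) q = pair al (cmul c q).
Proof.
rewrite (pair_widen _ (size_cmul c al)) /pair; apply: eq_bigr => i _.
by rewrite !coef_cmul mulrCA mulrA.
Qed.

Lemma pair_restr P al q : pair (restr P al) q = pair al (restr P q).
Proof. exact: pair_cmul. Qed.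

Lemma pair_spread k al q : pair (spread k al) q = \sum_(i < size al) al`_i * q`_(k i).
Proof. exact: (@comb_spread R R^o (fun i => q`_i) k al). Qed.

Lemma coef_spread k q i : (forall i, (k i < k i.+1)%N) -> (spread k q)`_(k i) = q`_i.
Proof.
move=> kI; rewrite /spread (@comb_widen _ _ _ _ (maxn (size q) i.+1)) ?leq_maxl //.
have hi : (i < maxn (size q) i.+1)%N by rewrite leq_max leqnn orbT.
rewrite coef_sum (bigD1 (Ordinal hi)) //= coefZ coefXn eqxx mulr1 big1 ?addr0 //.
move=> j /eqP nj; rewrite coefZ coefXn; case: eqP => [e|_]; last by rewrite mulr0.
exfalso; apply: nj; apply: val_inj => /=.
case: (ltngtP j i) => // /(incr_lt kI); rewrite e ltnn //.
Qed.

Lemma size_nzs q n : (size q <= n)%N -> size (nzs q) = count (fun i => q`_i != 0) (iota 0 n).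
Proof. by move=> h; rewrite (nzs_mkseq h) size_filter /mkseq count_map. Qed.

Lemma size_nzs_cmul c q : (size (nzs (cmul c q)) <= size (nzs q))%N.
Proof.
rewrite (size_nzs (size_cmul c q)) (size_nzs (leqnn _)); apply: sub_count => i /=.
by rewrite coef_cmul mulf_eq0 negb_or => /andP[].
Qed.

Lemma spread_coef_le k q (M : R) : (forall i, (k i < k i.+1)%N) -> 0 <= M ->
  (forall i, `|q`_i| <= M) -> forall i, `|(spread k q)`_i| <= M.
Proof.
move=> kI M0 h i; have [->|nz] := eqVneq (spread k q)`_i 0; first by rewrite normr0.
have : (spread k q)`_i \in nzs (spread k q).
  rewrite mem_filter nz mem_nth // ltnNge; apply: contra nz => ge.
  by rewrite nth_default.
by rewrite nzs_spread // mem_filter => /andP[_ /(nthP 0)[j _ <-]].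
Qed.

Lemma nzs_indicator N (J : pred nat) :
  nzs (\poly_(i < N) (J i)%:R : {poly R}) = nseq (count J (iota 0 N)) 1.
Proof.
rewrite (nzs_mkseq (size_poly N _)).
have -> : mkseq (fun i => (\poly_(i < N) (J i)%:R : {poly R})`_i) N = [seq (J i)%:R | i <- iota 0 N].
  apply/eq_in_map => i; rewrite mem_iota add0n => /andP[_ hi].
  by rewrite coef_poly hi.
elim: (iota 0 N) => //= i l ih; case: (J i) => /=; rewrite ?oner_eq0 ?eqxx /= ih //.
Qed.

Lemma sum_indicator N (J : pred nat) :
  \sum_(i < N) (J i)%:R = (count J (iota 0 N))%:R :> R.
Proof.
rewrite -(big_mkord xpredT (fun i => (J i)%:R)) /index_iota subn0.
elim: (iota 0 N) => [|i l ih]; first by rewrite big_nil.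
by rewrite big_cons ih /= natrD.
Qed.

End Pairing.

(** * Fundamental function and the working subsequence *)

Section Fundamental.
Variables (R : realType) (K : R) (p : {poly R} -> R).
Hypothesis ps : spreading_norm K p.

(** The fundamental function of the model. *)
Definition fund (n : nat) : R := p (\poly_(i < n) 1).

Lemma fund_indicator N (J : pred nat) :
  p (\poly_(i < N) (J i)%:R) = fund (count J (iota 0 N)).
Proof.
apply: (sn_inv ps); rewrite nzs_indicator.
have -> : \poly_(i < count J (iota 0 N)) 1 =
    \poly_(i < count J (iota 0 N)) (predT i)%:R :> {poly R} by [].
by rewrite nzs_indicator count_predT size_iota.
Qed.

Lemma fund_mono m n : (m <= n)%N -> fund m <= K * fund n.
Proof.
move=> mn; rewrite /fund.
have -> : \poly_(i < m) 1 = restr (fun i => i < m)%N (\poly_(i < n) 1) :> {poly R}.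
  apply/polyP => i; rewrite coef_restr !coef_poly; case: ltnP => // h.
  by rewrite (leq_trans h).
exact: (sn_restr ps).
Qed.

End Fundamental.

(** Collects what the dual argument uses of the selected subsequence: basis constant 2, Schreier
    unconditionality with constant 2, and a norm [p] that models it. *)
Record good_sequence (R : realType) (X : normedModType R) (y : nat -> X)
    (p : {poly R} -> R) (eps : nat -> R) : Prop := GoodSequence {
  gs1 : forall n, `|y n| = 1;
  gsG : forall q n, `|comb y (restr (fun i => i < n)%N q)| <= 2 * `|comb y q|;
  gsS : forall (q : {poly R}) n F, (forall i, (i < n)%N -> q`_i = 0) ->
    count F (iota 0 (size q)) = n -> `|comb y (restr F q)| <= 2 * `|comb y q|;
  gsD : forall q r, p (q + r) <= p q + p r;
  gsZ : forall (c : R) q, p (c *: q) = `|c| * p q;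
  gsp1 : p 1 = 1;
  gs_inv : forall q r, nzs q = nzs r -> p q = p r;
  gs_eps0 : forall n, 0 <= eps n;
  gs_eps : eps @ \oo --> (0 : R);
  gs_models : models (fun v : X => `|v|) y p eps }.

Section GoodSequence.
Variables (R : realType) (X : normedModType R) (y : nat -> X).
Variables (p : {poly R} -> R) (eps : nat -> R).
Hypothesis gs : good_sequence y p eps.
Implicit Types (al be q r : {poly R}).

Lemma normed_setT : normed_on (@setT X) (fun v : X => `|v|).
Proof.
by split=> // [u v _ _|c u _]; [exact: ler_normD | exact: normrZ].
Qed.

Lemma gs_schreier q L F : (forall i, (i < L)%N -> q`_i = 0) ->
  (size (nzs (restr F q)) <= L)%N -> `|comb y (restr F q)| <= 2 * `|comb y q|.
Proof.
move=> qz sz; pose F' i := F i && (q`_i != 0).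
have -> : restr F q = restr F' q.
  apply/polyP => i; rewrite !coef_restr /F'; case: (F i) => //=.
  by case: eqP => [->|].
apply: (gsS gs) (erefl _) => i hi; apply: qz; apply: leq_trans hi _.
apply: leq_trans sz; rewrite (size_nzs (size_cmul _ q)); apply: sub_count => j.
by rewrite /F' coef_restr => /andP[-> ->].
Qed.

Lemma gs_level : exists L0, forall L q, (L0 <= L)%N -> (forall i, (i < L)%N -> q`_i = 0) ->
  (size (nzs q) <= L)%N -> p q <= 2 * `|comb y q| /\ `|comb y q| <= 2 * p q.
Proof.
have /cvgr0Pnorm_le/(_ _ ltr01)[L0 _ hL] := gs_eps gs.
exists L0 => L q LL qz qs.
have e1 : eps L <= 1 := le_trans (ler_norm _) (hL L LL).
have e0 := gs_eps0 gs L.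
have /andP[h1 h2] := gs_models gs qz qs.
have p0 : 0 <= p q := seminorm_ge0 (gsD gs) (gsZ gs) q.
have n0 := normr_ge0 (comb y q).
rewrite ler_pdivrMl in h1; last by lra.
by split; [apply: le_trans h1 _ | apply: le_trans h2 _]; apply: ler_wpM2r => //; lra.
Qed.

(** [8 = 2 * 2 * 2]: move [q] far out and pass to [X], restrict there by Schreier unconditionality,
    and come back. *)
Lemma gs_spreading : spreading_norm 8 p.
Proof.
split; [exact: (gsD gs)|exact: (gsZ gs)|exact: (gsp1 gs)|exact: (gs_inv gs)|].
move=> P q; have [L0 hL] := gs_level; pose L := (L0 + size q)%N.
have sh r : p ('X^L * r) = p r by apply: (gs_inv gs); rewrite nzs_XnM.
have low r i : (i < L)%N -> ('X^L * r)`_i = 0 by move=> h; rewrite coefXnM h.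
pose F i := P (i - L)%N.
have e : restr F ('X^L * q) = 'X^L * restr P q.
  apply/polyP => i; rewrite coef_restr !coefXnM /F coef_restr.
  by case: ltnP => //; case: (P _).
have s1 r : (size (nzs r) <= size q)%N -> (size (nzs ('X^L * r)) <= L)%N.
  by move=> h; rewrite nzs_XnM (leq_trans h) // leq_addl.
have sq := s1 q (size_nzs_le q).
have sr := s1 (restr P q) (leq_trans (size_nzs_le _) (size_cmul _ _)).
have [h1 _] := hL L _ (leq_addr _ _) (low (restr P q)) sr.
have [_ h2] := hL L _ (leq_addr _ _) (low q) sq.
rewrite -e in sr; have h3 := gs_schreier (low q) sr.
rewrite !sh in h1 h2; rewrite e in h3; lra.
Qed.

Definition cspan : set X := [set z | in_closed_span (fun v : X => `|v|) y z].

Lemma cspanP z : cspan z <-> forall e, 0 < e -> exists q, `|z - comb y q| < e.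
Proof.
split=> h e e0; have := h e e0.
  by move=> [n [a ha]]; exists (opoly a); rewrite comb_opoly.
by move=> [q hq]; exists (size q), (fun i => q`_i).
Qed.

Lemma cspan_comb q : cspan (comb y q).
Proof. by apply/cspanP => e e0; exists q; rewrite subrr normr0. Qed.

Lemma cspan_linear (c : R) u v : cspan u -> cspan v -> cspan (c *: u + v).
Proof.
move=> /cspanP hu /cspanP hv; apply/cspanP => e e0.
have c0 : 0 < `|c| + 1 by have := normr_ge0 c; lra.
have e1 : 0 < e / 2 / (`|c| + 1) by rewrite !divr_gt0.
have e2 : 0 < e / 2 by rewrite divr_gt0.
have [q hq] := hu _ e1; have [r hr] := hv _ e2; exists (c *: q + r).
rewrite comb_linear.
have -> : c *: u + v - (c *: comb y q + comb y r) = c *: (u - comb y q) + (v - comb y r).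
  by rewrite scalerBr opprD addrACA.
apply: le_lt_trans (ler_normD _ _) _; rewrite normrZ.
rewrite ltr_pdivlMr // in hq.
have := normr_ge0 (u - comb y q); lra.
Qed.

Lemma cspan_closed : closed_subspace cspan.
Proof.
split; last first.
  by split; [rewrite -(comb0 y); exact: cspan_comb | move=> c u v; exact: cspan_linear].
move=> z cz; apply/cspanP => e e0; have e2 : 0 < e / 2 by rewrite divr_gt0.
have [u [/cspanP hu bu]] := cz (ball z (e / 2)) (nbhsx_ballx z _ e2).
have [q hq] := hu _ e2; exists q; rewrite -ball_normE /= in bu.
have -> : z - comb y q = (z - u) + (u - comb y q) by rewrite addrA subrK.
by apply: le_lt_trans (ler_normD _ _) _; lra.
Qed.

Lemma gs_normalized : normalized (@setT X) (fun v : X => `|v|) y.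
Proof. by move=> n; split=> //; exact: (gs1 gs). Qed.

Lemma gs_grunblum : grunblum (fun v : X => `|v|) 2 y.
Proof. exact: (gsG gs). Qed.

Lemma gs_coef q i : `|q`_i| <= 4 * `|comb y q|.
Proof.
by have := grunblum_coef normed_setT gs_normalized gs_grunblum q i; lra.
Qed.

Lemma cspan_infinite : infinite_dimensional cspan.
Proof.
move=> n; exists (fun i => y i); split=> [i|a].
  by rewrite -(combXn (R := R) y i); exact: cspan_comb.
rewrite -comb_opoly => h i; apply/eqP; rewrite -normr_le0 -(coef_opoly a).
by apply: le_trans (gs_coef _ _) _; rewrite h normr0 mulr0.
Qed.

Lemma coord_ex i : exists f : X -> R, forall z q,
  `|f z - q`_i| <= 4 * `|z - comb y q|.
Proof.
have H z : exists c : R, forall q, `|c - q`_i| <= 4 * `|z - comb y q|.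
  have [c hc] := coef_functional normed_setT gs_normalized gs_grunblum i (I : setT z).
  by exists c => q; have := hc q; lra.
by have [f hf] := choice H; exists f.
Qed.

(** Zero off the closed span, as [dual_space] requires. On the span it is a Lipschitz extension from
    finite combinations, and density makes it linear. *)
Definition coord i (z : X) : R :=
  if `[< cspan z >] then sval (cid (coord_ex i)) z else 0.

Lemma coord_dist i z q : cspan z -> `|coord i z - q`_i| <= 4 * `|z - comb y q|.
Proof. by move=> cz; rewrite /coord asboolT //; case: cid => f /= hf. Qed.

Lemma coord_comb i q : coord i (comb y q) = q`_i.
Proof.
apply/eqP; rewrite -subr_eq0 -normr_le0.
by apply: le_trans (coord_dist i q (cspan_comb q)) _; rewrite subrr normr0 mulr0.
Qed.

Local Notation D := (dual_space cspan).
Local Notation DN := (dual_norm cspan).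

Lemma coord_linear i (c : R) u v : cspan u -> cspan v ->
  coord i (c *: u + v) = c * coord i u + coord i v.
Proof.
move=> cu cv; have cw := cspan_linear c cu cv.
apply/eqP; rewrite -subr_eq0 -normr_le0; apply/ler_addgt0Pl => e e0; rewrite addr0.
have c0 : 0 < 8 * (`|c| + 1) by have := normr_ge0 c; lra.
have e1 : 0 < e / (8 * (`|c| + 1)) by rewrite divr_gt0.
have /cspanP/(_ _ e1)[q hq] := cu; have /cspanP/(_ _ e1)[r hr] := cv.
have h1 := coord_dist i (c *: q + r) cw.
have h2 := coord_dist i q cu; have h3 := coord_dist i r cv.
have h4 : `|c *: u + v - comb y (c *: q + r)| <= `|c| * `|u - comb y q| + `|v - comb y r|.
  rewrite comb_linear.
  have -> : c *: u + v - (c *: comb y q + comb y r) = c *: (u - comb y q) + (v - comb y r).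
    by rewrite scalerBr opprD addrACA.
  by apply: le_trans (ler_normD _ _) _; rewrite normrZ.
rewrite coefD coefZ in h1.
have -> : coord i (c *: u + v) - (c * coord i u + coord i v) =
  (coord i (c *: u + v) - (c * q`_i + r`_i)) - (c * (coord i u - q`_i) + (coord i v - r`_i)) by ring.
apply: le_trans (ler_normB _ _) _.
have h5 := ler_normD (c * (coord i u - q`_i)) (coord i v - r`_i); rewrite normrM in h5.
have h6 := ler_wpM2l (normr_ge0 c) h2.
have h7 := ler_wpM2l (normr_ge0 c) (ltW hq).
have h8 : 8 * (`|c| + 1) * (e / (8 * (`|c| + 1))) = e by rewrite mulrC divfK // gt_eqF.
by move: h8 hr h7; move: (e / _) => d h8 hr h7; lra.
Qed.

Lemma coord_dual i : D (coord i).
Proof.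
split; first by move=> z nz; rewrite /coord asboolF.
split; first by move=> c u v; exact: coord_linear.
exists 4 => z cz; have := coord_dist i 0 cz.
by rewrite coef0 subr0 comb0 subr0.
Qed.

Section DualNorm.
Variables (Y : set X) (f : X -> R).
Hypotheses (YS : closed_subspace Y) (fD : dual_space Y f).

Lemma dual_norm_has_sup : has_sup [set `|f z| | z in [set z | Y z /\ `|z| <= 1]].
Proof.
have [_ [Y0 _]] := YS; have [_ [fl [C hC]]] := fD.
split; first by exists `|f 0|, 0 => //=; rewrite normr0.
exists `|C| => _ [z [Yz z1] <-]; apply: le_trans (hC z Yz) _.
apply: (@le_trans _ _ (`|C| * `|z|)); first by apply: ler_wpM2r => //; exact: ler_norm.
by rewrite ler_piMr.
Qed.

Lemma dual_norm_le (C : R) : (forall z, Y z -> `|z| <= 1 -> `|f z| <= C) -> dual_norm Y f <= C.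
Proof.
move=> h; apply: ge_sup; first exact: dual_norm_has_sup.1.
by move=> _ [z [Yz z1] <-]; exact: h.
Qed.

Lemma dual_norm_ub z : Y z -> `|z| <= 1 -> `|f z| <= dual_norm Y f.
Proof. by move=> Yz z1; apply: ub_le_sup; [exact: dual_norm_has_sup.2 | exists z]. Qed.

Lemma dual_norm_ge z : Y z -> `|f z| <= dual_norm Y f * `|z|.
Proof.
move=> Yz; have [_ [Y0 YL]] := YS; have [_ [fl _]] := fD.
have f0 : f 0 = 0 by have := fl 1 0 0 Y0 Y0; rewrite scale1r addr0 mul1r; lra.
have [->|nz] := eqVneq z 0; first by rewrite f0 !normr0 mulr0.
have z0 : 0 < `|z| by rewrite normr_gt0.
have Yz' : Y (`|z|^-1 *: z) by have := YL `|z|^-1 z 0 Yz Y0; rewrite addr0.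
have : `|f (`|z|^-1 *: z)| <= dual_norm Y f.
  by apply: dual_norm_ub => //; rewrite normfZV.
have -> : f (`|z|^-1 *: z) = `|z|^-1 * f z.
  by have := fl `|z|^-1 z 0 Yz Y0; rewrite !addr0 f0 addr0.
by rewrite normrM normfV normr_id ler_pdivrMl // mulrC.
Qed.

End DualNorm.

Lemma normed_dual (Y : set X) : closed_subspace Y -> normed_on (dual_space Y) (dual_norm Y).
Proof.
move=> YS; have [_ [Y0 YL]] := YS.
have DL (c : R) f g : dual_space Y f -> dual_space Y g -> dual_space Y (c *: f + g).
  move=> [f1 [f2 [C fC]]] [g1 [g2 [C' gC]]]; split.
    by move=> z nz; rewrite -[LHS]/(c * f z + g z) f1 // g1 // mulr0 addr0.
  split; first by move=> d u v Yu Yv; rewrite -[LHS]/(c * f _ + g _) f2 // g2 // -![(c *: f + g) _]/(c * f _ + g _); ring.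
  exists (`|c| * C + C') => z Yz; rewrite -[(c *: f + g) z]/(c * f z + g z).
  apply: le_trans (ler_normD _ _) _; rewrite normrM mulrDl -mulrA lerD ?ler_wpM2l //.
  - exact: fC.
  - exact: gC.
have D0 : dual_space Y 0.
  split=> //; split=> [c u v _ _|]; last by exists 0 => z _; rewrite normr0 mul0r.
  by rewrite -[LHS]/(0 : R) -[RHS]/(c * 0 + 0) mulr0 addr0.
have DZ (c : R) f : dual_space Y f -> dual_space Y (c *: f).
  by move=> h; rewrite -[c *: f]addr0; exact: DL.
have le (c : R) f : dual_space Y f -> dual_norm Y (c *: f) <= `|c| * dual_norm Y f.
  move=> h; apply: (dual_norm_le YS (DZ c f h)) => z Yz z1.
  rewrite -[(c *: f) z]/(c * f z) normrM; apply: ler_wpM2l => //.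
  exact: dual_norm_ub.
split=> // [f g hf hg|c f hf].
  have hfg : dual_space Y (f + g) by rewrite -[f]scale1r; exact: DL.
  apply: (dual_norm_le YS hfg) => z Yz z1; rewrite -[(f + g) z]/(f z + g z).
  by apply: le_trans (ler_normD _ _) _; apply: lerD; exact: dual_norm_ub.
apply/eqP; rewrite eq_le le //=.
have [->|c0] := eqVneq c 0.
  rewrite normr0 mul0r; apply: le_trans (normr_ge0 _) (dual_norm_ub YS (DZ _ f hf) Y0 _).
  by rewrite normr0.
have cp : 0 < `|c| by rewrite normr_gt0.
have := le c^-1 (c *: f) (DZ c f hf).
by rewrite scalerA mulVf // scale1r normfV ler_pdivlMl.
Qed.

Lemma dual_comb (z : nat -> X -> R) q x : comb z q x = \sum_(i < size q) q`_i * z i x.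
Proof. by rewrite /comb fct_sumE. Qed.

Lemma comb_coord_pair al q : comb coord al (comb y q) = pair al q.
Proof. by rewrite dual_comb /pair; apply: eq_bigr => i _; rewrite coord_comb. Qed.

Local Notation NSD := (normed_dual cspan_closed).

Lemma dual_comb_coord al : D (comb coord al).
Proof. by apply: (noS_comb NSD) => n; exact: coord_dual. Qed.

Lemma pair_le_dual al q : pair al q <= DN (comb coord al) * `|comb y q|.
Proof.
rewrite -comb_coord_pair; apply: le_trans (ler_norm _) _.
exact: (dual_norm_ge cspan_closed (dual_comb_coord al) (cspan_comb q)).
Qed.

Lemma dual_norm_dense al (C : R) : 0 <= C ->
  (forall q, pair al q <= C * `|comb y q|) -> DN (comb coord al) <= C.
Proof.
move=> C0 h; have fD := dual_comb_coord al; set f := comb coord al in fD *.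
have hN q : `|pair al q| <= C * `|comb y q|.
  rewrite ler_norml h andbT; have := h (- q).
  by rewrite combN normrN -scaleN1r pairZr mulN1r; lra.
have [_ [fl _]] := fD.
apply: (dual_norm_le cspan_closed fD) => z cz z1.
apply/ler_addgt0Pl => e e0.
pose M := DN f + C.
have DN0 : 0 <= DN f by exact: (no_ge0 NSD fD).
have M1 : 0 < M + 1 by rewrite /M; lra.
have e1 : 0 < e / (M + 1) by rewrite divr_gt0.
have /cspanP/(_ _ e1)[q hq] := cz.
have cq := cspan_comb q.
have cd : cspan (z - comb y q).
  by have := cspan_linear (-1) cq cz; rewrite scaleN1r addrC.
have -> : f z = f (comb y q) + f (z - comb y q).
  by have := fl 1 _ _ cq cd; rewrite scale1r mul1r addrC subrK.
apply: le_trans (ler_normD _ _) _.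
have h1 := hN q; rewrite -comb_coord_pair -/f in h1.
have h2 := dual_norm_ge cspan_closed fD cd.
have h3 : `|comb y q| <= 1 + `|z - comb y q|.
  have qE : comb y q = z - (z - comb y q) by rewrite opprB addrC subrK.
  by rewrite {1}qE; apply: le_trans (ler_normB _ _) _; rewrite lerD2r.
have h4 : C * `|comb y q| <= C * (1 + `|z - comb y q|) by apply: ler_wpM2l.
have h5 : M * `|z - comb y q| <= e.
  rewrite ltr_pdivlMr // in hq; have := normr_ge0 (z - comb y q) => n0.
  have M0 : 0 <= M by rewrite /M addr_ge0.
  by lra.
by rewrite /M in h5; lra.
Qed.

(** Only the part of [q] on the support of [al] is tested. [12 = 2 * 2 * 3]: 2 from the norm in [X]
    to [p], 2 for the Schreier restriction, and 3 for removing the coordinates before [L]. *)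
Lemma dual_norm_upper : exists L0, forall L al (C : R), (L0 <= L)%N ->
  (forall i, (i < L)%N -> al`_i = 0) -> (size (nzs al) <= L)%N -> 0 <= C ->
  (forall q, pair al q <= C * p q) -> DN (comb coord al) <= 12 * C.
Proof.
have [L0 hL] := gs_level; exists L0 => L al C LL az as_ C0 h.
apply: dual_norm_dense; first lra.
move=> q; pose F i := al`_i != 0.
pose q1 := q - restr (fun i => i < L)%N q.
have q1z i : (i < L)%N -> q1`_i = 0 by move=> hi; rewrite coefB coef_restr hi subrr.
have e : restr F q = restr F q1.
  apply/polyP => i; rewrite !coef_restr coefB coef_restr.
  case: (ltnP i L) => hi; last by rewrite subr0.
  by rewrite /F az // eqxx.
have pe : pair al q = pair al (restr F q).
  rewrite /pair; apply: eq_bigr => i _; rewrite coef_restr /F.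
  by case: eqP => //= ->; rewrite !mul0r.
have sz : (size (nzs (restr F q1)) <= L)%N.
  rewrite -e; apply: leq_trans as_.
  rewrite (size_nzs (leq_trans (size_cmul _ _) (leq_maxl (size q) (size al)))).
  rewrite (size_nzs (leq_maxr (size q) (size al))).
  by apply: sub_count => i; rewrite coef_restr /F; case: (al`_i != 0) => //; rewrite eqxx.
have rz i : (i < L)%N -> (restr F q1)`_i = 0.
  by move=> hi; rewrite coef_restr q1z //; case: ifP.
have [h1 _] := hL L _ LL rz sz; have h2 := gs_schreier q1z sz.
have h3 : `|comb y q1| <= 3 * `|comb y q|.
  rewrite combB; apply: le_trans (ler_normB _ _) _.
  by have := gsG gs q L; lra.
have h4 : p (restr F q1) <= 12 * `|comb y q| by lra.
rewrite pe e; apply: le_trans (h _) _.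
by have := ler_wpM2l C0 h4; lra.
Qed.

Definition cnorm i : R := DN (coord i).

Lemma cnorm_ge1 i : 1 <= cnorm i.
Proof.
have := dual_norm_ge cspan_closed (coord_dual i) (cspan_comb 'X^i).
by rewrite coord_comb combXn (gs1 gs) mulr1 coefXn eqxx normr1.
Qed.

Lemma cnorm_le4 i : cnorm i <= 4.
Proof.
apply: (dual_norm_le cspan_closed (coord_dual i)) => z cz z1.
by have := coord_dist i 0 cz; rewrite coef0 subr0 comb0 subr0; lra.
Qed.

Definition ncoord i : X -> R := (cnorm i)^-1 *: coord i.

Lemma comb_ncoord al : comb ncoord al = comb coord (cmul (fun i => (cnorm i)^-1) al).
Proof.
rewrite comb_cmul /comb; apply: eq_bigr => i _; by rewrite scalerA mulrC.
Qed.

Lemma ncoord_normalized : normalized D DN ncoord.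
Proof.
move=> i; have c0 : 0 < cnorm i by have := cnorm_ge1 i; lra.
split; first by apply: (noSZ NSD); exact: coord_dual.
rewrite (noZ NSD); last exact: coord_dual.
by rewrite gtr0_norm ?invr_gt0 // -/(cnorm i) mulVf // gt_eqF.
Qed.

(** Initial projections of the coordinate functionals are adjoint to those of [y], and normalization
    commutes with them. *)
Lemma ncoord_grunblum : grunblum DN 2 ncoord.
Proof.
move=> al n; rewrite !comb_ncoord.
set be := cmul _ al; have -> : cmul (fun i => (cnorm i)^-1) (restr (fun i => i < n)%N al) =
    restr (fun i => i < n)%N be.
  by apply/polyP => i; rewrite !coef_cmul mulrCA.
have n0 : 0 <= DN (comb coord be) by exact: (no_ge0 NSD (dual_comb_coord be)).
apply: dual_norm_dense; first lra.
move=> q; rewrite pair_restr; apply: le_trans (pair_le_dual be _) _.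
have := ler_wpM2l n0 (gsG gs q n); lra.
Qed.

End GoodSequence.

(** * Spreading models of the coefficient functionals *)

Section DualModel.
Variables (R : realType) (X : normedModType R) (y : nat -> X).
Variables (p : {poly R} -> R) (eps : nat -> R).
Hypothesis gs : good_sequence y p eps.
Implicit Types (al be q r a b : {poly R}).
Let ps : spreading_norm 8 p := gs_spreading gs.
Local Notation D := (dual_space (cspan y)).
Local Notation DN := (dual_norm (cspan y)).
Local Notation NSD := (normed_dual (cspan_closed y)).
Local Notation w := (coord gs).
Local Notation v := (ncoord gs).
Local Notation rho := (cnorm gs).

(** At most half of the pairing can come from coordinates below [t = c / 2 * p q]. The [n] remaining
    ones contribute at most [8 * p q] each, whence [c * L <= 16 * n]. Multiplying [q] by the
    inverses of these large coordinates yields a sum of [n] basis vectors, at cost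
    [2 * (1 / t) * 8]. *)
Lemma far_coordinates be q (c : R) L : 0 < c -> (size (nzs be) <= L)%N ->
  (forall i, `|be`_i| <= 1) -> c * L%:R * p q < pair be q ->
  exists2 n, c * L%:R <= 16 * n%:R & fund p n <= 32 / c.
Proof.
move=> c0 bs b1 h.
have pq : 0 < p q.
  rewrite lt_neqAle (sn_ge0 ps) andbT eq_sym; apply/eqP => p0.
  have q0 : q = 0.
    apply/polyP => i; apply/eqP; rewrite coef0 -normr_le0.
    by apply: le_trans (sn_coef ps q i) _; rewrite p0 mulr0.
  by move: h; rewrite p0 mulr0 q0 pair0r ltxx.
pose N := size be; pose t := c / 2 * p q.
have t0 : 0 < t by rewrite /t mulr_gt0 // divr_gt0.
pose J i := (be`_i != 0) && (t <= `|q`_i|).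
exists (count J (iota 0 N)); last first.
  rewrite -(fund_indicator ps).
  have -> : \poly_(i < N) (J i)%:R = cmul (fun i => if J i then (q`_i)^-1 else 0) q.
    apply/polyP => i; rewrite coef_cmul coef_poly; case Ji : (J i); last first.
      by rewrite mul0r; case: ifP.
    move: Ji => /andP[bi ti].
    have -> : (i < N)%N by rewrite ltnNge; apply: contra bi => hi; rewrite nth_default.
    by rewrite mulVf // -normr_gt0; exact: lt_le_trans ti.
  have hM i : `|(if J i then (q`_i)^-1 else 0)| <= t^-1.
    case Ji : (J i); last by rewrite normr0 invr_ge0 ltW.
    move: Ji => /andP[_ ti]; rewrite normfV lef_pV2 ?posrE //; exact: lt_le_trans ti.
  apply: le_trans (sn_cmul ps q hM) _; rewrite /t.
  have -> : 2 * (c / 2 * p q)^-1 * 8 * p q = 32 / c by field; rewrite !gt_eqF.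
  by [].
have : pair be q <= \sum_(i < N) ((J i)%:R * (8 * p q) + (be`_i != 0)%:R * t).
  rewrite /pair; apply: ler_sum => i _; apply: le_trans (ler_norm _) _; rewrite normrM /J.
  have := sn_coef ps q i; have := b1 i; have := normr_ge0 q`_i.
  case: eqP => [->|_] /=; first by rewrite normr0 !mul0r addr0.
  rewrite mul1r; case: (leP t `|q`_i|) => ht h1 h2 h3.
    rewrite mul1r; apply: (@le_trans _ _ (1 * `|q`_i|)); first by apply: ler_wpM2r.
    by lra.
  rewrite mul0r add0r; apply: (@le_trans _ _ (1 * `|q`_i|)); first by apply: ler_wpM2r.
  by lra.
rewrite big_split /= -!mulr_suml sum_indicator (@sum_indicator R N (fun i => be`_i != 0)).
rewrite -(size_nzs (leqnn N)).
have : (size (nzs be))%:R * t <= L%:R * t by apply: ler_wpM2r; [exact: ltW | rewrite ler_nat].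
move: (count J _)%:R (size _)%:R => n s; rewrite /t => h1 h2.
have h3 : (c * L%:R) * p q < (16 * n) * p q by lra.
by rewrite ltr_pM2r // in h3; exact: ltW.
Qed.

(** A functional staying above [e] along a subsequence forces sign-weighted sums of [L] of the
    [ncoord] to have dual norm of order [L]. Some [q] witnesses this, and [far_coordinates] then
    bounds [fund p n] with [n] proportional to [L]. *)
Lemma ncoord_weakly_null : (forall M : R, exists n, M < fund p n) -> weakly_null D DN v.
Proof.
move=> unb Phi bP; have [PL [C hC]] := bP.
have Sv n : D (v n) := (ncoord_normalized gs n).1.
apply/cvgr0Pnorm_le => e e0; apply: contrapT => nN.
have far N : exists n, (N <= n)%N /\ e < `|Phi (v n)|.
  apply: contrapT => h; apply: nN; exists N => // n /= Nn; rewrite leNgt; apply/negP => h'.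
  by apply: h; exists n.
have [f hf] := choice far.
pose m := fix m i := if i is j.+1 then f (m j).+1 else f 0%N.
have mI i : (m i < m i.+1)%N := (hf (m i).+1).1.
have me i : e < `|Phi (v (m i))| by case: i => [|i]; [exact: (hf 0%N).2 | exact: (hf (m i).+1).2].
have [L0 hL0] := dual_norm_upper gs.
pose C' := `|C| + 1; have C0 : 0 < C' by rewrite /C'; have := normr_ge0 C; lra.
(* Chosen so that [12 * c * L], the bound of [dual_norm_upper], is half of the lower bound
   [L * e / C']. Below, [n0] beats [32 / c] by the factor 8 lost in [fund_mono], and [L1] is large
   enough to force [n >= n0]. *)
pose c := e / (24 * C'); have c0 : 0 < c by rewrite divr_gt0 //; lra.
have [n0 hn0] := unb (8 * (32 / c)).
have [L1 hL1] : exists L1 : nat, 16 * n0%:R / c <= L1%:R.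
  by exists (Num.truncn (16 * n0%:R / c)).+1; exact/ltW/truncnS_gt.
pose L := (L0 + L1).+1.
pose k i := m (L + i)%N.
have kI i : (k i < k i.+1)%N by rewrite /k addnS.
pose s i := Num.sg (Phi (v (k i))).
pose a := \poly_(i < L) s i; pose al := spread k a.
pose be := cmul (fun i => (rho i)^-1) al.
have rho1 i := cnorm_ge1 gs i.
have s1 i : `|a`_i| <= 1.
  rewrite coef_poly; case: ifP => _; last by rewrite normr0.
  by rewrite normr_sg lern1; case: eqP.
have al1 : forall i, `|al`_i| <= 1 by apply: spread_coef_le.
have be1 i : `|be`_i| <= 1.
  rewrite coef_cmul normrM normfV (ger0_norm (le_trans ler01 (rho1 i))).
  have r1 := rho1 i; have a1 := al1 i.
  rewrite ler_pdivrMl; last exact: lt_le_trans ltr01 r1.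
  by rewrite mulr1; exact: le_trans a1 r1.
have bez i : (i < L)%N -> be`_i = 0.
  have kL : (L <= k 0)%N by rewrite /k addn0; exact: incr_ge.
  by move=> iL; rewrite coef_cmul (coef_spread_lt a kI kL iL) mulr0.
have bes : (size (nzs be) <= L)%N.
  apply: leq_trans (size_nzs_cmul _ _) _; rewrite nzs_spread //.
  by apply: leq_trans (size_nzs_le _) (size_poly _ _).
have big : L%:R * e <= C' * DN (comb w be).
  rewrite -comb_ncoord.
  have -> : comb v al = comb (v \o k) a by rewrite /al comb_spread.
  have E : Phi (comb (v \o k) a) = \sum_(i < L) `|Phi (v (k i))|.
    rewrite (functional_comb NSD _ bP); last by move=> n; exact: Sv.
    rewrite (sum_coef_widen (fun i => Phi (v (k i))) (size_poly L s)).
    by apply: eq_bigr => i _; rewrite coef_poly ltn_ord -normrEsg.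
  have h1 : L%:R * e <= Phi (comb (v \o k) a).
    rewrite E; apply: (@le_trans _ _ (\sum_(i < L) e)).
      by rewrite sumr_const card_ord mulr_natl.
    by apply: ler_sum => i _; exact: ltW (me _).
  apply: le_trans h1 _; apply: le_trans (ler_norm _) _.
  have SD : D (comb (v \o k) a) by apply: (noS_comb NSD) => n; exact: Sv.
  apply: le_trans (hC _ SD) _; apply: ler_wpM2r; first exact: (no_ge0 NSD SD).
  by rewrite /C'; have := ler_norm C; lra.
have Lp : 0 < L%:R :> R by rewrite ltr0n.
have [q hq] : exists q, c * L%:R * p q < pair be q.
  apply: contrapT => nq.
  have := hL0 L be (c * L%:R) _ bez bes _ _.
  have cL : 0 < c * L%:R by rewrite mulr_gt0.
  have /[swap] /[apply] : (L0 <= L)%N by rewrite /L; lia.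
  move=> /(_ (ltW cL)) H.
  have {}H : DN (comb w be) <= 12 * (c * L%:R).
    apply: H => q; rewrite leNgt; apply/negP => h; apply: nq; by exists q.
  have : C' * DN (comb w be) <= C' * (12 * (c * L%:R)) by apply: ler_wpM2l => //; exact: ltW.
  have -> : C' * (12 * (c * L%:R)) = L%:R * e / 2 by rewrite /c; field; rewrite gt_eqF.
  have := mulr_gt0 Lp e0; lra.
have [n h1 h2] := far_coordinates c0 bes be1 hq.
have n0n : (n0 <= n)%N.
  rewrite ler_pdivrMr // in hL1.
  have : 16 * n0%:R <= 16 * n%:R :> R.
    apply: le_trans hL1 _; apply: le_trans h1; rewrite mulrC; apply: ler_wpM2l; first exact: ltW.
    by rewrite ler_nat /L; lia.
  by rewrite ler_pM2l // ler_nat.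
have := fund_mono ps n0n; lra.
Qed.

Section Stable.
Variables (m : nat -> nat) (P : {poly R} -> R).
Hypothesis mI : forall i, (m i < m i.+1)%N.
Hypotheses (PD : forall q r, P (q + r) <= P q + P r)
  (PZ : forall (c : R) q, P (c *: q) = `|c| * P q)
  (Pinv : forall q r, nzs q = nzs r -> P q = P r).
Hypothesis Papp : forall L q, (forall i, (i < L)%N -> q`_i = 0) -> (size (nzs q) <= L)%N ->
    (forall i, `|q`_i| <= 1) -> `|DN (comb (v \o m) q) - P q| <= 6 * 4^-1 ^+ L.

Let P0 q : 0 <= P q := seminorm_ge0 PD PZ q.
Let Sv n : D (v n) := (ncoord_normalized gs n).1.

Lemma shift_limit al (e : R) : 0 < e -> exists N, forall L, (N <= L)%N ->
  `|DN (comb (v \o m) ('X^L * al)) - P al| <= e.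
Proof.
move=> e0; pose A := 1 + \sum_(j < size al) `|al`_j|.
have A0 : 0 < A.
  by have : 0 <= \sum_(j < size al) `|al`_j| by [apply: sumr_ge0]; rewrite /A; lra.
have [N hN] := geo_small (A * 6) e0; exists (maxn N (size al)) => L.
rewrite geq_max => /andP[NL sL].
pose r := A^-1 *: al.
have alr : al = A *: r by rewrite scalerA divff ?gt_eqF // scale1r.
have S1 : D (comb (v \o m) ('X^L * r)) by apply: (noS_comb NSD) => n; exact: Sv.
have e1 : DN (comb (v \o m) ('X^L * al)) = A * DN (comb (v \o m) ('X^L * r)).
  by rewrite [in LHS]alr -scalerAr (combZ _ A) (noZ NSD) // gtr0_norm.
have -> : P al = A * P r by rewrite [in LHS]alr PZ gtr0_norm.
rewrite e1 -mulrBr normrM (gtr0_norm A0); apply: le_trans (hN L NL).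
rewrite -mulrA; apply: ler_wpM2l; first exact: ltW.
have <- : P ('X^L * r) = P r by apply: Pinv; rewrite nzs_XnM.
apply: Papp => [i iL||i].
- by rewrite coefXnM iL.
- rewrite nzs_XnM; apply: leq_trans (size_nzs_le _) _.
  exact: leq_trans (size_scale_leq _ _) sL.
- rewrite coefXnM; case: ifP => _; first by rewrite normr0.
  rewrite coefZ normrM normfV (gtr0_norm A0) mulrC ler_pdivrMr // mul1r.
  exact: sumabs_bound.
Qed.

Let k L i := m (L + i)%N.
Let kI L i : (k L i < k L i.+1)%N. Proof. by rewrite /k addnS. Qed.
Let k0 L : (L <= k L 0)%N. Proof. by rewrite /k addn0; exact: incr_ge. Qed.
Let be L al := cmul (fun i => (rho i)^-1) (spread (k L) al).

Let comb_be L al : comb (v \o m) ('X^L * al) = comb w (be L al).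
Proof. by rewrite comb_XnM -comb_ncoord comb_spread. Qed.

Let rho_gt0 i : 0 < rho i. Proof. by have := cnorm_ge1 gs i; lra. Qed.

(** The test vector carries the norms [rho], at most 4, that [ncoord] divides by: this costs
    [2 * 4 * 8], and passing from [p] to the norm of [X] costs 2 more. *)
Lemma dual_model_ge al q : pair al q <= 128 * P al * p q.
Proof.
have [L0 hL] := gs_level gs.
apply/ler_addgt0Pl => e e0.
have d0 : 0 < 128 * p q + 1 by have := sn_ge0 ps q; lra.
have e1 : 0 < e / (128 * p q + 1) by rewrite divr_gt0.
have [N hN] := shift_limit al e1.
pose L := (L0 + N + size q)%N.
have NL : (N <= L)%N by rewrite /L; lia.
have LL : (L0 <= L)%N by rewrite /L; lia.
pose qh := spread (k L) (cmul (fun i => rho (k L i)) q).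
have -> : pair al q = pair (be L al) qh.
  rewrite pair_cmul pair_spread; apply: eq_bigr => i _; congr (_ * _).
  by rewrite coef_cmul coef_spread // coef_cmul mulKf // gt_eqF.
apply: le_trans (pair_le_dual gs (be L al) qh) _; rewrite -comb_be.
have [|_ h1] := hL L qh LL (fun i => @coef_spread_lt R (k L) _ L i (kI L) (k0 L)).
  rewrite nzs_spread //; apply: leq_trans (size_nzs_cmul _ _) _.
  by apply: leq_trans (size_nzs_le _) _; rewrite /L; lia.
have h2 : p qh <= 64 * p q.
  rewrite (sn_spread ps) //; apply: le_trans (sn_cmul ps (M := 4) _ _) _; last by lra.
  by move=> i; rewrite gtr0_norm //; exact: cnorm_le4.
have := hN L NL; rewrite ler_norml => /andP[_ h3].
set DL := DN _ in h3 *.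
have DL0 : 0 <= DL by apply: (no_ge0 NSD); apply: (noS_comb NSD) => n; exact: Sv.
have h4 : DL * `|comb y qh| <= DL * (128 * p q) by apply: ler_wpM2l => //; lra.
apply: le_trans h4 _.
have pq := sn_ge0 ps q.
have h5 : DL <= P al + e / (128 * p q + 1) by lra.
have h6 : DL * (128 * p q) <= (P al + e / (128 * p q + 1)) * (128 * p q).
  by apply: ler_wpM2r => //; lra.
have h7 : e / (128 * p q + 1) * (128 * p q + 1) = e by rewrite divfK // gt_eqF.
by move: h6 h7 e1; move: (e / _) => d; lra.
Qed.

(** [1536 = 12 * 128]: 12 from [dual_norm_upper], and [128 = 16 * 8] for the multiplier by the
    inverses of [rho] and the restriction to the range of [k L]. *)
Lemma dual_model_le al (C : R) : 0 <= C -> (forall q, pair al q <= C * p q) ->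
  P al <= 1536 * C.
Proof.
move=> C0 h; have [L0 hL0] := dual_norm_upper gs.
apply/ler_addgt0Pl => e e0; have [N hN] := shift_limit al e0.
pose L := (L0 + N + size al)%N.
have NL : (N <= L)%N by rewrite /L; lia.
have LL : (L0 <= L)%N by rewrite /L; lia.
have := hN L NL; rewrite ler_norml comb_be => /andP[h1 _].
have bez i : (i < L)%N -> (be L al)`_i = 0.
  by move=> iL; rewrite coef_cmul (@coef_spread_lt R (k L) _ L) ?mulr0.
have bes : (size (nzs (be L al)) <= L)%N.
  apply: leq_trans (size_nzs_cmul _ _) _; rewrite nzs_spread //.
  by apply: leq_trans (size_nzs_le _) _; rewrite /L; lia.
have C128 : 0 <= 128 * C by lra.
have h2 : DN (comb w (be L al)) <= 12 * (128 * C).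
  apply: (hL0 L _ _ LL bez bes C128) => q.
  pose q2 := \poly_(i < size al) q`_(k L i).
  have -> : pair (be L al) q = pair al (cmul (fun i => (rho (k L i))^-1) q2).
    rewrite pair_cmul pair_spread; apply: eq_bigr => i _; congr (_ * _).
    by rewrite !coef_cmul coef_poly ltn_ord.
  apply: le_trans (h _) _; rewrite -mulrA mulrCA; apply: ler_wpM2l => //.
  have hM i : `|(rho (k L i))^-1| <= 1.
    by rewrite gtr0_norm ?invr_gt0 // invf_le1 //; exact: cnorm_ge1.
  apply: le_trans (sn_cmul ps q2 hM) _.
  have : p q2 <= 8 * p q.
    rewrite -(sn_spread ps q2 (kI L)).
    (* Reading [q] along [k L] and spreading the result back is a coordinate projection. *)
    have -> : spread (k L) q2 = restr (fun i => i \in [seq k L j | j <- iota 0 (size al)]) q.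
      apply/polyP => i; rewrite coef_restr; case: ifPn => [/mapP[j]|ni].
        rewrite mem_iota add0n => /andP[_ hj] ->.
        by rewrite coef_spread // coef_poly hj.
      rewrite /spread comb_poly coef_sum big1 // => j _; rewrite coefZ coefXn.
      case: eqP => [e'|_]; last by rewrite mulr0.
      exfalso; move/negP: ni; apply; rewrite e'; apply/mapP; exists (j : nat) => //.
      by rewrite mem_iota add0n ltn_ord.
    exact: (sn_restr ps).
  lra.
lra.
Qed.

(** Unconditionality by duality: a restriction is self-adjoint for [pair] and costs 8 in [p], so
    [1024 = 128 * 8]; going back to [P] costs 1536. *)
Lemma dual_model_spreading : spreading_norm (1536 * 1024) P.
Proof.
split=> // [|F al].
  apply/eqP; rewrite -subr_eq0 -normr_le0; apply/ler_addgt0Pl => e e0; rewrite addr0.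
  have [N hN] := shift_limit 1 e0; have := hN N (leqnn N).
  by rewrite mulr1 combXn /= (ncoord_normalized gs (m N)).2 distrC.
have c0 : 0 <= 1024 * P al by have := P0 al; lra.
have := @dual_model_le (restr F al) _ c0; rewrite mulrA; apply=> q.
rewrite pair_restr; apply: le_trans (dual_model_ge _ _) _.
have := ler_wpM2l (P0 al) (sn_restr ps F q); lra.
Qed.

Lemma dual_norming a : exists2 al, P al <= 1536 * 8 & pair al a = p a.
Proof.
have [f [fl fle fa]] := Hahn_Banach_supporting a (seminorm_sublinear (snD ps) (snZ ps)).
exists (\poly_(i < size a) f 'X^i); last first.
  rewrite (pair_widen _ (size_poly _ _)) -fa -[in RHS](comb_id a) /comb.
  rewrite (linear_functional_sum fl); apply: eq_bigr => i _.
  by rewrite coef_poly ltn_ord linear_functionalZ // mulrC.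
apply: dual_model_le => // q.
have -> : pair (\poly_(i < size a) f 'X^i) q = f (restr (fun i => i < size a)%N q).
  rewrite (pair_widen _ (size_poly _ _)).
  have -> : restr (fun i => i < size a)%N q = comb (fun i => 'X^i) (\poly_(i < size a) q`_i).
    by rewrite comb_id; apply/polyP => i; rewrite coef_restr coef_poly.
  rewrite comb_poly (linear_functional_sum fl); apply: eq_bigr => i _.
  by rewrite coef_poly ltn_ord linear_functionalZ // mulrC.
exact: le_trans (fle _) (sn_restr ps _ _).
Qed.

Lemma sum_mul (f : nat -> R) E M :
  \sum_(t < E * M) f t = \sum_(i < M) \sum_(j < E) f (E * i + j)%N.
Proof.
elim: M => [|M ih]; first by rewrite muln0 !big_ord0.
by rewrite big_ord_recr /= -ih mulnSr big_split_ord.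
Qed.

Lemma pair_tens E b a be' al : (0 < E)%N -> (size a <= E)%N -> (size al <= E)%N ->
  pair (tens E be' al) (tens E b a) = pair be' b * pair al a.
Proof.
move=> E0 ha hal; pose M := (size (tens E be' al) + size be')%N.
have s1 : (size (tens E be' al) <= E * M)%N.
  by apply: leq_trans (leq_addr (size be') _) _; rewrite leq_pmull.
rewrite (pair_widen _ s1) (sum_mul (fun t => (tens E be' al)`_t * (tens E b a)`_t)).
rewrite (@pair_widen _ be' b M) ?leq_addl // (pair_widen _ hal) mulr_suml.
apply: eq_bigr => i _; rewrite mulr_sumr; apply: eq_bigr => j _.
by rewrite !coef_tens // mulrACA.
Qed.

(** If [al] and [bet] norm [a] and [b], then [pair_tens] evaluates their product at [b (x) a] as
    [p a * p b], and submultiplicativity of [P] bounds the norm of that product. *)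
Lemma dual_submult_super (C : R) : 0 <= C ->
  (forall a b, ptens P b a <= C * P a * P b) ->
  exists2 C', 0 <= C' & forall a b, p a * p b <= C' * ptens p b a.
Proof.
move=> C0 h; pose M : R := 1536 * 8.
have Ps := dual_model_spreading.
exists (128 * (C * M * M)); first by rewrite /M; lra.
move=> a b; have [al alP ala] := dual_norming a; have [bet beP beb] := dual_norming b.
pose E := (size a + size al).+1.
have sa : (size a <= E)%N by rewrite /E; lia.
have sal : (size al <= E)%N by rewrite /E; lia.
rewrite -ala -beb mulrC -(@pair_tens E b a bet al) //.
apply: le_trans (dual_model_ge _ _) _.
rewrite (ptensE Ps _ sal) (ptensE ps _ sa).
have h1 : ptens P bet al <= C * M * M.
  apply: le_trans (h _ _) _; apply: ler_pM => //; first by rewrite mulr_ge0.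
  by apply: ler_wpM2l.
have := ler_wpM2r (ptens_ge0 ps b a) h1; lra.
Qed.

End Stable.

(** Unboundedness of [fund] makes the functionals weakly null; only then does the model of a stable
    subsequence of them count in [SPw_countable]. *)
Theorem dual_supermultiplicative : (forall M : R, exists n, M < fund p n) ->
  SPw_countable D DN -> exists2 C, 0 <= C & forall a b, p a * p b <= C * ptens p b a.
Proof.
move=> unb cnt.
have vn := ncoord_normalized gs.
have [m [mI [P [PD PZ Pinv Papp]]]] := stable_subsequence NSD vn.
have Ps := dual_model_spreading mI PD PZ Pinv Papp.
have th0 : (fun L => 6 * 2^-1 ^+ L) @ \oo --> (0 : R).
  rewrite [X in _ --> X](_ : 0 = 6 * 0); last by rewrite mulr0.
  by apply: cvgMr; exact: geo_cvg0.
pose KP : R := 1536 * 1024.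
have KP0 : 0 < KP^-1 by rewrite invr_gt0 /KP; lra.
have [||F [xt [z [zw zg zG xtP]]]] := @additive_spreading_model _ _ _ _ NSD 2 (v \o m) P _ KP^-1
  (normalized_sub m vn) (weakly_null_sub mI (ncoord_weakly_null unb))
  (grunblum_sub (ncoord_grunblum gs) mI) PD PZ Pinv KP0 _ th0.
- move=> q i; rewrite ler_pdivrMl; last by rewrite -invr_gt0.
  exact: (sn_coef Ps).
- move=> L q h1 h2 h3; apply: le_trans (Papp L q h1 h2 h3) _.
  by apply: ler_wpM2l => //; exact: geo4_half.
have [eps' [e0 [_ ecvg] zm _ _]] := generates_models NSD zg.
have e : (fun q => `|comb xt q|) = P by apply/funext.
rewrite e in zm.
have [C C0 hC] := SPw_countable_submultiplicative NSD zg.1 zw zG Ps e0 ecvg zm cnt.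
exact: (dual_submult_super mI PD PZ Pinv Papp C0 hC).
Qed.

End DualModel.

(** * Multiplicative spreading norms *)

Section Growth.
Variable R : realType.

Lemma bernoulli (d : R) k : 0 <= d -> 1 + k%:R * d <= (1 + d) ^+ k.
Proof.
move=> d0; elim: k => [|k ih]; first by rewrite mul0r addr0 expr0.
rewrite exprS -natr1; have := ler_wpM2l (addr_ge0 ler01 d0) ih.
have : 0 <= k%:R * d * d by rewrite !mulr_ge0.
lra.
Qed.

(** At even exponents the square of Bernoulli's inequality gives quadratic growth if [x > 1],
    against a linear bound. *)
Lemma subexponential_le1 (x B : R) (tau : nat) : 0 <= x -> 0 <= B ->
  (forall k, x ^+ k <= B * (k * tau).+1%:R) -> x <= 1.
Proof.
move=> x0 B0 h; rewrite leNgt; apply/negP => x1.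
pose d := x - 1; have d0 : 0 < d by rewrite /d; lra.
have xd : x = 1 + d by rewrite /d; lra.
pose M := B * (2 * tau).+1%:R.
have H k : (0 < k)%N -> k%:R * d * d <= M.
  move=> k0; have kp : 0 < k%:R :> R by rewrite ltr0n.
  have h1 := bernoulli k (ltW d0); rewrite -xd in h1.
  have h2 := h (k * 2)%N; rewrite exprM expr2 in h2.
  have xk0 : 0 <= 1 + k%:R * d by rewrite addr_ge0 // mulr_ge0 // ltW.
  have h3 := ler_pM xk0 xk0 h1 h1.
  have h4 : B * (k * 2 * tau).+1%:R <= B * ((2 * tau).+1%:R * k%:R).
    by apply: ler_wpM2l => //; rewrite -natrM ler_nat; nia.
  have h5 : (k%:R * d) * (k%:R * d) <= M * k%:R.
    apply: le_trans (le_trans h3 (le_trans h2 _)); last by rewrite /M -mulrA.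
    by have := mulr_gt0 kp d0; lra.
  have : (k%:R * d * d) * k%:R <= M * k%:R by lra.
  by rewrite ler_pM2r.
have [k hk] : exists k : nat, M / (d * d) < k.+1%:R.
  by exists (Num.truncn (M / (d * d))); exact: truncnS_gt.
have := H k.+1 isT; rewrite ltr_pdivrMr ?mulr_gt0 // in hk; lra.
Qed.

(** The slope is squeezed between all [(phi j - c) / j] and all [(phi k + c) / k], which are
    compared by computing [phi (j * k)] in two ways. *)
Lemma near_additive (phi : nat -> R) (c : R) :
  (forall j k, `|phi (j + k)%N - phi j - phi k| <= c) ->
  exists sg, forall k, (0 < k)%N -> `|phi k - sg * k%:R| <= c.
Proof.
move=> h.
have M n j : (0 < n)%N -> `|phi (n * j)%N - n%:R * phi j| <= n.-1%:R * c.
  case: n => // n _; elim: n => [|n ih]; first by rewrite mul1n mul1r subrr normr0 mul0r.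
  rewrite mulSn -[n.+2%:R]natr1 /=.
  have -> : phi (j + n.+1 * j)%N - (n.+1%:R + 1) * phi j =
    (phi (j + n.+1 * j)%N - phi j - phi (n.+1 * j)%N) + (phi (n.+1 * j)%N - n.+1%:R * phi j) by ring.
  apply: le_trans (ler_normD _ _) _; have := h j (n.+1 * j)%N; move: ih => /=.
  by rewrite -[n.+1%:R in X in _ -> _ -> _ <= X]natr1; lra.
have [|sg hsg] := @between R (fun j => (phi j.+1 - c) / j.+1%:R) (fun k => (phi k.+1 + c) / k.+1%:R).
  move=> j k; have h1 := M k.+1 j.+1 isT; have h2 := M j.+1 k.+1 isT.
  rewrite mulnC in h2; move: h1 h2; rewrite !ler_norml /= => /andP[a1 a2] /andP[b1 b2].
  have c0 : 0 <= c by apply: le_trans (h 0 0)%N.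
  rewrite ler_pdivrMr ?ltr0n // mulrAC ler_pdivlMr ?ltr0n //.
  rewrite -![_.+1%:R]natr1 in a1 a2 b1 b2 *; lra.
exists sg => -[//|k] _; have /andP[h1 h2] := hsg k.
rewrite ler_pdivrMr ?ltr0n // in h1; rewrite ler_pdivlMr ?ltr0n // in h2.
by rewrite ler_norml; apply/andP; split; lra.
Qed.

End Growth.

Section Multiplicative.
Variables (R : realType) (K : R) (p : {poly R} -> R) (C : R).
Hypothesis ps : spreading_norm K p.
Hypothesis C1 : 1 <= C.
Hypothesis sub : forall a b, ptens p b a <= C * p a * p b.
Hypothesis sup : forall a b, p a * p b <= C * ptens p b a.
Implicit Types (a b q : {poly R}).

Let K1 : 1 <= K. Proof. exact: (sn_K_ge1 ps). Qed.

Lemma nzs_ones n : nzs (\poly_(i < n) 1 : {poly R}) = nseq n 1.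
Proof.
have -> : \poly_(i < n) 1 = \poly_(i < n) (predT i)%:R :> {poly R} by [].
by rewrite nzs_indicator count_predT size_iota.
Qed.

Lemma fund_mul m n : fund p (m * n) = ptens p (\poly_(i < m) 1) (\poly_(i < n) 1).
Proof.
apply: (sn_inv ps); rewrite nzs_tensE ?size_poly // !nzs_ones.
elim: m => [|m ih] //=; rewrite mulSn nseqD ih; congr (_ ++ _).
by rewrite map_nseq mulr1.
Qed.

Lemma fund_ge n : (0 < n)%N -> 1 <= K * fund p n.
Proof.
move=> n0; have := sn_coef ps (\poly_(i < n) 1) 0.
by rewrite coef_poly n0 normr1.
Qed.

Lemma fund_gt0 n : (0 < n)%N -> 0 < fund p n.
Proof. by move=> /fund_ge h; have k1 := K1; rewrite -(pmulr_rgt0 _ (lt_le_trans ltr01 k1)); lra. Qed.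

Lemma fund_le n : fund p n <= n%:R.
Proof.
apply: le_trans (sn_le_sum ps (size_poly n _)) _.
rewrite (eq_bigr (fun=> 1)) => [|i _]; last by rewrite coef_poly ltn_ord normr1.
by rewrite sumr_const card_ord.
Qed.

(** The logarithm of [fund p (2 ^ k)] is additive in [k] up to [ln C], hence linear up to [ln C];
    dividing its slope by [ln 2] gives [s]. Other integers are compared with powers of 2 by
    [fund_mono]. *)
Lemma fund_power : (forall M : R, exists n, M < fund p n) ->
  exists s B : R, [/\ 0 < s, s <= 1, 0 < B &
    forall n, fund p n <= B * n%:R `^ s /\ n%:R `^ s <= B * fund p n].
Proof.
move=> unb; have k1 := K1; have c1 : 1 <= C := C1; pose phi k := ln (fund p (2 ^ k)); pose c := ln C.
have C0 : 0 < C by lra.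
have c0 : 0 <= c by exact: ln_ge0.
have f0 k : 0 < fund p (2 ^ k) by apply: fund_gt0; rewrite expn_gt0.
have pe k : fund p (2 ^ k) = expR (phi k) by rewrite lnK // posrE.
have [sg hsg] : exists sg, forall k, (0 < k)%N -> `|phi k - sg * k%:R| <= c.
  apply: near_additive => j k.
  have h1 : phi (j + k)%N <= c + phi k + phi j.
    rewrite /phi /c expnD fund_mul -!lnM ?posrE ?mulr_gt0 // ler_ln ?posrE ?mulr_gt0 //.
    by rewrite -fund_mul -expnD.
  have h2 : phi k + phi j <= c + phi (j + k)%N.
    rewrite /phi /c expnD fund_mul -!lnM ?posrE // ?mulr_gt0 //; last by rewrite -fund_mul -expnD.
    rewrite ler_ln ?posrE ?mulr_gt0 //; last by rewrite -fund_mul -expnD.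
    exact: sup.
  by rewrite ler_norml; apply/andP; split; lra.
have up k : fund p (2 ^ k.+1) <= expR (sg * k.+1%:R + c).
  rewrite pe ler_expR; have := hsg k.+1 isT; rewrite ler_norml => /andP[]; lra.
have lo k : expR (sg * k.+1%:R - c) <= fund p (2 ^ k.+1).
  rewrite pe ler_expR; have := hsg k.+1 isT; rewrite ler_norml => /andP[]; lra.
have bound n : (0 < n)%N -> fund p n <= K * fund p (2 ^ (trunc_log 2 n).+1).
  by move=> n0; apply: (fund_mono ps); exact/ltnW/trunc_log_ltn.
have ln2 : 0 < ln 2 :> R by apply: ln_gt0; lra.
have sg0 : 0 < sg.
  rewrite ltNge; apply/negP => sgn.
  have [n hn] := unb (K * expR c); case: n hn => [|n] hn.
    move: hn; rewrite /fund (_ : \poly_(i < 0) 1 = 0); last by apply/polyP => i; rewrite coef_poly coef0.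
    rewrite (sn0 ps); have := mulr_gt0 (lt_le_trans ltr01 k1) (expR_gt0 c); lra.
  have := bound n.+1 isT; have := up (trunc_log 2 n.+1); set t := trunc_log 2 n.+1.
  have : expR (sg * t.+1%:R + c) <= expR c.
    by rewrite ler_expR gerDr mulr_le0_ge0.
  move=> h1 h2 h3; have h4 : K * fund p (2 ^ t.+1) <= K * expR c.
    by apply: ler_wpM2l; [lra | exact: le_trans h2 h1].
  lra.
(* The triangle inequality gives [fund p (2 ^ k) <= 2 ^ k]; this is what later makes the exponent
   [1 / s] at least 1. *)
have sg1 : sg <= ln 2.
  rewrite leNgt; apply/negP => hs; have d0 : 0 < sg - ln 2 by lra.
  have [k hk] : exists k : nat, c / (sg - ln 2) < k.+1%:R.
    by exists (Num.truncn (c / (sg - ln 2))); exact: truncnS_gt.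
  rewrite ltr_pdivrMr // in hk.
  have h1 : phi k.+1 <= k.+1%:R * ln 2.
    rewrite /phi mulr_natl -lnXn // ler_ln ?posrE ?exprn_gt0 //.
    by rewrite -natrX; exact: fund_le.
  have := hsg k.+1 isT; rewrite ler_norml => /andP[h2 _]; lra.
pose s := sg / ln 2.
have s0 : 0 < s by rewrite divr_gt0.
have sgE : sg = s * ln 2 by rewrite /s divfK // gt_eqF.
have e2 k : expR (sg * k%:R) = (2 ^ k)%:R `^ s.
  rewrite /powR pnatr_eq0 expn_eq0 /= natrX lnXn // -mulr_natl sgE; congr expR; ring.
have eC : expR c = C by rewrite lnK // posrE.
have fz : fund p 0 = 0.
  rewrite /fund (_ : \poly_(i < 0) 1 = 0) ?(sn0 ps) //.
  by apply/polyP => i; rewrite coef_poly coef0.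
pose B := K * C * expR sg + 2 * C * C * K.
have B1 : 0 < K * C * expR sg by rewrite !mulr_gt0 ?expR_gt0 //; lra.
have B2 : 0 < 2 * C * C * K by rewrite !mulr_gt0 //; lra.
have s1 : s <= 1 by rewrite /s ler_pdivrMr // mul1r.
exists s, B; split=> //; first by rewrite /B addr_gt0.
case=> [|n]; first by rewrite fz powR0 ?gt_eqF // !mulr0.
set N := n.+1; set t := trunc_log 2 N.
have N0 : (0 < N)%N by [].
have tN : (2 ^ t <= N)%N by exact: trunc_logP.
have Nt : (N <= 2 ^ t.+1)%N by exact/ltnW/trunc_log_ltn.
have pN : 0 <= N%:R `^ s :> R by exact: powR_ge0.
have fN := fund_gt0 N0.
have m1 : (2 ^ t)%:R `^ s <= N%:R `^ s :> R.
  by apply: ge0_ler_powR; rewrite ?nnegrE ?ler_nat // ltW.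
have m2 : N%:R `^ s <= (2 ^ t.+1)%:R `^ s :> R.
  by apply: ge0_ler_powR; rewrite ?nnegrE ?ler_nat // ltW.
have ft := fund_mono ps tN.
split.
  have h1 := bound N N0; have h2 := up t; rewrite -/t in h1.
  have e3 : expR (sg * t.+1%:R + c) = C * expR sg * (2 ^ t)%:R `^ s.
    by rewrite -e2 -eC -!expRD -natr1; congr expR; ring.
  rewrite e3 in h2.
  have h3 : C * expR sg * (2 ^ t)%:R `^ s <= C * expR sg * N%:R `^ s.
    by apply: ler_wpM2l => //; rewrite mulr_ge0 ?expR_ge0 //; lra.
  have h4 : K * fund p (2 ^ t.+1) <= K * (C * expR sg * N%:R `^ s).
    by apply: ler_wpM2l; [lra | exact: le_trans h2 h3].
  have h5 : 0 <= 2 * C * C * K * N%:R `^ s by rewrite mulr_ge0 // ltW.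
  by rewrite /B; lra.
have h1 := lo t.
have e3 : (2 ^ t.+1)%:R `^ s = C * expR (sg * t.+1%:R - c).
  by rewrite -e2 -{1}eC -expRD; congr expR; ring.
have h2 : fund p (2 ^ t.+1) <= C * fund p 2 * fund p (2 ^ t).
  by rewrite expnSr fund_mul; exact: sub.
have h3 : fund p 2 <= 2 by exact: fund_le.
have h4 : C * fund p 2 * fund p (2 ^ t) <= C * 2 * (K * fund p N).
  apply: ler_pM => //.
  - by rewrite mulr_ge0 ?(ltW (fund_gt0 _)) //; lra.
  - exact: ltW (f0 t).
  - by apply: ler_wpM2l => //; lra.
have h5 : C * expR (sg * t.+1%:R - c) <= C * (C * 2 * (K * fund p N)).
  by apply: ler_wpM2l; [lra | exact: le_trans h1 (le_trans h2 h4)].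
rewrite e3 in m2; have h6 : 0 <= K * C * expR sg * fund p N by rewrite mulr_ge0 // ltW.
by rewrite /B; lra.
Qed.

End Multiplicative.

(** * The tensor power method *)

Section TensorPower.
Variables (R : realType) (K : R) (p : {poly R} -> R) (C s B : R).
Hypothesis ps : spreading_norm K p.
Hypothesis C1 : 1 <= C.
Hypothesis sub : forall a b, ptens p b a <= C * p a * p b.
Hypothesis sup : forall a b, p a * p b <= C * ptens p b a.
Hypotheses (s0 : 0 < s) (B0 : 0 < B).
Hypothesis fB : forall n, fund p n <= B * n%:R `^ s /\ n%:R `^ s <= B * fund p n.
Implicit Types (t u T : seq nat).

Let K1 : 1 <= K. Proof. exact: (sn_K_ge1 ps). Qed.
Let C0 : 0 < C. Proof. exact: lt_le_trans ltr01 C1. Qed.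

Lemma nzs_Poly (l : seq R) : nzs (Poly l) = [seq c <- l | c != 0].
Proof.
rewrite (nzs_mkseq (size_Poly l)) (eq_mkseq (g := nth 0 l)); first by rewrite mkseq_nth.
by move=> i; rewrite coef_Poly.
Qed.

Definition dyadic t : {poly R} := Poly [seq 2^-1 ^+ i | i <- t].

Lemma nzs_dyadic t : nzs (dyadic t) = [seq 2^-1 ^+ i | i <- t].
Proof.
rewrite nzs_Poly; apply/all_filterP/allP => _ /mapP[i _ ->].
by rewrite expf_neq0.
Qed.

(** Exponents of the [k]-th tensor power of [dyadic t]: products of coefficients add exponents. The
    list grows exponentially in [k], but its values stay within [k * tau] if those of [t] are at
    most [tau]. *)
Fixpoint sumpow k t : seq nat :=
  if k is k'.+1 then [seq (i + j)%N | i <- t, j <- sumpow k' t] else [:: 0%N].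

Lemma dyadic_sumpow k t :
  p (dyadic (sumpow k.+1 t)) = ptens p (dyadic t) (dyadic (sumpow k t)).
Proof.
apply: (sn_inv ps); rewrite nzs_tensE // !nzs_dyadic map_allpairs allpairs_mapl allpairs_mapr.
by apply: eq_allpairs => i j; rewrite exprD.
Qed.

Lemma dyadic_sumpow0 t : p (dyadic (sumpow 0 t)) = 1.
Proof.
rewrite -(sn1 ps); apply: (sn_inv ps); rewrite nzs_dyadic /= expr0.
by rewrite /nzs polyseq1 /= oner_eq0.
Qed.

Lemma dyadic_sumpow_le k t : p (dyadic (sumpow k t)) <= (C * p (dyadic t)) ^+ k.
Proof.
have c0 := C0; have p0 := sn_ge0 ps (dyadic t).
elim: k => [|k ih]; first by rewrite dyadic_sumpow0 expr0.
rewrite dyadic_sumpow exprS; apply: le_trans (sub _ _) _; rewrite mulrAC.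
by apply: ler_wpM2l => //; rewrite mulr_ge0 // ltW.
Qed.

Lemma dyadic_sumpow_ge k t : p (dyadic t) ^+ k <= C ^+ k * p (dyadic (sumpow k t)).
Proof.
have c0 := C0; have p0 := sn_ge0 ps (dyadic t).
elim: k => [|k ih]; first by rewrite dyadic_sumpow0 !expr0 mulr1.
rewrite dyadic_sumpow !exprS; have h := sup (dyadic (sumpow k t)) (dyadic t).
have h1 := ler_wpM2l p0 ih.
have h2 := ler_wpM2l (exprn_ge0 k (ltW c0)) h.
rewrite mulrC in h1; lra.
Qed.

Let r := s^-1.
Let h : R := 2^-1 `^ r.
Let h0 : 0 < h. Proof. exact: powR_gt0. Qed.

Let h_pow j : (h ^+ j) `^ s = 2^-1 ^+ j.
Proof.
rewrite -powR_mulrn ?(ltW h0) // /h -!powRrM.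
have -> : r * (j%:R * s) = j%:R by rewrite /r; field; rewrite gt_eqF.
by rewrite powR_mulrn.
Qed.

(** Since [h ^+ i] is the [r]-th power of [2^-i], this is the [r]-th power of the [l_r] norm of
    [dyadic t]. It is exactly multiplicative under tensor powers. *)
Definition weight t : R := \sum_(i <- t) h ^+ i.

Lemma weight_allpairs t u : weight [seq (i + j)%N | i <- t, j <- u] = weight t * weight u.
Proof.
rewrite /weight; elim: t => [|i t ih] /=; first by rewrite !big_nil mul0r.
rewrite big_cat big_cons mulrDl ih; congr (_ + _).
by rewrite big_map mulr_sumr; apply: eq_bigr => j _; rewrite exprD.
Qed.

Lemma weight_sumpow k t : weight (sumpow k t) = weight t ^+ k.
Proof.
elim: k => [|k ih]; first by rewrite /weight big_cons big_nil addr0 !expr0.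
by rewrite [LHS]weight_allpairs ih exprS.
Qed.

Lemma sumpow_le k t tau : all (fun i => i <= tau)%N t ->
  all (fun i => i <= k * tau)%N (sumpow k t).
Proof.
move=> /allP ht; elim: k => // k /allP ih; apply/allP => _ /allpairsP[[i j] /= [hi hj ->]].
by rewrite mulSn; apply: leq_add; [exact: ht | exact: ih].
Qed.

Lemma fund_level T j :
  p (\poly_(i < size T) (nth 0%N T i == j)%:R) = fund p (count_mem j T).
Proof.
rewrite (fund_indicator ps _ (fun i => nth 0%N T i == j)); congr fund.
by rewrite -[in RHS](mkseq_nth 0%N T) /mkseq count_map.
Qed.

Lemma coef_dyadic T i : (dyadic T)`_i = if (i < size T)%N then 2^-1 ^+ nth 0%N T i else 0.
Proof.
rewrite coef_Poly; case: ltnP => hi; first by rewrite (nth_map 0%N).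
by rewrite nth_default // size_map.
Qed.

Lemma dyadic_levels T J : all (fun i => i <= J)%N T ->
  p (dyadic T) <= \sum_(j < J.+1) 2^-1 ^+ j * fund p (count_mem (j : nat) T).
Proof.
move=> /allP hT.
have -> : dyadic T = \sum_(j < J.+1) 2^-1 ^+ j *: \poly_(i < size T) (nth 0%N T i == j)%:R.
  apply/polyP => i; rewrite coef_dyadic coef_sum; case: ltnP => hi; last first.
    by rewrite big1 // => j _; rewrite coefZ coef_poly ltnNge hi mulr0.
  have hj : (nth 0%N T i < J.+1)%N by rewrite ltnS; apply: hT; exact: mem_nth.
  rewrite (bigD1 (Ordinal hj)) //= coefZ coef_poly hi eqxx mulr1 big1 ?addr0 //.
  move=> j /eqP nj; rewrite coefZ coef_poly hi; case: eqP => [e|_]; last by rewrite mulr0.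
  by exfalso; apply: nj; apply: val_inj.
apply: le_trans (sn_sum ps _ _ _) _; apply: ler_sum => j _.
by rewrite (snZ ps) ger0_norm ?exprn_ge0 // fund_level.
Qed.

Lemma dyadic_level_le T j : 2^-1 ^+ j * fund p (count_mem j T) <= K * p (dyadic T).
Proof.
rewrite -fund_level -[X in X * _]ger0_norm ?exprn_ge0 // -(snZ ps).
have -> : 2^-1 ^+ j *: \poly_(i < size T) (nth 0%N T i == j)%:R =
    restr (fun i => nth 0%N T i == j) (dyadic T).
  apply/polyP => i; rewrite coef_restr coef_dyadic coefZ coef_poly; case: ltnP => hi.
    by case: eqP => [->|_]; rewrite ?mulr1 ?mulr0.
  by rewrite mulr0; case: ifP.
exact: (sn_restr ps).
Qed.

Lemma weight_levels T J : all (fun i => i <= J)%N T ->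
  weight T = \sum_(j < J.+1) h ^+ j * (count_mem (j : nat) T)%:R.
Proof.
rewrite /weight; elim: T => [|i T ih] /=.
  by rewrite big_nil big1 // => j _; rewrite mulr0.
move=> /andP[hi /ih e]; rewrite big_cons e.
under [RHS]eq_bigr do rewrite natrD mulrDr.
rewrite big_split /=; congr (_ + _).
have hj : (i < J.+1)%N by [].
rewrite (bigD1 (Ordinal hj)) //= eqxx mulr1 big1 ?addr0 // => j /eqP nj.
case: eqP => [e'|_]; last by rewrite mulr0.
by exfalso; apply: nj; apply: val_inj.
Qed.

Lemma weight_level_le T j : h ^+ j * (count_mem j T)%:R <= weight T.
Proof.
have g i : 0 <= h ^+ i by rewrite exprn_ge0 // ltW // h0.
rewrite /weight; elim: T => [|i T ih] /=; first by rewrite big_nil mulr0.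
rewrite big_cons natrD mulrDr; apply: lerD => //.
by case: eqP => [->|_]; rewrite ?mulr1 ?mulr0.
Qed.

Lemma weight_ge0 t : 0 <= weight t.
Proof. by apply: sumr_ge0 => i _; rewrite exprn_ge0 // ltW // h0. Qed.

Let level_pow j (n : nat) : 2^-1 ^+ j * n%:R `^ s = (h ^+ j * n%:R) `^ s.
Proof. by rewrite powRM ?h_pow // exprn_ge0 // ltW // h0. Qed.

(** Split the [k]-th tensor power into level sets, each of norm at most [B] times the [k]-th power
    of the [l_r] norm. There are at most [k * tau + 1] of them, so taking [k] large removes [B] and
    their number; only the factor [C] per step remains. *)
Lemma dyadic_le_weight t : t != [::] -> p (dyadic t) <= C * weight t `^ s.
Proof.
move=> tn; have c0 := C0; have b0 : 0 < B := B0.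
have ws : 0 < weight t `^ s.
  apply: powR_gt0; case: t tn => // i t _; rewrite /weight big_cons.
  have := exprn_gt0 i h0; have := weight_ge0 t; rewrite /weight; lra.
have tau : exists tau, all (fun i => i <= tau)%N t.
  exists (\sum_(i <- t) i)%N; apply/allP => i it; rewrite (big_rem i) //=; exact: leq_addr.
have {tau}[tau ht] := tau.
have cw : 0 < C * weight t `^ s by rewrite mulr_gt0.
have pt := sn_ge0 ps (dyadic t).
suff : p (dyadic t) / (C * weight t `^ s) <= 1 by rewrite ler_pdivrMr // mul1r.
apply: (@subexponential_le1 _ _ B tau).
- by rewrite divr_ge0 // ltW.
- exact: ltW.
move=> k; rewrite expr_div_n ler_pdivrMr ?exprn_gt0 //.
apply: le_trans (dyadic_sumpow_ge k t) _; rewrite exprMn [B * _ * _]mulrCA.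
apply: ler_wpM2l; first by rewrite exprn_ge0 // ltW.
apply: le_trans (dyadic_levels (sumpow_le k ht)) _.
apply: (@le_trans _ _ (\sum_(j < (k * tau).+1) B * (weight t `^ s) ^+ k)); last first.
  by rewrite sumr_const card_ord -[_ *+ (k * tau).+1]mulr_natr mulrAC.
apply: ler_sum => j _; apply: le_trans (ler_wpM2l _ (fB _).1) _; first exact: exprn_ge0.
rewrite mulrCA level_pow; apply: ler_wpM2l; first exact: ltW.
have -> : (weight t `^ s) ^+ k = weight (sumpow k t) `^ s.
  by rewrite weight_sumpow -!powR_mulrn ?powR_ge0 ?weight_ge0 // powRAC.
apply: ge0_ler_powR; rewrite ?nnegrE ?weight_ge0 ?(ltW s0) //.
  by apply: mulr_ge0 => //; apply: exprn_ge0; exact: ltW h0.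
exact: weight_level_le.
Qed.

(** The same method with the roles exchanged: the weight of a power is a sum over levels, and by
    unconditionality each level has norm at most [K] times that of the whole power. *)
Lemma weight_le_dyadic t : t != [::] -> weight t `^ s <= C * p (dyadic t).
Proof.
move=> tn; have c0 := C0; have b0 : 0 < B := B0; have k1 := K1.
have tau : exists tau, all (fun i => i <= tau)%N t.
  exists (\sum_(i <- t) i)%N; apply/allP => i it; rewrite (big_rem i) //=; exact: leq_addr.
have {tau}[tau ht] := tau.
have pt : 0 < p (dyadic t).
  have := sn_coef ps (dyadic t) 0; rewrite coef_dyadic; case: t tn {ht} => // i t _ /=.
  have g : 0 < 2^-1 ^+ i :> R by rewrite exprn_gt0.
  rewrite gtr0_norm // => hp; have := lt_le_trans g hp; rewrite pmulr_rgt0 //; lra.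
pose Y := C * p (dyadic t); have Y0 : 0 < Y by rewrite mulr_gt0.
have r0 : 0 < r by rewrite invr_gt0.
have Yr : 0 < Y `^ r by exact: powR_gt0.
suff le1 : weight t / Y `^ r <= 1.
  rewrite ler_pdivrMr // mul1r in le1.
  have -> : C * p (dyadic t) = (Y `^ r) `^ s.
    by rewrite -powRrM mulVf ?gt_eqF // powRr1 // ltW.
  by apply: ge0_ler_powR; rewrite ?nnegrE ?weight_ge0 ?powR_ge0 ?(ltW s0).
pose M := (B * K) `^ r.
apply: (@subexponential_le1 _ _ M tau).
- by rewrite divr_ge0 ?weight_ge0 ?powR_ge0.
- exact: powR_ge0.
move=> k; rewrite expr_div_n ler_pdivrMr ?exprn_gt0 //.
rewrite -weight_sumpow (weight_levels (sumpow_le k ht)).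
apply: (@le_trans _ _ (\sum_(j < (k * tau).+1) M * (Y `^ r) ^+ k)); last first.
  by rewrite sumr_const card_ord -[_ *+ (k * tau).+1]mulr_natr mulrAC.
apply: ler_sum => j _; set T := sumpow k t; set n := count_mem _ T.
have hn : 0 <= h ^+ j * n%:R by apply: mulr_ge0 => //; apply: exprn_ge0; exact: ltW h0.
have -> : h ^+ j * n%:R = (2^-1 ^+ j * n%:R `^ s) `^ r.
  by rewrite level_pow -powRrM mulfV ?gt_eqF // powRr1.
have bk : 0 <= B * K by apply: mulr_ge0; lra.
have yk : 0 <= Y ^+ k by rewrite exprn_ge0 // ltW.
have -> : M * (Y `^ r) ^+ k = (B * K * Y ^+ k) `^ r.
  rewrite (powRM _ bk yk).
  rewrite -(@powR_mulrn R (Y `^ r) k (powR_ge0 _ _)) -(@powR_mulrn R Y k (ltW Y0)).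
  by rewrite powRAC.
apply: ge0_ler_powR.
- exact: ltW.
- by rewrite nnegrE mulr_ge0 ?exprn_ge0 ?powR_ge0.
- by rewrite nnegrE mulr_ge0.
apply: le_trans (ler_wpM2l _ (fB n).2) _; first exact: exprn_ge0.
rewrite mulrCA -mulrA; apply: ler_wpM2l; first exact: ltW.
apply: le_trans (dyadic_level_le T j) _; apply: ler_wpM2l; first by lra.
exact: dyadic_sumpow_le.
Qed.

Lemma dyadic_approx (c : R) : 0 < c <= 1 -> exists i, 2^-1 ^+ i.+1 < c <= 2^-1 ^+ i.
Proof.
move=> /andP[c0 c1].
have /cvgr0Pnorm_le/(_ _ c0)[N _ hN] := @geo_cvg0 R.
have ex : exists i, (2^-1 ^+ i.+1 < c).
  exists N; apply: lt_le_trans (le_trans (ler_norm _) (hN N (leqnn N))).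
  by rewrite exprS; have : 0 < 2^-1 ^+ N :> R by [rewrite exprn_gt0]; lra.
have := ex_minnP ex => -[i hi himin]; exists i; rewrite hi /=.
case: i hi himin => [|i] hi himin; first by rewrite expr0.
by rewrite leNgt; apply/negP => h'; have := himin i h'; rewrite ltnn.
Qed.

(** After division by the largest coefficient [A], absolute values are rounded up to powers of
    [1/2], losing at most a factor 2; [sn_cmul] allows this, and also the removal of signs, at the
    cost [2 * K]. *)
Theorem multiplicative_lp q : p q <= 4 * K * C * (\sum_(i < size q) `|q`_i| `^ r) `^ s /\
  (\sum_(i < size q) `|q`_i| `^ r) `^ s <= 4 * K * C * p q.
Proof.
have c0 := C0; have k1 := K1; have r0 : 0 < r by rewrite invr_gt0.
rewrite (@sum_coef_nzs R (fun c => `|c| `^ r) q); last by rewrite normr0 powR0 // gt_eqF.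
have [->|q0] := eqVneq q 0.
  by rewrite (sn0 ps) nzs0 big_nil powR0 ?gt_eqF // !mulr0.
pose A := \big[Num.max/0]_(i < size q) `|q`_i|.
have qA i : `|q`_i| <= A.
  case: (ltnP i (size q)) => hi; last by rewrite nth_default // normr0 bigmax_ge_id.
  exact: (@le_bigmax _ _ _ _ (fun i : 'I_(size q) => `|q`_i|) (Ordinal hi)).
have A0 : 0 < A.
  apply: lt_le_trans (qA (size q).-1); rewrite normr_gt0 -/(lead_coef q).
  by rewrite lead_coef_eq0.
pose l := nzs q.
have lP c : c \in l -> 0 < `|c| / A <= 1.
  rewrite mem_filter => /andP[cn /(nthP 0)[i _ ci]]; rewrite divr_gt0 ?normr_gt0 //=.
  by rewrite ler_pdivrMr // mul1r -ci.
have ex c : exists i, c \in l -> 2^-1 ^+ i.+1 < `|c| / A <= 2^-1 ^+ i.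
  have [cl|] := boolP (c \in l); last by exists 0%N.
  by have [i hi] := dyadic_approx (lP c cl); exists i.
have [e he] := choice ex.
pose t := [seq e c | c <- l].
have lN : l != [::].
  have : lead_coef q \in l.
    rewrite mem_filter lead_coef_eq0 q0 lead_coefE mem_nth //.
    by rewrite prednK ?size_poly_gt0.
  by apply: contraTneq => ->.
have tN : t != [::] by rewrite /t; case: (l) lN.
have lt i : (i < size l)%N -> nth 0 l i \in l by exact: mem_nth.
have two i : 2^-1 ^+ i = 2 * 2^-1 ^+ i.+1 :> R by rewrite exprS; field.
have gpos i : 0 < 2^-1 ^+ i :> R by rewrite exprn_gt0.
have pz : p q = p (Poly l).
  apply: (sn_inv ps); rewrite nzs_Poly; apply/esym/all_filterP/allP => c.
  by rewrite mem_filter => /andP[].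
have h1 : p q <= 2 * A * K * p (dyadic t).
  (* Beyond the list the multiplier is set to zero, so that its bound holds at every index. *)
  rewrite pz; have -> : Poly l = cmul (fun i => l`_i / 2^-1 ^+ e l`_i *+ (i < size l)) (dyadic t).
    apply/polyP => i; rewrite coef_cmul coef_Poly coef_dyadic size_map; case: ltnP => hi.
      by rewrite (nth_map 0) // mulr1n divfK // gt_eqF.
    by rewrite mulr0 nth_default.
  apply: (sn_cmul ps) => i; case: ltnP => hi; last by rewrite normr0 ltW.
  have /andP[_ b2] := he _ (lt i hi).
  rewrite mulr1n normrM normfV (gtr0_norm (gpos _)) ler_pdivrMr // mulrC.
  by rewrite ler_pdivrMr in b2.
have h2 : p (dyadic t) <= 2 * (2 / A) * K * p q.
  rewrite pz; have -> : dyadic t = cmul (fun i => 2^-1 ^+ e l`_i / l`_i *+ (i < size l)) (Poly l).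
    apply/polyP => i; rewrite coef_cmul coef_Poly coef_dyadic size_map; case: ltnP => hi.
      rewrite (nth_map 0) // mulr1n divfK //; have := lt i hi.
      by rewrite mem_filter => /andP[].
    by rewrite nth_default // mulr0.
  apply: (sn_cmul ps) => i; case: ltnP => hi; last by rewrite normr0 divr_ge0 // ltW.
  have /andP[b1 _] := he _ (lt i hi); have /andP[b0 _] := lP _ (lt i hi).
  rewrite mulr1n normrM normfV (gtr0_norm (gpos _)).
  have n0 : 0 < `|l`_i| by move: b0; rewrite pmulr_lgt0 // invr_gt0.
  rewrite ler_pdivrMr // two -mulrA; apply: ler_wpM2l => //.
  by rewrite mulrC; exact: ltW.
have dp := dyadic_le_weight tN; have dw := weight_le_dyadic tN.
have W0 := weight_ge0 t.
have hr i : h ^+ i = (2^-1 ^+ i) `^ r.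
  have i0 : 0 <= 2^-1 :> R by rewrite invr_ge0.
  rewrite -(@powR_mulrn R h i (ltW h0)) -(@powR_mulrn R 2^-1 i i0).
  exact: powRAC.
have Ar : 0 <= A `^ r by exact: powR_ge0.
have u1 : \sum_(c <- l) `|c| `^ r <= A `^ r * weight t.
  rewrite /weight big_map mulr_sumr big_seq [X in _ <= X]big_seq; apply: ler_sum => c cl.
  have /andP[_ b2] := he c cl; rewrite hr -powRM ?(ltW A0) ?(ltW (gpos _)) //.
  rewrite ler_pdivrMr // in b2.
  apply: ge0_ler_powR; rewrite ?nnegrE ?(ltW r0) // 1?mulrC //.
  by rewrite mulr_ge0 // ltW.
have u2 : (A / 2) `^ r * weight t <= \sum_(c <- l) `|c| `^ r.
  rewrite /weight big_map mulr_sumr big_seq [X in _ <= X]big_seq; apply: ler_sum => c cl.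
  have /andP[b1 _] := he c cl; rewrite hr -powRM ?divr_ge0 ?(ltW A0) ?(ltW (gpos _)) //.
  rewrite ltr_pdivlMr // in b1.
  apply: ge0_ler_powR; rewrite ?nnegrE ?(ltW r0) //.
    by rewrite mulr_ge0 ?divr_ge0 // ltW.
  by have := gpos (e c).+1; move: b1; rewrite [2^-1 ^+ e c]two; lra.
have S0 : 0 <= \sum_(c <- l) `|c| `^ r by apply: sumr_ge0 => c _; exact: powR_ge0.
have pw (D : R) : 0 <= D -> (D `^ r * weight t) `^ s = D * weight t `^ s.
  by move=> D0; rewrite powRM ?powR_ge0 // -powRrM mulVf ?gt_eqF // powRr1.
have v1 : (\sum_(c <- l) `|c| `^ r) `^ s <= A * weight t `^ s.
  rewrite -pw ?(ltW A0) //; apply: ge0_ler_powR; rewrite ?nnegrE ?(ltW s0) //.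
  by rewrite mulr_ge0.
have v2 : A / 2 * weight t `^ s <= (\sum_(c <- l) `|c| `^ r) `^ s.
  rewrite -pw ?divr_ge0 ?(ltW A0) //; apply: ge0_ler_powR; rewrite ?nnegrE ?(ltW s0) //.
  by rewrite mulr_ge0 ?powR_ge0.
rewrite -/l; move: v1 v2; set L := (\sum_(c <- l) _) `^ s => v1 v2.
have KA : 0 <= 2 * A * K by rewrite !mulr_ge0 // ?(ltW A0) //; lra.
split.
  apply: le_trans h1 _; apply: le_trans (ler_wpM2l KA dp) _.
  have := ler_wpM2l (_ : 0 <= 4 * K * C) v2.
  rewrite !mulr_ge0 ?(ltW c0) //; last by lra.
  by move=> /(_ isT); lra.
apply: le_trans v1 _; apply: le_trans (ler_wpM2l (ltW A0) dw) _.
have := ler_wpM2l (_ : 0 <= A * C) h2; rewrite mulr_ge0 ?(ltW A0) ?(ltW c0) // => /(_ isT).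
have -> : A * C * (2 * (2 / A) * K * p q) = 4 * K * C * p q by field; rewrite gt_eqF.
by rewrite mulrA.
Qed.

End TensorPower.

Section Subsequence.
Variables (R : realType) (V : lmodType R) (nv : V -> R) (x : nat -> V).
Variables (p : {poly R} -> R) (eps : nat -> R).

Lemma models_sub m : (forall i, (m i < m i.+1)%N) ->
  (forall q r, nzs q = nzs r -> p q = p r) -> models nv x p eps ->
  models nv (x \o m) p eps.
Proof.
move=> mI pinv xm L q qz qs; rewrite -(comb_spread x m).
have -> : p q = p (spread m q) by apply: pinv; rewrite nzs_spread.
apply: xm; last by rewrite nzs_spread.
have [r ->] := factor_Xn qz => i iL.
have -> : spread m ('X^L * r) = spread (fun j => m (L + j)%N) r by rewrite /spread comb_XnM.
have kI j : (m (L + j) < m (L + j.+1))%N by rewrite addnS.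
by apply: (coef_spread_lt r kI _ iL); rewrite addn0; exact: incr_ge.
Qed.

End Subsequence.

(** * Comparison with the classical norms and conclusion *)

Section CoefficientNorms.
Variables (R : realType) (K : R) (p : {poly R} -> R).
Hypothesis ps : spreading_norm K p.

Lemma bounded_fund_le (M A : R) (q : {poly R}) : (forall n, fund p n <= M) ->
  (forall i, `|q`_i| <= A) -> p q <= 2 * A * K * M.
Proof.
move=> fM qA; have A0 : 0 <= A := le_trans (normr_ge0 _) (qA 0%N).
have -> : q = cmul (fun i => q`_i) (\poly_(i < size q) 1).
  apply/polyP => i; rewrite coef_cmul coef_poly; case: ltnP => hi; first by rewrite mulr1.
  by rewrite mulr0 nth_default.
apply: le_trans (sn_cmul ps _ qA) _; apply: ler_wpM2l; last exact: fM.
by rewrite !mulr_ge0 //; exact: le_trans ler01 (sn_K_ge1 ps).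
Qed.

Lemma sum_opoly n (a : 'I_n -> R) (f : R -> R) : f 0 = 0 ->
  \sum_(i < n) f (a i) = \sum_(i < size (opoly a)) f (opoly a)`_i.
Proof.
move=> f0; have h : (size (opoly a) <= n)%N by exact: size_poly.
rewrite (big_ord_widen n (fun i => f (opoly a)`_i) h) [RHS]big_mkcond /=.
apply: eq_bigr => i _; rewrite coef_opoly; case: ltnP => // hi.
by rewrite -(coef_opoly a) nth_default.
Qed.

End CoefficientNorms.

Unset Implicit Arguments.
Set Strict Implicit.
Set Printing Implicit Defensive.

Theorem theorem1p9 (R : realType) (X : completeNormedModType R) :
  separable X ->
  infinite_dimensional (@setT X) ->
  SPw_countable (@setT X) (fun x : X => `|x|) ->
  (forall Y : set X, closed_subspace Y -> infinite_dimensional Y ->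
     SPw_countable (dual_space Y) (dual_norm Y)) ->
  forall (E : completeNormedModType R) (xt : nat -> E),
    is_SPw (@setT X) (fun x : X => `|x|) xt ->
    equiv_to_coeff_norm xt (@c0_norm R) \/
    exists p : R, 1 <= p /\ equiv_to_coeff_norm xt (lp_norm p).
Proof.
move=> _ _ cX cY E xt [x [xw xg]].
pose p q := `|comb xt q|.
have NS := @normed_setT R X.
have [eps [e0 [_ ecvg] xm p1 pinv]] := generates_models NS xg.
have x1 n : `|x n| = 1 := (xg.1 n).2.
have [m [mI mG mS]] := schreier_unconditional_subsequence x1 xw.
have gs : good_sequence (x \o m) p eps.
  split=> // [n|q r|c q|].
  - exact: x1.
  - by rewrite /p combD; exact: ler_normD.
  - by rewrite /p combZ normrZ.
  - exact: models_sub.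
have ps := gs_spreading gs.
have aE n (a : 'I_n -> R) : `|\sum_(i < n) a i *: xt i| = p (opoly a).
  by rewrite /p comb_opoly.
have [C1 C10 h1] := SPw_countable_submultiplicative NS (gs_normalized gs)
  (weakly_null_sub mI xw) (gs_grunblum gs) ps e0 ecvg (gs_models gs) cX.
(* Unbounded sums of basis vectors make the dual argument available and lead to some [l_p], where
   [p = 1] is included; bounded ones give [c_0] by unconditionality alone. *)
have [unb|bnd] := pselect (forall M : R, exists n, M < fund p n).
  have [C2 C20 h2] := dual_supermultiplicative gs unb
    (cY _ (cspan_closed (x \o m)) (cspan_infinite gs)).
  pose C := C1 + C2 + 1.
  have Cge : 1 <= C by rewrite /C; lra.
  have sub a b : ptens p b a <= C * p a * p b.
    apply: le_trans (h1 a b) _; rewrite -!mulrA; apply: ler_wpM2r; last by rewrite /C; lra.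
    by rewrite mulr_ge0 ?(sn_ge0 ps).
  have sup a b : p a * p b <= C * ptens p b a.
    apply: le_trans (h2 a b) _; apply: ler_wpM2r; last by rewrite /C; lra.
    exact: (ptens_ge0 ps).
  have [s [B [s0 s1 B0 fB]]] := fund_power ps Cge sub sup unb.
  right; exists s^-1; split; first by rewrite invf_ge1.
  pose Q := 4 * 8 * C; have Q0 : 0 < Q by rewrite /Q; lra.
  exists Q; split=> // n a; rewrite aE /lp_norm invrK.
  rewrite (sum_opoly a (f := fun c => `|c| `^ s^-1)); last first.
    by rewrite normr0 powR0 // invr_eq0 gt_eqF.
  have [u1 u2] := multiplicative_lp ps Cge sub sup s0 B0 fB (opoly a).
  by rewrite ler_pdivrMl // u1 u2.
left; have [M fM] : exists M : R, forall n, fund p n <= M.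
  apply: contrapT => h; apply: bnd => M; apply: contrapT => h'; apply: h; exists M => n.
  by rewrite leNgt; apply/negP => h''; apply: h'; exists n.
have M0 : 0 <= M by apply: le_trans (fM 0%N); exact: (sn_ge0 ps).
(* [8] from the coefficient bound [sn_coef], and [16 * M = 2 * 8 * M] from [bounded_fund_le], both
   with the unconditionality constant 8. *)
pose Q := 8 + 16 * M; have Q0 : 0 < Q by rewrite /Q; lra.
exists Q; split=> // n a; rewrite aE /c0_norm; set A := \big[_/_]_(_ < _) _.
have A0 : 0 <= A by exact: bigmax_ge_id.
have aA i : `|(opoly a)`_i| <= A.
  case: (ltnP i n) => hi; last first.
    by rewrite nth_default ?normr0 //; apply: leq_trans (size_poly _ _) hi.
  rewrite -[i]/(val (Ordinal hi)) coef_opoly.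
  exact: (@le_bigmax _ _ _ _ (fun i : 'I_n => `|a i|) (Ordinal hi)).
have p0 := sn_ge0 ps (opoly a).
have u1 := bounded_fund_le ps fM aA.
have u2 : A <= 8 * p (opoly a).
  apply: bigmax_le; first by rewrite mulr_ge0.
  by move=> i _; rewrite -(coef_opoly a); exact: (sn_coef ps).
have v1 := mulr_ge0 M0 A0; have v2 := mulr_ge0 M0 p0.
rewrite ler_pdivrMl //; apply/andP; split; rewrite /Q; lra.
Qed.
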